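(* Let $F\in\mathrm{Diff}(\mathbb C^n,0)$ and let $\Gamma$ be an invariant formal curve of $F$. Assume that the multiplier $\lambda=(F|_\Gamma)'(0)$ satisfies $|\lambda|<1$. Then $\Gamma$ is a germ of an analytic curve at the origin, and a representative of $\Gamma$ is a stable manifold of $F$ that eventually contains any orbit of $F$ asymptotic to $\Gamma$.
   Context: $\mathrm{Diff}(\mathbb C^n,0)$ is the group of germs of biholomorphisms of $\mathbb C^n$ fixing the origin. $\hat{\mathcal O}_n=\mathbb C[[x_1,\dots,x_n]]$. A formal (irreducible) curve at $0\in\mathbb C^n$ is a prime ideal $\Gamma\subset\hat{\mathcal O}_n$ such that $\hat{\mathcal O}_n/\Gamma$ has dimension one. It is determined by an irreducible formal parametrization $\gamma(s)\in(s\mathbb C[[s]])^n\setminus\{0\}$, for which $g\in\Gamma$ if and only if $g(\gamma(s))\equiv0$. $\Gamma$ is a germ of an analytic curve if it is the ideal of $\hat{\mathcal O}_n$ generated by the ideal of convergent germs vanishing on some irreducible germ of analytic curve; equivalently, it admits a convergent parametrization. $\Gamma$ is invariant for $F$ if $h\circ F\in\Gamma$ for every $h\in\Gamma$; equivalently, there is $\theta(s)\in\mathbb C[[s]]$ with $\theta(0)=0$, $\theta'(0)\ne0$ and $F\circ\gamma=\gamma\circ\theta$. The formal one-variable diffeomorphism $\theta$, well defined up to formal conjugacy, is the restriction $F|_\Gamma$, and $(F|_\Gamma)'(0)=\theta'(0)$. A subset $B\subset V$ of an open neighborhood $V$ of $0$ on which $F$ is defined is a stable set of $F$ if $F(B)\subset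 B$ and the (positive) orbit of each point of $B$ converges to $0$. If in addition $B$ is an analytic, locally closed submanifold of $V$, then $B$ is a stable manifold of $F$. Iterated tangents of $\Gamma$: $q_0=0$ and, for $k\ge1$, $q_k$ is the point of the exceptional divisor of the blow-up at $q_{k-1}$ corresponding to the tangent line of the strict transform of $\Gamma$ at $q_{k-1}$. A non-trivial positive orbit $O=\{a_k=F^k(a_0)\}_{k\ge0}$ converging to $0$ is asymptotic to $\Gamma$ if, with $\pi_j:M_j\to M_{j-1}$ ($M_0=\mathbb C^n$) the blow-up at $q_{j-1}$, one has $\lim_{k\to\infty}\pi_j^{-1}\circ\cdots\circ\pi_1^{-1}(a_k)=q_j$ for every $j\ge1$. A set eventually contains the orbit $O$ if it contains $a_k$ for all sufficiently large $k$.
   Formalization: A representative B of Γ, with 0, is shown to be a stable manifold only when Γ is nonsingular; in general B is a stable set and B minus the origin is a stable manifold, since a singular Γ such as the cusp y²=x³ is not a submanifold at 0. *)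

(* Defs.v *)
From HB Require Import structures.
From mathcomp Require Import all_boot all_order all_algebra.
From mathcomp Require Import all_classical all_reals all_analysis.
From mathcomp Require Import complex.
From mathcomp Require mpoly.
(* The notations of mpoly clash with those of MathComp-Analysis. *)
Import -(notations) mpoly.

Set Implicit Arguments.
Unset Strict Implicit.
Unset Printing Implicit Defensive.

Import Order.TTheory GRing.Theory Num.Theory.
Import numFieldNormedType.Exports.

Local Open Scope classical_set_scope.
Local Open Scope ring_scope.

(* Complex numbers, packed as a [numClosedFieldType]: the topology of
   MathComp-Analysis on ['rV_n] is found for this form, not for a bare [R[i]]. *)
Definition Cplx (R : realType) : numClosedFieldType := R[i].

Definition fps (K : comNzRingType) (n : nat) : Type := multinom n -> K.

Section FpsRing.
Variables (K : comNzRingType) (n : nat).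
Implicit Types f g h : fps K n.

HB.instance Definition _ := GRing.Zmodule.copy (fps K n) (multinom n -> K).

Definition fpsC (c : K) : fps K n := fun m => c *+ (m == mnm0).

(* [bmultinom n d] is the finite type of multi-indices of degree [< d]. *)
Definition fps_mul f g : fps K n := fun m =>
  \sum_(k : bmultinom n (mdeg m).+1 * bmultinom n (mdeg m).+1
          | m == mnm_add k.1 k.2) f k.1 * g k.2.

Let trunc d f : mpoly n K := \sum_(k : bmultinom n d) f k *: mpolyX K k.

Let truncE d f m : (mdeg m < d)%N -> mcoeff m (trunc d f) = f m.
Proof.
move=> md; rewrite /trunc raddf_sum /= (bigD1 (BMultinom md)) //=.
rewrite mcoeffZ mcoeffX eqxx mulr1 big1 ?addr0 // => k kNm.
by rewrite mcoeffZ mcoeffX -(bmeqP k (BMultinom md)) (negbTE kNm) mulr0.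
Qed.

Let eq_mcoeffM (p q p' q' : mpoly n K) m :
    (forall k, (mdeg k < (mdeg m).+1)%N -> mcoeff k p = mcoeff k p') ->
    (forall k, (mdeg k < (mdeg m).+1)%N -> mcoeff k q = mcoeff k q') ->
  mcoeff m (p * q) = mcoeff m (p' * q').
Proof.
move=> pp' qq'; rewrite !mcoeffM; apply: eq_bigr => -[k l] _ /=.
by rewrite pp' ?qq' ?bmdeg.
Qed.

Let fps_mulE d f g m : (mdeg m < d)%N ->
  fps_mul f g m = mcoeff m (trunc d f * trunc d g).
Proof.
move=> md; rewrite mcoeffM; apply: eq_bigr => -[k l] _ /=.
by rewrite !truncE // (leq_trans (bmdeg _)).
Qed.

Let trunc_mul d f g m : (mdeg m < d)%N ->
  mcoeff m (trunc d (fps_mul f g)) = mcoeff m (trunc d f * trunc d g).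
Proof. by move=> md; rewrite truncE // (fps_mulE _ _ md). Qed.

Let fps_mulA : associative fps_mul.
Proof.
move=> f g h; apply/funext => m; rewrite !(fps_mulE _ _ (ltnSn (mdeg m))).
transitivity (mcoeff m (trunc (mdeg m).+1 f *
                (trunc (mdeg m).+1 g * trunc (mdeg m).+1 h))).
  by apply: eq_mcoeffM => // k; apply: trunc_mul.
by rewrite mulrA; apply: eq_mcoeffM => // k km; rewrite trunc_mul.
Qed.

Let fps_mulC : commutative fps_mul.
Proof.
by move=> f g; apply/funext => m; rewrite !(fps_mulE _ _ (ltnSn _)) mulrC.
Qed.

Let fps_mul1 : left_id (fpsC 1) fps_mul.
Proof.
move=> f; apply/funext => m; rewrite (fps_mulE _ _ (ltnSn _)).
rewrite -[RHS](truncE f (ltnSn (mdeg m))) -[in RHS](mul1r (trunc _ f)).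
by apply: eq_mcoeffM => // k km; rewrite truncE // mcoeff1.
Qed.

Let fps_mulDl : left_distributive fps_mul +%R.
Proof.
move=> f g h; apply/funext => m; rewrite /fps_mul.
rewrite -[RHS]big_split /=; apply: eq_bigr => k _.
by rewrite -mulrDl.
Qed.

Let fps_1neq0 : fpsC 1 != 0.
Proof.
apply/eqP => /(congr1 (fun f : fps K n => f mnm0)).
by rewrite /fpsC eqxx => /eqP; rewrite oner_eq0.
Qed.

HB.instance Definition _ := GRing.Zmodule_isComNzRing.Build (fps K n)
  fps_mulA fps_mulC fps_mul1 fps_mulDl fps_1neq0.

End FpsRing.

(* The substitution [h o G]; it is meaningful when every [G i] has zero constant
   term, since then [\prod_i G i ^+ k i] has order at least [mdeg k] and the
   truncated sum is the whole sum. *)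
Definition fps_comp (K : comNzRingType) (n p : nat) (h : fps K n)
    (G : 'I_n -> fps K p) : fps K p := fun m =>
  \sum_(k : bmultinom n (mdeg m).+1) h k * (\prod_i G i ^+ k i) m.

Definition coef1 (K : comNzRingType) (f : fps K 1) (k : nat) : K :=
  f (Multinom [tuple k]).

Section Ideals.
Variable T : comNzRingType.
Implicit Types A I J P : set T.

(* Ideals of a subring [A] of [T], so as to treat convergent series inside formal
   series; the predicates of ring_quotient only cover [A = setT]. *)
Definition ideal_of A I :=
  [/\ I `<=` A, I 0, forall f g, I f -> I g -> I (f + g)
    & forall a f, A a -> I f -> I (a * f)].

Definition prime_of A P :=
  [/\ ideal_of A P, ~ P 1 & forall f g, A f -> A g -> P (f * g) -> P f \/ P g].

Definition prime_chain A I (d : nat) := exists P : nat -> set T,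
  (forall i, (i <= d)%N -> prime_of A (P i) /\ I `<=` P i) /\
  (forall i, (i < d)%N -> P i `<` P i.+1).

(* Krull dimension of [A / I]; longer chains truncate to length [d.+1]. *)
Definition quotient_dim A I (d : nat) :=
  prime_chain A I d /\ ~ prime_chain A I d.+1.

Definition generated_ideal J : set T := [set g | exists k (a b : 'I_k -> T),
  (forall i, J (b i)) /\ g = \sum_i a i * b i].

End Ideals.

Section Holomorphic.
Variables (R : realType) (n : nat).
Local Notation C := (Cplx R).
Implicit Types (p : fps C n) (f : 'rV[C]_n -> C) (a z : 'rV[C]_n).
Implicit Types (B U V W : set 'rV[C]_n).

(* Absolute convergence at [(r, .., r)]; [0 < r] forces [r] to be real. *)
Definition convergent : set (fps C n) := [set p : fps C n | exists r M : C, 0 < r /\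
  forall N, \sum_(k : bmultinom n N) `|p k| * r ^+ mdeg k <= M].

Definition psum p z (N : nat) : C :=
  \sum_(k : bmultinom n N) p k * \prod_i z 0 i ^+ k i.

Definition expansion f a p := convergent p /\
  \forall z \near (0 : 'rV[C]_n), psum p z @ \oo --> f (a + z).

(* The Taylor series of [f] at [a], when [f] is holomorphic at [a]. *)
Definition taylor f a : fps C n := xget 0 (expansion f a).

Definition holomorphic_at f a := exists p, expansion f a p.

Definition holomorphic (m : nat) U (f : 'rV[C]_n -> 'rV[C]_m) :=
  forall a, U a -> forall j, holomorphic_at (fun z => f z 0 j) a.

End Holomorphic.

Section Dynamics.
Variables (R : realType) (n : nat).
Local Notation C := (Cplx R).
Implicit Types (B U V W : set 'rV[C]_n) (F : 'rV[C]_n -> 'rV[C]_n).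
Implicit Types (Gamma : set (fps C n)) (c : 'I_n -> fps C 1).

Definition biholomorphic U W F :=
  [/\ open U, open W, holomorphic U F
    & exists H : 'rV[C]_n -> 'rV[C]_n,
      [/\ holomorphic W H, forall z, U z -> W (F z) /\ H (F z) = z
        & forall w, W w -> U (H w) /\ F (H w) = w]].

(* [F], considered on [U] only, represents an element of Diff(C^n, 0). *)
Definition diffeo_germ U F :=
  [/\ U 0, F 0 = 0 & exists W, biholomorphic U W F].

Definition jet F : 'I_n -> fps C n := fun i => taylor (fun z => F z 0 i) 0.

Definition formal_curve Gamma :=
  prime_of setT Gamma /\ quotient_dim setT Gamma 1.

Definition invariant_curve F Gamma :=
  forall h, Gamma h -> Gamma (fps_comp h (jet F)).

Definition parametrization c :=
  (forall i, coef1 (c i) 0 = 0) /\ exists i, c i <> 0.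

Definition irreducible_parametrization c := parametrization c /\
  forall (d : 'I_n -> fps C 1) (s : fps C 1), parametrization d ->
    coef1 s 0 = 0 -> (forall i, c i = fps_comp (d i) (fun=> s)) ->
    coef1 s 1 <> 0.

Definition parametrizes c Gamma := irreducible_parametrization c /\
  forall g, Gamma g <-> fps_comp g c = 0.

(* [lam = (F|_Gamma)'(0)], where the restriction [F|_Gamma] is the series [t]; it does
   not depend on the choice of [c] and [t]. *)
Definition multiplier F Gamma (lam : C) :=
  exists (c : 'I_n -> fps C 1) (t : fps C 1),
    [/\ parametrizes c Gamma, coef1 t 0 = 0, coef1 t 1 <> 0,
        forall i, fps_comp (jet F i) c = fps_comp (c i) (fun=> t)
      & lam = coef1 t 1].

Definition nonsingular Gamma :=
  exists c, parametrizes c Gamma /\ exists i, coef1 (c i) 1 <> 0.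

(* Sets [B] are considered here as germs at [0]. *)
Definition analytic_germ B := exists U k (f : 'I_k -> 'rV[C]_n -> C),
  [/\ open U, U 0, forall i a, U a -> holomorphic_at (f i) a
    & forall z, U z -> (B z <-> forall i, f i z = 0)].

Definition germ_ideal B : set (fps C n) := [set g : fps C n | convergent g /\
  \forall z \near (0 : 'rV[C]_n), B z -> psum g z @ \oo --> (0 : C)].

Definition irreducible_curve_germ B :=
  [/\ analytic_germ B, prime_of (@convergent R n) (germ_ideal B)
    & quotient_dim (@convergent R n) (germ_ideal B) 1].

Definition represents B Gamma :=
  irreducible_curve_germ B /\ Gamma = generated_ideal (germ_ideal B).

Definition analytic_curve Gamma := exists B, represents B Gamma.

Definition stable_set U F V B :=
  [/\ [/\ open V, V 0 & V `<=` U], B `<=` V, F @` B `<=` B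
    & forall z, B z -> (fun k => iter k F z) @ \oo --> (0 : 'rV[C]_n)].

Definition locally_closed B := exists O D : set 'rV[C]_n,
  [/\ open O, closed D & B = O `&` D].

Definition analytic_submanifold B := exists d, (d <= n)%N /\
  forall b, B b -> exists W W' (phi : 'rV[C]_n -> 'rV[C]_n),
    [/\ W b, biholomorphic W W' phi
      & forall z, W z -> (B z <-> forall i : 'I_n, (d <= i)%N -> phi z 0 i = 0)].

(* [B] need not contain [0]: a representative of a singular curve is a manifold
   only away from [0]. *)
Definition stable_manifold U F V B :=
  [/\ stable_set U F V B, locally_closed B & analytic_submanifold B].

Definition tangent_line c (v : 'rV[C]_n) := v <> 0 /\
  exists (nu : nat) (x : C), x <> 0 /\ forall l,
    coef1 (c l) nu = x * v 0 l /\ forall k, (k < nu)%N -> coef1 (c l) k = 0.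

(* The blow-up of C^n at [0] in the i-th affine chart, centred at the point of the
   exceptional divisor that corresponds to the line [C v], where [v 0 i = 1]. *)
Definition blowup_chart (i : 'I_n) (v u : 'rV[C]_n) : 'rV[C]_n :=
  \row_l (if l == i then u 0 i else u 0 i * (v 0 l + u 0 l)).

(* [c'] is the strict transform of [c] in this chart. *)
Definition strict_transform (i : 'I_n) (v : 'rV[C]_n) c (c' : 'I_n -> fps C 1) :=
  c' i = c i /\ forall l, l <> i -> c l = c i * (fpsC (v 0 l) + c' l).

(* [cs j] is the strict transform of [c] in the chart centred at [q_j], in which
   the tangent line is spanned by [v j]; that line is the point [q_j.+1], and it is
   the centre of the chart of index [i j] of the blow-up at [q_j]. *)
Definition iterated_tangents c (i : nat -> 'I_n) (v : nat -> 'rV[C]_n)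
    (cs : nat -> 'I_n -> fps C 1) := cs 0%N = c /\ forall j,
  [/\ tangent_line (cs j) (v j), v j 0 (i j) = 1
    & strict_transform (i j) (v j) (cs j) (cs j.+1)].

Fixpoint blowdown (i : nat -> 'I_n) (v : nat -> 'rV[C]_n) (j : nat)
    (u : 'rV[C]_n) : 'rV[C]_n :=
  if j is j'.+1 then blowdown i v j' (blowup_chart (i j') (v j') u) else u.

Definition nontrivial_orbit U F (a : nat -> 'rV[C]_n) :=
  [/\ forall k, U (a k), forall k, a k.+1 = F (a k) & a 0%N <> 0].

(* [blowdown i v j] is pi_1 o .. o pi_j in the chart centred at [q_j]. It is
   injective over the complement of [0], so that [u k] is the coordinate vector of
   the lift of [a k] to [M_j]; for [j = 0] the condition is that [a] tends to [0]. *)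
Definition asymptotic (a : nat -> 'rV[C]_n) Gamma :=
  exists c i v cs, [/\ parametrizes c Gamma, iterated_tangents c i v cs &
    forall j, exists u : nat -> 'rV[C]_n,
      (\forall k \near \oo, blowdown i v j (u k) = a k) /\
      u @ \oo --> (0 : 'rV[C]_n)].

End Dynamics.

(* Main.v *)
(** Since |lam| < 1, a parametrization [c] of [Gamma] can be chosen with F (c(s)) = c(lam s)
   (Koenigs), and the recursion (lam^k - DF(0)) c_k = (terms of lower order), with lam^k -> 0,
   makes [c] convergent by majorants.  A convergent change of parameter turns [c] into [d] with
   one coordinate equal to s^nu.  Norms of linear forms along x = s^nu are holomorphic equations
   for the arc B = {d(s) : |s| < rho}; Weierstrass-type division by characteristic polynomials and
   elimination over the valuation ring of convergent series show that [Gamma] is generated by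
   convergent series.  On [B] the map is conjugate to a contraction, so [B] is stable.
   Along an orbit asymptotic to [Gamma], every g in Gamma is O(|x|^M) for every M, because each
   blow-up divides g and x by the exceptional coordinate while lowering only the order of x^M.
   So the orbit is O(|x|^M)-close to [B] while |x| decreases at least geometrically; pulling this
   back by F^-1, whose Lipschitz constant is fixed, shows that the orbit lies in the closure of
   [B], hence in [B]. *)

From HB Require Import structures.
From mathcomp Require Import all_boot all_order all_algebra.
From mathcomp Require Import all_classical all_reals all_analysis.
From mathcomp Require Import cyclic separable cyclotomic complex ring lra zify.
From mathcomp Require mpoly.
Import -(notations) mpoly.
Require Import Defs.
Import Order.TTheory GRing.Theory Num.Theory.
Import numFieldNormedType.Exports.
Local Open Scope classical_set_scope.
Local Open Scope ring_scope.

Set Implicit Arguments.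
Unset Strict Implicit.
Unset Printing Implicit Defensive.

(** * Formal power series *)

(** The analysis rests on one weighted l^1 norm of power series. It is submultiplicative and
    compatible with substitution, so that convergence, composition and evaluation reduce to
    estimates on coefficients, without Cauchy integrals. The condition |lam| < 1 removes small
    divisors: lam^k - DF(0) tends to - DF(0), which is invertible because F is a local
    diffeomorphism. The obstacle is that the curve may be singular. It is then no graph over a
    coordinate, only a branched cover x = s^nu on which the nu-th roots of unity act by s -> zeta s.
    Norms for this action replace the equations of a graph, in the algebra of the ideal as well as
    in the analysis. A small norm of one linear form only says that this form is close to its value
    at one of the nu points over x, and the point may change with the form. With nu * n + 1 forms,
    at least n of them select the same point, and these n determine it. Used with error 0, this
    estimate gives the equations of the arc; used with a positive error, it gives the distance from
    an orbit to the arc. *)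

Section MultinomSums.
Context {n : nat} {V : nmodType}.
Implicit Types (m k : multinom n) (F : multinom n -> V) (N M : nat).
Local Notation bm := (bmultinom n).

Lemma bmsum_eq N m F :
  \sum_(k : bm N | m == k :> multinom n) F k = if (mdeg m < N)%N then F m else 0.
Proof.
case: ifP => [mN|mN].
  by rewrite (big_pred1 (BMultinom mN)) // => k; rewrite eq_sym.
by apply: big1 => k /eqP mk; move: mN; rewrite mk bmdeg.
Qed.

Lemma bmsum_lt N M F : (M <= N)%N ->
  \sum_(k : bm N | (mdeg k < M)%N) F k = \sum_(k : bm M) F k.
Proof.
move=> MN; pose w (k : bm M) := BMultinom (leq_trans (bmdeg k) MN).
have winj : injective w by move=> k l /(congr1 val) /= kl; exact: val_inj.
rewrite -(big_map w xpredT (fun k : bm N => F k)) /=.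
rewrite [RHS]big_uniq /= ?map_inj_uniq ?index_enum_uniq //=.
apply: eq_bigl => k; apply/idP/mapP => [kM|[j _ ->] /=]; last by case: j.
by exists (BMultinom kM); rewrite ?mem_index_enum //; apply: val_inj.
Qed.

Lemma bmsum_widen N M (P : pred (multinom n)) F : (M <= N)%N ->
    (forall k, P k -> (mdeg k < M)%N) ->
  \sum_(k : bm N | P k) F k = \sum_(k : bm M | P k) F k.
Proof.
move=> MN PM; rewrite [RHS]big_mkcond /=.
rewrite -(bmsum_lt (fun k => if P k then F k else 0) MN).
rewrite [RHS]big_mkcond [LHS]big_mkcond; apply: eq_bigr => k _.
by case: ifP => [/PM ->//|]; case: ifP.
Qed.

Lemma bmsum_split N M F : (M <= N)%N ->
  \sum_(k : bm N) F k =
    \sum_(k : bm M) F k + \sum_(k : bm N | (M <= mdeg k)%N) F k.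
Proof.
move=> MN; rewrite (bigID (fun k : bm N => (mdeg k < M)%N)) /= bmsum_lt //.
by congr (_ + _); apply: eq_bigl => k; rewrite -leqNgt.
Qed.

(** Regroups the coefficients of a truncated product: of the full square of pairs, only those of
    total degree below [N] remain. Estimates for products compare this part with the square. *)
Lemma bmsum_pairs N (Phi : multinom n -> multinom n -> V) :
  \sum_(m : bm N) \sum_(k : bm N * bm N | m == mnm_add k.1 k.2 :> multinom n)
      Phi k.1 k.2 =
  \sum_(k : bm N * bm N | (mdeg k.1 + mdeg k.2 < N)%N) Phi k.1 k.2.
Proof.
under eq_bigr do rewrite big_mkcond /=.
rewrite exchange_big [RHS]big_mkcond; apply: eq_bigr => -[k l] _ /=.
rewrite -big_mkcond /= -mdegD.
under eq_bigl do rewrite eq_sym.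
exact: (bmsum_eq N (mnm_add k l) (fun=> Phi k l)).
Qed.

End MultinomSums.

Section FpsTheory.
Context {K : comNzRingType} {n : nat}.
Implicit Types (f g h : fps K n) (m k : multinom n) (d N : nat).

Lemma fpsP f g : (forall m, f m = g m) -> f = g.
Proof. by move=> fg; apply/funext. Qed.

Lemma fpsD f g m : (f + g) m = f m + g m. Proof. by []. Qed.
Lemma fpsN f m : (- f) m = - f m. Proof. by []. Qed.
Lemma fpsB f g m : (f - g) m = f m - g m. Proof. by []. Qed.
Lemma fps0 m : (0 : fps K n) m = 0. Proof. by []. Qed.

Lemma fps_sum (I : Type) (r : seq I) (P : pred I) (F : I -> fps K n) m :
  (\sum_(i <- r | P i) F i) m = \sum_(i <- r | P i) F i m.
Proof. by elim/big_rec2: _ => // i x y _ <-. Qed.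

Lemma fps1E m : (1 : fps K n) m = (m == mnm0)%:R. Proof. by []. Qed.

(** The condition m = k + l already bounds both degrees, so the range fixed in the definition of the
    product can be any larger one, common to several coefficients. *)
Lemma fpsME N f g m : (mdeg m < N)%N ->
  (f * g) m = \sum_(k : bmultinom n N * bmultinom n N
                     | m == mnm_add k.1 k.2) f k.1 * g k.2.
Proof.
move=> mN; rewrite -[LHS]/(fps_mul f g m) /fps_mul.
have pairE d : \sum_(k : bmultinom n d * bmultinom n d | m == mnm_add k.1 k.2) f k.1 * g k.2 =
    \sum_(k : bmultinom n d) \sum_(l : bmultinom n d | m == mnm_add k l) f k * g l.
  by rewrite pair_big_dep.
rewrite !pairE.
have inner k : \sum_(l : bmultinom n N | m == mnm_add k l) f k * g l =
     \sum_(l : bmultinom n (mdeg m).+1 | m == mnm_add k l) f k * g l.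
  apply: (@bmsum_widen n K N _ (fun l => m == mnm_add k l) (fun l => f k * g l)) => //.
  by move=> l /eqP ->; rewrite mdegD ltnS leq_addl.
under [RHS]eq_bigr do rewrite inner.
rewrite [RHS](bmsum_split (fun k => \sum_(l : bmultinom n (mdeg m).+1 | m == mnm_add k l) f k * g l) mN).
rewrite [X in _ + X]big1 ?addr0 // => k mk.
apply: big1 => l /eqP ml; move: mk; rewrite {1}ml mdegD.
by rewrite ltnNge leq_addr.
Qed.

(* Congruence modulo the d-th power of the maximal ideal. *)
Definition eqd d f g := forall m, (mdeg m < d)%N -> f m = g m.

Lemma eqd_refl d f : eqd d f f. Proof. by []. Qed.
Lemma eqd_sym d f g : eqd d f g -> eqd d g f.
Proof. by move=> fg m md; rewrite fg. Qed.
Lemma eqd_trans d f g h : eqd d f g -> eqd d g h -> eqd d f h.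
Proof. by move=> fg gh m md; rewrite fg // gh. Qed.
Lemma eqdP f g : (forall d, eqd d f g) -> f = g.
Proof. by move=> fg; apply: fpsP => m; apply: (fg (mdeg m).+1). Qed.

Lemma eqdD d f g f' g' : eqd d f f' -> eqd d g g' -> eqd d (f + g) (f' + g').
Proof. by move=> ff gg m md; rewrite !fpsD ff ?gg. Qed.
Lemma eqdN d f f' : eqd d f f' -> eqd d (- f) (- f').
Proof. by move=> ff m md; rewrite !fpsN ff. Qed.
Lemma eqd_sub0 d f g : eqd d (f - g) 0 <-> eqd d f g.
Proof.
split=> fg m md; last by rewrite fpsB fg ?subrr.
by have /eqP := fg m md; rewrite fpsB subr_eq0 => /eqP.
Qed.

Lemma eqdM0 d e f g : eqd d f 0 -> eqd e g 0 -> eqd (d + e) (f * g) 0.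
Proof.
move=> f0 g0 m md; rewrite (fpsME f g (ltnSn _)); apply: big1 => -[k l] /= /eqP mkl.
have [kd|kd] := ltnP (mdeg k) d; first by rewrite f0 ?mul0r.
rewrite g0 ?mulr0 //; move: md; rewrite {1}mkl mdegD => md.
by rewrite -(ltn_add2l d); apply: leq_ltn_trans md; rewrite leq_add2r.
Qed.

Lemma eqdM d f g f' g' : eqd d f f' -> eqd d g g' -> eqd d (f * g) (f' * g').
Proof.
move=> /eqd_sub0 ff /eqd_sub0 gg; apply/eqd_sub0.
have -> : f * g - f' * g' = f * (g - g') + (f - f') * g' by ring.
rewrite -[0]addr0; apply: eqdD.
  by rewrite -[d]add0n; apply: eqdM0 => // m; rewrite ltn0.
by rewrite -[d]addn0; apply: eqdM0 => // m; rewrite ltn0.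
Qed.

Lemma eqd_sum d (I : Type) (r : seq I) (P : pred I) (F G : I -> fps K n) :
  (forall i, P i -> eqd d (F i) (G i)) ->
  eqd d (\sum_(i <- r | P i) F i) (\sum_(i <- r | P i) G i).
Proof. by move=> FG; elim/big_rec2: _ => // i x y Pi; apply: eqdD; exact: FG. Qed.

Lemma eqd_prod d (I : Type) (r : seq I) (P : pred I) (F G : I -> fps K n) :
  (forall i, P i -> eqd d (F i) (G i)) ->
  eqd d (\prod_(i <- r | P i) F i) (\prod_(i <- r | P i) G i).
Proof. by move=> FG; elim/big_rec2: _ => // i x y Pi; apply: eqdM; exact: FG. Qed.

Lemma eqdX d f g (k : nat) : eqd d f g -> eqd d (f ^+ k) (g ^+ k).
Proof. by move=> fg; elim: k => // k IH; rewrite !exprS; apply: eqdM. Qed.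

Lemma eqd1 f : eqd 1 f 0 <-> f mnm0 = 0.
Proof.
split=> [|f0 m]; first by apply; rewrite mdeg0.
by rewrite ltnS leqn0 mdeg_eq0 => /eqP ->.
Qed.

Lemma eqdX0 d f (k : nat) : eqd d f 0 -> eqd (k * d)%N (f ^+ k) 0.
Proof. by move=> f0; elim: k => // k IH; rewrite exprS mulSn; apply: eqdM0. Qed.

Lemma fpsC_mul c f m : (fpsC c * f) m = c * f m.
Proof.
rewrite (fpsME _ f (ltnSn (mdeg m))).
rewrite (bigD1 (bm0, BMultinom (ltnSn (mdeg m)))) /= ?Monoid.mul1m //.
rewrite big1 /fpsC ?eqxx ?addr0 // => -[k l] /andP[/eqP mkl kl] /=.
case: eqP => k0; last by rewrite mul0r.
case/negP: kl; rewrite -pair_eqE /=; apply/andP; split; apply/eqP/val_inj => //=.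
by rewrite [RHS]mkl /= k0 Monoid.mul1m.
Qed.

Lemma fpsC_is_additive : additive (@fpsC K n).
Proof. by move=> a b; apply: fpsP => m; rewrite fpsB /fpsC mulrnBl. Qed.
HB.instance Definition _ := GRing.isAdditive.Build K (fps K n) (@fpsC K n) fpsC_is_additive.
Lemma fpsC_is_multiplicative : multiplicative (@fpsC K n).
Proof.
split=> // a b; apply: fpsP => m; rewrite fpsC_mul /fpsC.
by rewrite mulrnAr.
Qed.
HB.instance Definition _ :=
  GRing.isMultiplicative.Build K (fps K n) (@fpsC K n) fpsC_is_multiplicative.

Lemma fpsM0 f g : (f * g) mnm0 = f mnm0 * g mnm0.
Proof.
have m0 : (mdeg (mnm0 : multinom n) < 1)%N by rewrite mdeg0.
rewrite (fpsME _ _ m0) (big_pred1 (bm0, bm0)) //= => -[k l] /=.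
rewrite eq_sym mnmD_eq0.
by rewrite xpair_eqE.
Qed.

Lemma fpsX0 f (k : nat) : (f ^+ k) mnm0 = f mnm0 ^+ k.
Proof.
by elim: k => [|k IH]; rewrite ?expr0 ?fps1E ?eqxx // !exprS fpsM0 IH.
Qed.

Definition fpsX (i : 'I_n) : fps K n := fun m => (m == mnm1 i)%:R.

Lemma fpsXM0 i f m : m i = 0%N -> (fpsX i * f) m = 0.
Proof.
move=> mi; rewrite (fpsME _ f (ltnSn (mdeg m))); apply: big1 => -[k l] /eqP /= mkl.
rewrite /fpsX; case: eqP => ki; last by rewrite mul0r.
by move: (mnmDE i k l); rewrite -mkl mi ki mnm1E eqxx.
Qed.

Lemma fpsXMS i f m : (fpsX i * f) (mnm_add (mnm1 i) m) = f m.
Proof.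
set m' := mnm_add _ m; have m'E : mdeg m' = (mdeg m).+1 by rewrite mdegD mdeg1.
have i' : (mdeg (mnm1 i) < (mdeg m').+1)%N by rewrite mdeg1 m'E.
have mm : (mdeg m < (mdeg m').+1)%N by rewrite m'E ltnS.
rewrite (fpsME _ f (ltnSn (mdeg m'))) (bigD1 (BMultinom i', BMultinom mm)) //=.
rewrite big1 /fpsX ?eqxx ?addr0 ?mul1r // => -[k l] /andP[/eqP /= mkl kl].
case: eqP => ki; last by rewrite mul0r.
case/negP: kl; rewrite -pair_eqE /=; apply/andP; split; apply/eqP/val_inj => //=.
by move: mkl; rewrite ki => /addmI.
Qed.

Lemma fpsXME i f m :
  (fpsX i * f) m = if m i == 0%N then 0 else f (mnm_sub m (mnm1 i)).
Proof.
case: eqP => [|/eqP mi]; first exact: fpsXM0.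
rewrite -{1}(@submK _ (mnm1 i) m) ?lep1mP // addmC fpsXMS.
by [].
Qed.

Lemma fpsX_div i f : (forall m, m i = 0%N -> f m = 0) ->
  f = fpsX i * (fun m => f (mnm_add (mnm1 i) m)).
Proof.
move=> f0; apply: fpsP => m; rewrite fpsXME; case: eqP => [/f0 //|/eqP mi].
by rewrite addmC submK // lep1mP.
Qed.

End FpsTheory.
Arguments fpsX {K n} i.
Arguments eqd {K n}.

Section FpsComp.
Context {K : comNzRingType} {n p : nat}.
Implicit Types (f g h : fps K n) (G H : 'I_n -> fps K p) (k : multinom n) (m : multinom p) (d N : nat).

Definition mmon (G : 'I_n -> fps K p) (k : multinom n) : fps K p := \prod_i G i ^+ k i.

Lemma mmonD G k l : mmon G (mnm_add k l) = mmon G k * mmon G l.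
Proof. by rewrite /mmon -big_split; apply: eq_bigr => i _; rewrite mnmDE exprD. Qed.

Lemma mmon0 G : mmon G mnm0 = 1.
Proof. by rewrite /mmon big1 // => i _; rewrite mnm0E. Qed.

Lemma mmon1 G i : mmon G (mnm1 i) = G i.
Proof.
rewrite /mmon (bigD1 i) //= mnm1E eqxx expr1 big1 ?mulr1 // => j ji.
by rewrite mnm1E eq_sym (negbTE ji).
Qed.

Lemma eqd_mmon d G H k : (forall i, eqd d (G i) (H i)) -> eqd d (mmon G k) (mmon H k).
Proof. by move=> GH; apply: eqd_prod => i _; apply: eqdX. Qed.

Definition const0 (q : nat) (G : 'I_q -> fps K p) := forall i, G i mnm0 = 0.

Lemma mmon_ord G k : const0 G -> eqd (mdeg k) (mmon G k) 0.
Proof.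
move=> G0; rewrite mdegE /mmon.
elim/big_ind2: _ => [m|d f e g fd ge|i _]; first by rewrite ltn0.
  exact: eqdM0.
by rewrite -[X in eqd X]muln1; apply: eqdX0; apply/eqd1.
Qed.

(** A finite sum in the ring of series, whereas the range of the sum in [fps_comp] depends on the
    coefficient. Identities are proved here and transferred by [eqd_psub]. *)
Definition psub N f G : fps K p := \sum_(k : bmultinom n N) fpsC (f k) * mmon G k.

Lemma psubE N f G m : psub N f G m = \sum_(k : bmultinom n N) f k * mmon G k m.
Proof. by rewrite /psub fps_sum; apply: eq_bigr => k _; rewrite fpsC_mul. Qed.

Lemma fps_compE f G m : fps_comp f G m = psub (mdeg m).+1 f G m.
Proof. by rewrite psubE. Qed.

Lemma eqd_psub N f G : const0 G -> eqd N (fps_comp f G) (psub N f G).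
Proof.
move=> G0 m mN; rewrite fps_compE !psubE.
rewrite [RHS](bmsum_split (fun k => f k * mmon G k m) mN).
rewrite [X in _ + X]big1 ?addr0 // => k mk.
by rewrite mmon_ord ?mulr0.
Qed.

Lemma eqd_comp_l d f g G : const0 G -> eqd d f g -> eqd d (fps_comp f G) (fps_comp g G).
Proof.
move=> G0 fg m md; rewrite !fps_compE !psubE; apply: eq_bigr => k _.
by rewrite fg // (leq_trans (bmdeg k)).
Qed.

Lemma fps_comp_ext f G H : (forall i, G i = H i) -> fps_comp f G = fps_comp f H.
Proof. by move=> GH; congr fps_comp; apply/funext. Qed.

Lemma fps_compD f g G : fps_comp (f + g) G = fps_comp f G + fps_comp g G.
Proof.
apply: fpsP => m; rewrite fpsD /fps_comp -big_split; apply: eq_bigr => k _.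
by rewrite fpsD mulrDl.
Qed.

Lemma fps_compN f G : fps_comp (- f) G = - fps_comp f G.
Proof.
apply: fpsP => m; rewrite fpsN /fps_comp -sumrN; apply: eq_bigr => k _.
by rewrite fpsN mulNr.
Qed.

Lemma fps_compB f g G : fps_comp (f - g) G = fps_comp f G - fps_comp g G.
Proof. by rewrite fps_compD fps_compN. Qed.

Lemma fps_comp0 G : fps_comp 0 G = 0.
Proof. by apply: (addrI (fps_comp 0 G)); rewrite -fps_compD !addr0. Qed.

Lemma fps_comp_sum G (I : Type) (r : seq I) (P : pred I) (F : I -> fps K n) :
  fps_comp (\sum_(i <- r | P i) F i) G = \sum_(i <- r | P i) fps_comp (F i) G.
Proof. by apply: (big_morph (fun f => fps_comp f G) (fun f g => fps_compD f g G) (fps_comp0 G)). Qed.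

Lemma fps_compC c G : fps_comp (fpsC c) G = fpsC c.
Proof.
apply: fpsP => m; rewrite fps_compE psubE (bigD1 bm0) //= /fpsC eqxx mulr1n mmon0 big1.
  by rewrite addr0 fps1E mulr_natr.
move=> k k0; case: eqP => [k00|]; last by rewrite mul0r.
by case/negP: k0; apply/eqP/val_inj.
Qed.

Lemma fps_comp1 G : fps_comp 1 G = 1.
Proof. by rewrite -[1](rmorph1 (@fpsC K n)) fps_compC rmorph1. Qed.

Lemma fps_compX i G : const0 G -> fps_comp (fpsX i) G = G i.
Proof.
move=> G0; apply: fpsP => m; rewrite fps_compE psubE.
have [m0|m0] := leqP 1 (mdeg m).
  have i1 : (mdeg (mnm1 i) < (mdeg m).+1)%N by rewrite mdeg1.
  rewrite (bigD1 (BMultinom i1)) //= /fpsX eqxx mul1r mmon1 big1 ?addr0 // => k ki.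
  case: eqP => [k1|]; last by rewrite mul0r.
  by case/negP: ki; apply/eqP/val_inj.
have -> : G i m = 0.
  by move: m0; rewrite ltnS leqn0 mdeg_eq0 => /eqP ->.
apply: big1 => k _; rewrite /fpsX; case: eqP => [k1|]; last by rewrite mul0r.
by have := bmdeg k; rewrite k1 mdeg1 ltnS leqNgt m0.
Qed.

(** Modulo degree [d] both sides are sums over pairs of multi-indices. They differ by the pairs of
    total degree at least [d], whose monomials in [G] have order at least [d]. *)
Lemma fps_compM f g G : const0 G -> fps_comp (f * g) G = fps_comp f G * fps_comp g G.
Proof.
move=> G0; apply: eqdP => d.
apply: (eqd_trans (eqd_psub _ G0)).
apply/eqd_sym/(eqd_trans (eqdM (eqd_psub f G0) (eqd_psub g G0))).
rewrite /psub big_distrlr pair_big /=.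
set Phi := fun k l : multinom n => fpsC (f k) * mmon G k * (fpsC (g l) * mmon G l).
have -> : \sum_(k : bmultinom n d) fpsC ((f * g) k) * mmon G k =
    \sum_(k : bmultinom n d * bmultinom n d | (mdeg k.1 + mdeg k.2 < d)%N) Phi k.1 k.2.
  rewrite -(bmsum_pairs d Phi); apply: eq_bigr => k _.
  rewrite (fpsME f g (bmdeg k)) rmorph_sum mulr_suml; apply: eq_bigr => -[l1 l2] /eqP -> /=.
  by rewrite /Phi rmorphM mmonD /=; ring.
rewrite (bigID (fun k : bmultinom n d * bmultinom n d => (mdeg k.1 + mdeg k.2 < d)%N)) /=.
rewrite -[X in eqd _ _ X]addr0; apply: eqdD => // m md.
rewrite fps_sum big1 // => -[k l] /=; rewrite -leqNgt => dkl.
have -> : fpsC (f k) * mmon G k * (fpsC (g l) * mmon G l) =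
   fpsC (f k * g l) * mmon G (mnm_add k l) by rewrite rmorphM mmonD /=; ring.
by rewrite fpsC_mul mmon_ord ?mulr0 // mdegD (leq_trans md).
Qed.

Lemma fps_compXn f (k : nat) G : const0 G -> fps_comp (f ^+ k) G = fps_comp f G ^+ k.
Proof. by move=> G0; elim: k => [|k IH]; rewrite ?expr0 ?fps_comp1 // !exprS fps_compM ?IH. Qed.

Lemma fps_comp_prod G (I : Type) (r : seq I) (P : pred I) (F : I -> fps K n) : const0 G ->
  fps_comp (\prod_(i <- r | P i) F i) G = \prod_(i <- r | P i) fps_comp (F i) G.
Proof.
by move=> G0; apply: (big_morph (fun f => fps_comp f G) (fun f g => fps_compM f g G0) (fps_comp1 G)).
Qed.

Lemma fps_comp_const f G : const0 G -> fps_comp f G mnm0 = f mnm0.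
Proof.
move=> G0; rewrite (eqd_psub (N := 1) _ G0) ?mdeg0 // psubE (big_pred1 bm0) => [|k].
  by rewrite mmon0 fps1E eqxx mulr1.
by apply/esym/eqP/val_inj/eqP; rewrite /= -mdeg_eq0 -leqn0 -ltnS bmdeg.
Qed.

(** A monomial of degree at least 2 in series without constant term has two factors of positive
    order. Changing one factor modulo degree d therefore changes the product only modulo degree d +
    1. This gain makes the implicit equations below contractions for the adic topology. *)
Lemma eqd_comp_ord2 d f G H : const0 G -> const0 H -> eqd 2 f 0 ->
  (forall i, eqd d (G i) (H i)) -> eqd d.+1 (fps_comp f G) (fps_comp f H).
Proof.
move=> G0 H0 f2 GH m md; rewrite !fps_compE !psubE; apply: eq_bigr => k _.
have [k2|k2] := ltnP (mdeg k) 2; first by rewrite f2 ?mul0r.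
congr (_ * _); apply/eqP; rewrite -subr_eq0 -fpsB; apply/eqP.
have [i ki] : exists i, k i != 0%N.
  apply: contrapT => /forallNP k0; move: k2; rewrite mdegE big1 // => i _.
  by have /negP := k0 i; rewrite negbK => /eqP.
have [j [l kE]] : exists j l, k = mnm_add (mnm1 i) (mnm_add (mnm1 j) l) :> multinom n.
  have kE : k = mnm_add (mnm1 i) (mnm_sub k (mnm1 i)) :> multinom n.
    by rewrite addmC submK // lep1mP.
  set k' := mnm_sub k _ in kE.
  have [j kj] : exists j, k' j != 0%N.
    apply: contrapT => /forallNP k0; move: k2; rewrite kE mdegD mdeg1 mdegE big1 // => j _.
    by have /negP := k0 j; rewrite negbK => /eqP.
  exists j, (mnm_sub k' (mnm1 j)).
  by rewrite kE; congr mnm_add; rewrite addmC submK // lep1mP.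
rewrite kE !mmonD !mmon1.
have -> : G i * (G j * mmon G l) - H i * (H j * mmon H l) =
  (G i - H i) * (G j * mmon G l) + (H i) * (G j * mmon G l - H j * mmon H l) by ring.
have D0 : eqd d.+1 ((G i - H i) * (G j * mmon G l)) 0.
  rewrite -addn1; apply: eqdM0; first exact/eqd_sub0.
  by rewrite -[1%N]addn0; apply: eqdM0; [apply/eqd1|move=> ?; rewrite ltn0].
have D1 : eqd d.+1 (H i * (G j * mmon G l - H j * mmon H l)) 0.
  rewrite -add1n; apply: eqdM0; first exact/eqd1.
  by apply/eqd_sub0; apply: eqdM => //; apply: eqd_mmon.
by rewrite fpsD D0 ?D1 // addr0.
Qed.

End FpsComp.
Arguments const0 {K p q}.

Section FpsCompAssoc.
Context {K : comNzRingType} {n p q : nat}.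

Lemma fps_compA (f : fps K n) (G : 'I_n -> fps K p) (H : 'I_p -> fps K q) :
  const0 G -> const0 H ->
  fps_comp (fps_comp f G) H = fps_comp f (fun i => fps_comp (G i) H).
Proof.
move=> G0 H0; apply: eqdP => d.
have GH0 : const0 (fun i => fps_comp (G i) H) by move=> i; rewrite fps_comp_const.
apply: (eqd_trans (eqd_comp_l H0 (eqd_psub f G0))).
apply/eqd_sym/(eqd_trans (eqd_psub f GH0)).
rewrite /psub fps_comp_sum; apply: eqd_sum => k _ m _.
rewrite fps_compM // fps_compC; suff -> : fps_comp (mmon G k) H = mmon (fun i => fps_comp (G i) H) k by [].
by rewrite /mmon fps_comp_prod //; apply: eq_bigr => i _; rewrite fps_compXn.
Qed.

End FpsCompAssoc.

Lemma fps_comp_id (K : comNzRingType) (n : nat) (f : fps K n) : fps_comp f (@fpsX K n) = f.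
Proof.
have X0 : const0 (@fpsX K n) by move=> i; rewrite /fpsX eq_sym mnm1_eq0.
apply: fpsP => m; rewrite fps_compE psubE (bigD1 (BMultinom (ltnSn (mdeg m)))) //=.
have mE k : mmon (@fpsX K n) k = (fun l => (l == k)%:R).
  rewrite /mmon.
  have E : forall r : seq 'I_n, (\prod_(i <- r) fpsX i ^+ k i : fps K n) =
      (fun l => (l == \big[mnm_add/mnm0]_(i <- r) mnm_muln (mnm1 i) (k i))%:R).
    elim=> [|i r IH]; first by rewrite !big_nil; apply: fpsP => l; rewrite fps1E.
    rewrite !big_cons IH; elim: (k i) => [|j IHj].
      by rewrite expr0 mul1r mulm0n add0m.
    rewrite exprS -mulrA IHj mulmS -addmA; apply: fpsP => l; rewrite fpsXME.
    set u := mnm_add _ (\big[_/_]_(_ <- _) _).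
    have [l0|li] := eqVneq (l i) 0%N.
      case: eqP => // lu; move: l0; rewrite lu mnmDE mnm1E eqxx //.
    rewrite -(inj_eq (@addmI _ (mnm1 i))); congr ((_ == _)%:R).
    by rewrite addmC submK // lep1mP.
  rewrite E; apply: fpsP => l; rewrite -multinomUE_id //.
rewrite mE eqxx mulr1 big1 ?addr0 // => k km.
rewrite mE; case: eqP => [mk|]; last by rewrite mulr0.
by case/negP: km; apply/eqP/val_inj.
Qed.

(** * Series in one variable: implicit equations, linearization, inverses and roots *)

Section Univariate.
Context {K : comNzRingType}.
Implicit Types (f g h s : fps K 1) (m : multinom 1) (d i j k N : nat).

Definition mn1 k : multinom 1 := Multinom [tuple k].

Lemma mdeg_mn1 k : mdeg (mn1 k) = k.
Proof. by rewrite mdegE big_ord1. Qed.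

Lemma mn1E m : m = mn1 (mdeg m).
Proof. by apply/mnmP => i; rewrite mdegE big_ord1 !(ord1 i). Qed.

Lemma mn1_eq0 k : (mn1 k == mnm0) = (k == 0%N).
Proof. by rewrite -mdeg_eq0 mdeg_mn1. Qed.

Lemma mn1_inj : injective mn1.
Proof. by move=> k l /(congr1 (@mdeg 1)); rewrite !mdeg_mn1. Qed.

Lemma mnm0_1 : (mnm0 : multinom 1) = mn1 0.
Proof. by apply/eqP; rewrite eq_sym mn1_eq0. Qed.

Lemma mnm1_1 (i : 'I_1) : mnm1 i = mn1 1.
Proof. by rewrite [LHS]mn1E mdeg1. Qed.

Lemma mn1D k l : mnm_add (mn1 k) (mn1 l) = mn1 (k + l).
Proof. by rewrite [LHS]mn1E mdegD !mdeg_mn1. Qed.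

Lemma coef1P f g : (forall k, coef1 f k = coef1 g k) -> f = g.
Proof. by move=> fg; apply: fpsP => m; rewrite (mn1E m); apply: fg. Qed.

Lemma bmsum1 (V : nmodType) N (F : multinom 1 -> V) :
  \sum_(k : bmultinom 1 N) F k = \sum_(i < N) F (mn1 i).
Proof.
pose w (i : 'I_N) : bmultinom 1 N := @BMultinom 1 N (mn1 i) (eq_ind_r (fun e => (e < N)%N) (ltn_ord i) (mdeg_mn1 i)).
rewrite (reindex w) //; exists (fun k : bmultinom 1 N => Ordinal (bmdeg k)) => [i _|k _].
  by apply/val_inj; rewrite /= mdeg_mn1.
by apply/val_inj; rewrite /= -mn1E.
Qed.

Lemma coef1M f g k : coef1 (f * g) k = \sum_(i < k.+1) coef1 f i * coef1 g (k - i).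
Proof.
rewrite /coef1 -/(mn1 k) (fpsME (N := k.+1)) ?mdeg_mn1 //.
pose Phi (i j : multinom 1) := if mn1 k == mnm_add i j then f i * g j else 0.
have -> : \sum_(i : bmultinom 1 k.+1 * bmultinom 1 k.+1 | mn1 k == mnm_add i.1 i.2) f i.1 * g i.2 =
   \sum_(i : bmultinom 1 k.+1) \sum_(j : bmultinom 1 k.+1) Phi i j.
  by rewrite pair_big big_mkcond.
rewrite (bmsum1 _ (fun i : multinom 1 => \sum_(j : bmultinom 1 k.+1) Phi i j)); apply: eq_bigr => i _.
rewrite (bmsum1 _ (Phi (mn1 i))) /Phi.
have ki : (k - i < k.+1)%N by rewrite ltnS leq_subr.
rewrite (bigD1 (Ordinal ki)) //= mn1D subnKC ?eqxx; last by rewrite -ltnS.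
rewrite big1 ?addr0 // => j jk; rewrite mn1D; case: eqP => // /mn1_inj kij.
by case/negP: jk; apply/eqP/val_inj => /=; lia.
Qed.

Lemma coef10 f : coef1 f 0 = f mnm0. Proof. by rewrite mnm0_1. Qed.
Lemma coef1D f g k : coef1 (f + g) k = coef1 f k + coef1 g k. Proof. by []. Qed.
Lemma coef1B f g k : coef1 (f - g) k = coef1 f k - coef1 g k. Proof. by []. Qed.
Lemma coef1C c k : coef1 (fpsC c : fps K 1) k = c *+ (k == 0%N).
Proof. by rewrite /coef1 /fpsC mn1_eq0. Qed.
Lemma coef1CM c f k : coef1 (fpsC c * f) k = c * coef1 f k.
Proof. exact: fpsC_mul. Qed.
Lemma coef1_1 k : coef1 (1 : fps K 1) k = (k == 0%N)%:R.
Proof. by rewrite /coef1 fps1E mn1_eq0. Qed.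
Lemma coef1_0 k : coef1 (0 : fps K 1) k = 0. Proof. by []. Qed.
Lemma coef1_sum (I : Type) (r : seq I) (P : pred I) (F : I -> fps K 1) k :
  coef1 (\sum_(i <- r | P i) F i) k = \sum_(i <- r | P i) coef1 (F i) k.
Proof. exact: fps_sum. Qed.

Definition ser (a : nat -> K) : fps K 1 := fun m => a (mdeg m).
Lemma coef1_ser a k : coef1 (ser a) k = a k.
Proof. by rewrite /coef1 /ser mdeg_mn1. Qed.

Lemma eqd1P d f g : eqd d f g <-> forall k, (k < d)%N -> coef1 f k = coef1 g k.
Proof.
split=> fg k kd; first by apply: fg; rewrite mdeg_mn1.
by rewrite (mn1E k); apply: fg.
Qed.

Definition X1 : fps K 1 := fpsX ord0.

Lemma coef1_X k : coef1 X1 k = (k == 1%N)%:R.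
Proof. by rewrite /coef1 /X1 /fpsX mnm1_1 (inj_eq mn1_inj). Qed.

Lemma X1_0 : X1 mnm0 = 0. Proof. by rewrite -coef10 coef1_X. Qed.

Lemma coef1_XM f k : coef1 (X1 * f) k = if k is k'.+1 then coef1 f k' else 0.
Proof.
rewrite /coef1; case: k => [|k]; rewrite -/(mn1 _); first by rewrite fpsXM0.
by rewrite -[k.+1]add1n -mn1D -(mnm1_1 ord0) fpsXMS.
Qed.

Lemma coef1_XnM f j k : coef1 (X1 ^+ j * f) k = if (k < j)%N then 0 else coef1 f (k - j).
Proof.
elim: j k => [|j IH] k; first by rewrite mul1r subn0.
by rewrite exprS -mulrA coef1_XM; case: k => // k; rewrite IH.
Qed.

Lemma coef1_Xn j k : coef1 (X1 ^+ j) k = (k == j)%:R.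
Proof.
by rewrite -[X1 ^+ j]mulr1 coef1_XnM coef1_1; case: ltngtP => // kj; rewrite ?kj ?subnn // subn_eq0 leqNgt kj.
Qed.

Lemma fps1_order f : f <> 0 -> exists k u, f = X1 ^+ k * u /\ coef1 u 0 <> 0.
Proof.
move=> f0; have [k fk] : exists k, coef1 f k != 0.
  apply: contrapT => /forallNP fk; apply: f0; apply: coef1P => k.
  by have /negP := fk k; rewrite negbK => /eqP.
have [j fj jmin] := ex_minnP (ex_intro (fun k => coef1 f k != 0) k fk).
exists j, (ser (fun i => coef1 f (j + i))); split; last by rewrite coef1_ser addn0; apply/eqP.
apply: coef1P => i; rewrite coef1_XnM coef1_ser; case: ltnP => [ij|ji]; last by rewrite subnKC.
by apply/eqP/negPn/negP => /jmin; rewrite leqNgt ij.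
Qed.

Lemma eqd_Xn d f : eqd d f 0 -> f = X1 ^+ d * ser (fun i => coef1 f (d + i)).
Proof.
move=> /eqd1P fd; apply: coef1P => i; rewrite coef1_XnM coef1_ser.
by case: ltnP => [/fd //|ji]; rewrite subnKC.
Qed.

Lemma coef1_comp_aXn f c j k : (0 < j)%N ->
  coef1 (fps_comp f (fun=> fpsC c * X1 ^+ j)) k =
  if (j %| k)%N then coef1 f (k %/ j)%N * c ^+ (k %/ j) else 0.
Proof.
move=> j0; rewrite /coef1 fps_compE psubE mdeg_mn1.
under eq_bigr => l _.
  rewrite /mmon big_ord1 exprMn -exprM -rmorphXn /= fpsC_mul.
  have -> : (X1 ^+ (j * l ord0)) (mn1 k) = (k == j * l ord0)%N%:R by exact: coef1_Xn.
  over.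
rewrite (bmsum1 _ (fun l : multinom 1 => f l * (c ^+ l ord0 * (k == j * l ord0)%N%:R))).
have E i : mn1 i ord0 = i by [].
under eq_bigr do rewrite E.
case: ifPn => [/dvdnP[q kE]|jk].
  have qk : (q < k.+1)%N by rewrite ltnS kE leq_pmulr.
  have -> : (k %/ j)%N = q by rewrite kE mulnK.
  rewrite (bigD1 (Ordinal qk)) //= {1}kE mulnC eqxx mulr1 big1 ?addr0 // => i iq.
  case: eqP => [kij|]; last by rewrite !mulr0.
  case/negP: iq; apply/eqP/val_inj => /=; apply/eqP.
  by rewrite -(eqn_pmul2l j0) -kij kE mulnC.
rewrite big1 // => i _; case: eqP => kE; last by rewrite !mulr0.
by case/negP: jk; rewrite kE dvdn_mulr.
Qed.

Lemma coef1_comp_aX f c k :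
  coef1 (fps_comp f (fun=> fpsC c * X1)) k = coef1 f k * c ^+ k.
Proof. by rewrite -[X1]expr1 coef1_comp_aXn // dvd1n divn1. Qed.

Lemma coef1_comp_Xn f j k : (0 < j)%N ->
  coef1 (fps_comp f (fun=> X1 ^+ j)) k = if (j %| k)%N then coef1 f (k %/ j)%N else 0.
Proof.
move=> j0; rewrite -[X1 ^+ j]mul1r -(rmorph1 (@fpsC K 1)) coef1_comp_aXn //.
by rewrite expr1n mulr1.
Qed.

Lemma const0_aX c : const0 (fun _ : 'I_1 => fpsC c * X1).
Proof. by move=> i; rewrite fpsM0 X1_0 mulr0. Qed.

Lemma const0_Xn j : (0 < j)%N -> const0 (fun _ : 'I_1 => X1 ^+ j).
Proof. by move=> j0 i; rewrite fpsX0 X1_0 expr0n; case: j j0. Qed.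

Lemma const0_1 (p : nat) (s : fps K p) : s mnm0 = 0 -> const0 (fun _ : 'I_1 => s).
Proof. by move=> s0 i. Qed.

Lemma fps_comp_X1 (p : nat) (s : fps K p) : s mnm0 = 0 -> fps_comp X1 (fun=> s) = s.
Proof. by move=> s0; rewrite fps_compX. Qed.

Lemma fps_comp_by_X1 f : fps_comp f (fun=> X1) = f.
Proof.
rewrite -[RHS]fps_comp_id; apply: fps_comp_ext => i; rewrite /X1.
by rewrite (ord1 i).
Qed.

Lemma coef1_comp1 f s : s mnm0 = 0 -> coef1 (fps_comp f (fun=> s)) 1 = coef1 f 1 * coef1 s 1.
Proof.
move=> s0; rewrite /coef1 fps_compE psubE -/(mn1 1) mdeg_mn1.
rewrite (bmsum1 _ (fun k : multinom 1 => f k * mmon (fun=> s) k (mn1 1))) !big_ord_recl big_ord0 /= addr0.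
by rewrite /mmon !big_ord1 /= expr0 expr1 fps1E mn1_eq0 mulr0 add0r.
Qed.

(** Each application of [Phi] settles one more degree, so the coefficient of degree k is constant
    from the iterate k + 1 on; the fixed point is the diagonal limit. *)
Lemma fps1_fixpoint (Phi : fps K 1 -> fps K 1) :
    (forall f, f mnm0 = 0 -> Phi f mnm0 = 0) ->
    (forall d f g, f mnm0 = 0 -> g mnm0 = 0 -> eqd d f g -> eqd d.+1 (Phi f) (Phi g)) ->
  exists y : fps K 1, y mnm0 = 0 /\ y = Phi y.
Proof.
move=> Phi0 PhiS; pose u d := iter d Phi 0.
have u0 d : u d mnm0 = 0 by elim: d => //= d IH; apply: Phi0.
have uS d : forall e, (d <= e)%N -> eqd d (u d) (u e).
  elim: d => [|d IH] e de; first by move=> m; rewrite ltn0.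
  by case: e de => // e de; apply: PhiS => //; apply: IH.
pose y : fps K 1 := fun m => u (mdeg m).+1 m.
have yu d : eqd d y (u d) by move=> m md; apply: uS md _ _.
have y0 : y mnm0 = 0 by rewrite /y mdeg0 u0.
exists y; split=> //; apply: eqdP => -[|d]; first by move=> m; rewrite ltn0.
by apply: eqd_trans (yu d.+1) _; apply: PhiS => //; apply/eqd_sym.
Qed.

Lemma fps1_implicit (e Q : fps K 1) : e mnm0 = 0 -> eqd 2 Q 0 ->
  exists y : fps K 1, y mnm0 = 0 /\ y = e + fps_comp Q (fun=> y).
Proof.
move=> e0 Q2; apply: fps1_fixpoint => [f f0|d f g f0 g0 fg].
  by rewrite fpsD fps_comp_const // e0 Q2 ?mdeg0 // add0r.
by apply: eqdD => //; apply: eqd_comp_ord2.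
Qed.

End Univariate.

Section UnivariateField.
Context {K : fieldType}.
Implicit Types (f g h s u : fps K 1) (d i j k N : nat).

Lemma fps1_domain f g : f * g = 0 -> f = 0 \/ g = 0.
Proof.
move=> fg; apply: contrapT => /not_orP[/fps1_order[k [u [fE u0]]] /fps1_order[l [v [gE v0]]]].
have : coef1 (f * g) (k + l) = 0 by rewrite fg.
rewrite fE gE; have -> : X1 ^+ k * u * (X1 ^+ l * v) = X1 ^+ (k + l) * (u * v).
  by rewrite exprD; ring.
rewrite coef1_XnM ltnn subnn coef1M big_ord1 subn0 => /eqP.
by rewrite mulf_eq0 => /orP[] /eqP.
Qed.

(** With t = lam X + Q, the equation reads (lam^k - lam) h_k = [Q o h]_k. As [Q] has order at least
    2, the right side only involves coefficients of [h] of degree below k. *)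
Lemma koenigs (t : fps K 1) (lam : K) : coef1 t 0 = 0 -> coef1 t 1 = lam ->
    (forall k, (2 <= k)%N -> lam ^+ k != lam) ->
  exists h : fps K 1, [/\ coef1 h 0 = 0, coef1 h 1 = 1 &
    fps_comp t (fun=> h) = fps_comp h (fun=> fpsC lam * X1)].
Proof.
move=> t0 t1 laml; pose Q := t - fpsC lam * X1.
have Q2 : eqd 2 Q 0.
  by apply/eqd1P => -[|[|k]] // _; rewrite coef1B coef1CM coef1_X ?t0 ?t1 ?mulr0 ?mulr1 subrr.
have Q0 : Q mnm0 = 0 by rewrite -coef10 (iffLR (eqd1P _ _ _) Q2 0%N).
(* In degree 1 the divisor lam - lam vanishes, and the coefficient is normalized to 1. In degree 0
   the numerator is 0, so the quotient is harmless. *)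
pose Phi h := ser (fun k => if k == 1%N then 1 else
   coef1 (fps_comp Q (fun=> h)) k / (lam ^+ k - lam)).
have [|d f g f0 g0 fg|h [h0 hE]] := @fps1_fixpoint _ Phi.
- by move=> f f0; rewrite -coef10 coef1_ser /= coef10 fps_comp_const // Q0 mul0r.
- apply/eqd1P => k kd; rewrite !coef1_ser; case: eqP => // _; congr (_ / _).
  have QS : eqd d.+1 (fps_comp Q (fun=> f)) (fps_comp Q (fun=> g)).
    by apply: eqd_comp_ord2.
  exact: (iffLR (eqd1P _ _ _) QS).
have h1 : coef1 h 1 = 1 by rewrite hE coef1_ser.
exists h; rewrite coef10; split=> //; apply: coef1P => k.
have -> : t = Q + fpsC lam * X1 by rewrite subrK.
rewrite fps_compD fps_compM // fps_compC fps_comp_X1 // coef1D coef1CM coef1_comp_aX.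
case: k => [|[|k]].
- by rewrite (coef10 h) h0 coef10 fps_comp_const // Q0 mulr0 mul0r addr0.
- rewrite h1 coef1_comp1 // (iffLR (eqd1P _ _ _) Q2 1%N) // mul0r add0r mulr1 mul1r expr1 //.
- have lk : lam ^+ k.+2 - lam != 0 by rewrite subr_eq0 laml.
  have : coef1 h k.+2 = coef1 (fps_comp Q (fun=> h)) k.+2 / (lam ^+ k.+2 - lam).
    by rewrite {1}hE coef1_ser.
  move/(congr1 (fun z => z * (lam ^+ k.+2 - lam))); rewrite mulfVK // => <-.
  by ring.
Qed.

(** Puts the inverse in the form g = e + Q o g with [Q] of order at least 2 when s(0) = 0. The same
    equation serves for existence and, later, for convergence. *)
Lemma fps1_inverse_eq s g : g mnm0 = 0 -> coef1 s 1 != 0 -> fps_comp s (fun=> g) = X1 ->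
  g = fpsC (coef1 s 1)^-1 * X1 + fps_comp (X1 - fpsC (coef1 s 1)^-1 * s) (fun=> g).
Proof.
move=> g0 s1 sg; rewrite fps_compB fps_comp_X1 // fps_compM // fps_compC sg.
by ring.
Qed.

Lemma fps1_right_inverse s : s mnm0 = 0 -> coef1 s 1 != 0 ->
  exists g : fps K 1, [/\ g mnm0 = 0, coef1 g 1 != 0 & fps_comp s (fun=> g) = X1].
Proof.
move=> s0 s1; set a := coef1 s 1.
have Q2 : eqd 2 (X1 - fpsC a^-1 * s) 0.
  apply/eqd1P => -[|[|k]] // _; rewrite coef1B coef1CM coef1_X.
    by rewrite coef10 s0 mulr0 subr0.
  by rewrite mulVf // subrr.
have [|g [g0 gE]] := @fps1_implicit _ (fpsC a^-1 * X1) _ _ Q2.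
  by rewrite fpsM0 X1_0 mulr0.
have sg : fps_comp s (fun=> g) = X1.
  move: gE; rewrite fps_compB fps_comp_X1 // fps_compM // fps_compC => gE.
  have : fpsC a^-1 * fps_comp s (fun=> g) = fpsC a^-1 * X1.
    apply/eqP; rewrite eq_sym -subr_eq0; apply/eqP.
    by move/(congr1 (fun z => z - g)): gE; rewrite subrr => ->; ring.
  move/(congr1 (fun z => fpsC a * z)); rewrite !mulrA -!rmorphM mulfV // rmorph1 !mul1r //.
exists g; split=> //; apply/eqP => g1.
have : coef1 (fps_comp s (fun=> g)) 1 = 1 by rewrite sg coef1_X.
by rewrite coef1_comp1 // g1 mulr0 => /eqP; rewrite eq_sym oner_eq0.
Qed.

(** A right inverse of [s] has a right inverse in turn, which can only be [s]; hence it is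
    two-sided. *)
Lemma fps1_inverse s : s mnm0 = 0 -> coef1 s 1 != 0 ->
  exists g : fps K 1, [/\ g mnm0 = 0, coef1 g 1 != 0, fps_comp s (fun=> g) = X1 & fps_comp g (fun=> s) = X1].
Proof.
move=> s0 s1; have [g [g0 g1 sg]] := fps1_right_inverse s0 s1.
have [g' [g'0 g'1 gg']] := fps1_right_inverse g0 g1.
exists g; split=> //; suff -> : s = g' by [].
rewrite -[s]fps_comp_by_X1 -gg'; rewrite -(fps_compA s (const0_1 g0) (const0_1 g'0)) sg.
by rewrite fps_comp_X1.
Qed.

(** The part of order at least 2 of ((1 + X)^nu - 1) / nu. With it, (1 + w)^nu = 1 + e becomes the
    implicit equation w = e / nu - tail(w). *)
Definition binom_tail (nu : nat) : fps K 1 :=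
  fpsC nu%:R^-1 * ((1 + X1) ^+ nu - 1 - fpsC nu%:R * X1).

Lemma binom_tail_ord nu : eqd 2 (binom_tail nu) 0.
Proof.
have E : eqd 2 ((1 + X1) ^+ nu : fps K 1) (1 + fpsC nu%:R * X1).
  elim: nu => [|nu IH].
    by rewrite expr0 raddf0 mul0r addr0.
  rewrite exprS; apply: (eqd_trans (eqdM (eqd_refl (1 + X1)) IH)).
  have -> : (1 + X1) * (1 + fpsC nu%:R * X1) = 1 + fpsC nu.+1%:R * X1 + X1 * (X1 * fpsC nu%:R) :> fps K 1.
    have -> : fpsC nu.+1%:R = fpsC nu%:R + 1 :> fps K 1 by rewrite -natr1 raddfD.
    by ring.
  rewrite -[X in eqd _ _ X]addr0; apply: eqdD => //.
  by apply/eqd1P => -[|[|k]] // _; rewrite !coef1_XM.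
rewrite /binom_tail -(mulr0 (fpsC nu%:R^-1)); apply: eqdM => //.
have -> : 0 = (1 + fpsC nu%:R * X1) - 1 - fpsC nu%:R * X1 :> fps K 1 by ring.
by apply: eqdD => //; apply: eqdD.
Qed.

Lemma comp_binom_tail nu (w : fps K 1) : w mnm0 = 0 -> fps_comp (binom_tail nu) (fun=> w : fps K 1) =
  fpsC nu%:R^-1 * ((1 + w) ^+ nu - 1 - fpsC nu%:R * w).
Proof.
move=> w0; rewrite /binom_tail fps_compM // !fps_compB !fps_compC fps_compXn // fps_compD.
by rewrite fps_compM // fps_comp1 fps_compC fps_comp_X1.
Qed.

Lemma fps1_root_eq nu (e w : fps K 1) : nu%:R != 0 :> K -> w mnm0 = 0 ->
  (1 + w) ^+ nu = 1 + e <->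
  w = fpsC nu%:R^-1 * e + fps_comp (- binom_tail nu) (fun=> w).
Proof.
move=> nu0 w0; rewrite fps_compN comp_binom_tail //.
have nuK : fpsC nu%:R^-1 * fpsC nu%:R = 1 :> fps K 1 by rewrite -rmorphM mulVf // rmorph1.
have -> : fpsC nu%:R^-1 * e + - (fpsC nu%:R^-1 * ((1 + w) ^+ nu - 1 - fpsC nu%:R * w)) =
   w + fpsC nu%:R^-1 * (1 + e - (1 + w) ^+ nu).
  have -> : fpsC nu%:R^-1 * ((1 + w) ^+ nu - 1 - fpsC nu%:R * w) =
    fpsC nu%:R^-1 * ((1 + w) ^+ nu - 1) - (fpsC nu%:R^-1 * fpsC nu%:R) * w by ring.
  by rewrite nuK; ring.
split=> [->|]; first by rewrite subrr mulr0 addr0.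
rewrite -[X in X = _]addr0 => /addrI /(congr1 (fun z => fpsC nu%:R * z)).
rewrite mulr0 mulrA [fpsC nu%:R * _]mulrC nuK mul1r => /esym /eqP.
by rewrite subr_eq0 => /eqP.
Qed.

Lemma fps1_root nu (e : fps K 1) : nu%:R != 0 :> K -> e mnm0 = 0 ->
  exists w : fps K 1, w mnm0 = 0 /\ (1 + w) ^+ nu = 1 + e.
Proof.
move=> nu0 e0; have [||w [w0 wE]] := @fps1_implicit _ (fpsC nu%:R^-1 * e) (- binom_tail nu).
- by rewrite fpsM0 e0 mulr0.
- by rewrite -[0]oppr0; apply/eqdN/binom_tail_ord.
by exists w; split=> //; apply/fps1_root_eq.
Qed.

Definition geom : fps K 1 := ser (fun=> 1).

Lemma geomE : geom * (1 - X1) = 1.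
Proof.
apply: coef1P => k; rewrite mulrBr mulr1 [geom * _]mulrC coef1B coef1_XM coef1_1 coef1_ser.
by case: k => [|k]; rewrite ?subr0 // coef1_ser subrr.
Qed.

(** The geometric series in 1 - f / f(0). Being a substitution, it inherits convergence from [f]. *)
Definition fps_inv (n : nat) (f : fps K n) : fps K n :=
  fpsC (f mnm0)^-1 * fps_comp geom (fun=> 1 - fpsC (f mnm0)^-1 * f).

Lemma fps_invE (n : nat) (f : fps K n) : f mnm0 != 0 -> f * fps_inv f = 1.
Proof.
move=> f0; rewrite /fps_inv; set a := f mnm0; set u := 1 - _.
have u0 : const0 (fun _ : 'I_1 => u).
  by move=> _; rewrite /u fpsB fps1E eqxx fpsC_mul mulVf // subrr.
have -> : f = fpsC a * fps_comp (1 - X1) (fun=> u).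
  rewrite fps_compB fps_comp1 fps_comp_X1 ?(u0 ord0) // /u opprB addrC subrK mulrA -rmorphM.
  by rewrite mulfV // rmorph1 mul1r.
have -> : fpsC a * fps_comp (1 - X1) (fun=> u) * (fpsC a^-1 * fps_comp geom (fun=> u)) =
  (fpsC a * fpsC a^-1) * (fps_comp geom (fun=> u) * fps_comp (1 - X1) (fun=> u)) by ring.
by rewrite -fps_compM // geomE fps_comp1 -rmorphM mulfV // rmorph1 mulr1.
Qed.

End UnivariateField.

(** * Convergence and evaluation *)

Section Modulus.
Context {R : realType}.
Local Notation C := (Cplx R).
Implicit Types (x y z : C) (a b : R).

(** The norm of [Cplx R] is itself a complex number; its real part carries the estimates into the
    totally ordered field [R]. *)
Definition ab z : R := complex.Re `|z|.
Definition toC (a : R) : C := real_complex R a.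

Lemma abE z : `|z| = toC (ab z).
Proof. by rewrite /ab /toC normc_def. Qed.

Lemma toC_le a b : (toC a <= toC b) = (a <= b). Proof. exact: lecR. Qed.
Lemma toC_lt a b : (toC a < toC b) = (a < b). Proof. exact: ltcR. Qed.
Lemma toC_inj : injective toC. Proof. exact: complexI. Qed.
Lemma toCM a b : toC (a * b) = toC a * toC b. Proof. exact: rmorphM. Qed.
Lemma toCD a b : toC (a + b) = toC a + toC b. Proof. exact: rmorphD. Qed.
Lemma toC0 : toC 0 = 0. Proof. exact: rmorph0. Qed.
Lemma toC1 : toC 1 = 1. Proof. exact: rmorph1. Qed.
Lemma toCX a k : toC (a ^+ k) = toC a ^+ k. Proof. exact: rmorphXn. Qed.
Lemma toC_sum (I : Type) (r : seq I) (P : pred I) (F : I -> R) :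
  toC (\sum_(i <- r | P i) F i) = \sum_(i <- r | P i) toC (F i).
Proof. exact: rmorph_sum. Qed.

Lemma toC_gt0 (e : C) : 0 < e -> exists2 a, 0 < a & e = toC a.
Proof.
move=> e0; exists (complex.Re e); last by rewrite /toC RRe_real // gtr0_real.
by move: e0; rewrite ltcE => /andP[].
Qed.

Lemma ab_ge0 z : 0 <= ab z. Proof. by rewrite -toC_le -abE toC0 normr_ge0. Qed.
Lemma abM x y : ab (x * y) = ab x * ab y.
Proof. by apply: toC_inj; rewrite toCM -!abE normrM. Qed.
Lemma ab0 : ab 0 = 0. Proof. by apply: toC_inj; rewrite -abE normr0 toC0. Qed.
Lemma ab1 : ab 1 = 1. Proof. by apply: toC_inj; rewrite -abE normr1 toC1. Qed.
Lemma abX x k : ab (x ^+ k) = ab x ^+ k.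
Proof. by apply: toC_inj; rewrite toCX -!abE normrX. Qed.
Lemma abN x : ab (- x) = ab x. Proof. by rewrite /ab normrN. Qed.
Lemma ab_eq0 x : (ab x == 0) = (x == 0).
Proof. by rewrite -(inj_eq toC_inj) -abE toC0 normr_eq0. Qed.
Lemma abV x : ab x^-1 = (ab x)^-1.
Proof.
have [->|x0] := eqVneq x 0; first by rewrite invr0 ab0 invr0.
have : ab x * ab x^-1 = 1 by rewrite -abM mulfV // ab1.
move=> xV; have ax : ab x != 0 by rewrite ab_eq0.
by rewrite -[LHS]mul1r -(mulVf ax) -mulrA xV mulr1.
Qed.
Lemma abD x y : ab (x + y) <= ab x + ab y.
Proof. by rewrite -toC_le toCD -!abE ler_normD. Qed.
Lemma abB x y : ab (x - y) <= ab x + ab y.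
Proof. by rewrite -(abN y); apply: abD. Qed.
Lemma abBC x y : ab (x - y) = ab (y - x). Proof. by rewrite -abN opprB. Qed.
Lemma ab_tri y x z : ab (x - z) <= ab (x - y) + ab (y - z).
Proof. by rewrite (_ : x - z = (x - y) + (y - z)); [apply: abD | ring]. Qed.
Lemma ab_gt0 x : (0 < ab x) = (x != 0).
Proof. by rewrite lt_neqAle ab_ge0 andbT eq_sym ab_eq0. Qed.
Lemma ab_toC a : 0 <= a -> ab (toC a) = a.
Proof. by move=> a0; apply: toC_inj; rewrite -abE ger0_norm // -toC0 toC_le. Qed.
Lemma ab_sum (I : Type) (r : seq I) (P : pred I) (F : I -> C) :
  ab (\sum_(i <- r | P i) F i) <= \sum_(i <- r | P i) ab (F i).
Proof.
elim/big_rec2: _ => [|i x y _ xy]; first by rewrite ab0.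
by apply: le_trans (abD _ _) _; rewrite lerD2l.
Qed.
Lemma ab_prod (I : Type) (r : seq I) (P : pred I) (F : I -> C) :
  ab (\prod_(i <- r | P i) F i) = \prod_(i <- r | P i) ab (F i).
Proof. exact: (big_morph ab abM ab1). Qed.
Lemma ab_le0 x : ab x <= 0 -> x = 0.
Proof. by move=> x0; apply/eqP; rewrite -ab_eq0 eq_le x0 ab_ge0. Qed.

Lemma ab_Re z : `|complex.Re z| <= ab z.
Proof.
rewrite -toC_le -abE normc_def lecR.
rewrite -sqrtr_sqr ler_sqrt ?addr_ge0 ?sqr_ge0 //.
by rewrite lerDl sqr_ge0.
Qed.

Lemma ab_Im z : `|complex.Im z| <= ab z.
Proof.
rewrite -toC_le -abE normc_def lecR.
rewrite -sqrtr_sqr ler_sqrt ?addr_ge0 ?sqr_ge0 //.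
by rewrite lerDr sqr_ge0.
Qed.

Lemma ab_le_ReIm z : ab z <= `|complex.Re z| + `|complex.Im z|.
Proof.
have -> : z = toC (complex.Re z) + 'i%C * toC (complex.Im z) by rewrite [LHS]complexE.
have abi : ab 'i%C = 1.
  by apply: toC_inj; rewrite -abE normc_def /= expr0n /= expr1n add0r sqrtr1.
apply: le_trans (abD _ _) _; rewrite abM abi mul1r.
have abr (a : R) : ab (toC a) = `|a|.
  by apply: toC_inj; rewrite -abE normc_def /= expr0n /= addr0 sqrtr_sqr.
rewrite !abr.
case: z => p q /=.
by rewrite !mul0r !mul1r !add0r oppr0 addr0.
Qed.

Definition seq_cvg (u : nat -> C) l :=
  forall e : R, 0 < e -> exists N, forall k, (N <= k)%N -> ab (l - u k) < e.

Lemma seq_cvgP (u : nat -> C) l : u @ \oo --> l <-> seq_cvg u l.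
Proof.
split=> [/cvgrPdist_lt ul e e0|ul].
  have /ul [N _ uN] : 0 < toC e by rewrite -toC0 toC_lt.
  by exists N => k /uN /=; rewrite abE toC_lt.
apply/cvgrPdist_lt => _ /toC_gt0[e e0 ->].
have [N uN] := ul e e0; exists N => // k /= /uN.
by rewrite abE toC_lt.
Qed.

Lemma seq_cvg_uniq (u : nat -> C) l l' : seq_cvg u l -> seq_cvg u l' -> l = l'.
Proof.
move=> ul ul'; apply/eqP; rewrite -subr_eq0 -ab_eq0; apply/eqP/le_anti.
rewrite ab_ge0 andbT; apply/ler_addgt0Pl => e e0; rewrite addr0.
have e2 : 0 < e / 2 by rewrite divr_gt0.
have [N uN] := ul _ e2; have [N' uN'] := ul' _ e2.
have := uN (maxn N N') (leq_maxl _ _); have := uN' (maxn N N') (leq_maxr _ _).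
have := ab_tri (u (maxn N N')) l l'; rewrite (abBC (u _) l'); lra.
Qed.

Lemma half_pow_small (e M : R) : 0 < e -> exists N, forall k, (N <= k)%N -> M * 2^-1 ^+ k < e.
Proof.
move=> e0; have [N Ne] : exists N : nat, `|M| / e < N%:R.
  by exists (Num.trunc (`|M| / e)).+1; rewrite truncnS_gt.
exists N => k Nk; have k2 : (k%:R : R) < 2 ^+ k by rewrite -natrX ltr_nat ltn_expl.
have Nk' : (N%:R : R) <= k%:R by rewrite ler_nat.
rewrite exprVn ltr_pdivrMr ?exprn_gt0 //.
have : `|M| < e * 2 ^+ k.
  have := lt_le_trans Ne (ltW (le_lt_trans Nk' k2)).
  by rewrite ltr_pdivrMr // mulrC.
by apply: le_lt_trans; rewrite ler_norm.
Qed.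

Lemma half_pow_cauchy_real (u : nat -> R) (M : R) :
  (forall N N', (N <= N')%N -> `|u N' - u N| <= M * 2^-1 ^+ N) ->
  exists l, forall N, `|l - u N| <= M * 2^-1 ^+ N.
Proof.
move=> uM; have cu : cvgn u.
  apply/cauchy_cvgP/cauchy_exP => e e0.
  have [N Ne] := half_pow_small M e0.
  exists (u N); exists N => // k /= Nk.
  by rewrite /ball /= distrC; apply: le_lt_trans (uM _ _ Nk) (Ne N (leqnn N)).
exists (limn u) => N.
apply/ler_addgt0Pl => e e0.
have /cvgrPdist_lt /(_ _ e0) [N' _ uN'] := cu.
have := uN' (maxn N N') (leq_maxr _ _); have := uM N (maxn N N') (leq_maxl _ _).
by rewrite /= !ler_norml ltr_norml => *; apply/andP; split; lra.
Qed.

Lemma half_pow_cauchy (u : nat -> C) (M : R) :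
  (forall N N', (N <= N')%N -> ab (u N' - u N) <= M * 2^-1 ^+ N) ->
  exists l, seq_cvg u l.
Proof.
move=> uM.
have [|a aM] := @half_pow_cauchy_real (fun k => complex.Re (u k)) M.
  move=> N N' /uM; apply: le_trans; apply: le_trans (ab_Re _).
  by rewrite raddfB.
have [|b bM] := @half_pow_cauchy_real (fun k => complex.Im (u k)) M.
  move=> N N' /uM; apply: le_trans; apply: le_trans (ab_Im _).
  by rewrite raddfB.
exists (Complex a b) => e e0.
have [N Ne] := half_pow_small (2 * M) e0; exists N => k /Ne; apply: le_lt_trans.
apply: le_trans (ab_le_ReIm _) _; have := aM k; have := bM k.
case: (u k) => p q /=; lra.
Qed.

Lemma seq_cvg_le (u : nat -> C) l x (M : R) : seq_cvg u l ->
  (exists N, forall k, (N <= k)%N -> ab (u k - x) <= M) -> ab (l - x) <= M.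
Proof.
move=> ul [N uM]; apply/ler_addgt0Pl => e e0.
have [N' uN'] := ul e e0.
have := uN' (maxn N N') (leq_maxr _ _); have := uM (maxn N N') (leq_maxl _ _).
have := ab_tri (u (maxn N N')) l x; lra.
Qed.

Lemma seq_cvg_half (u : nat -> C) l (M : R) :
  (forall N, ab (l - u N) <= M * 2^-1 ^+ N) -> seq_cvg u l.
Proof.
move=> uM e e0; have [N Ne] := half_pow_small M e0.
by exists N => k /Ne; apply: le_lt_trans.
Qed.

Section RowVectors.
Context {n : nat}.
Implicit Types (P : set 'rV[C]_n).

Lemma nbhs0P P : (\forall z \near (0 : 'rV[C]_n), P z) <->
  exists2 e : R, 0 < e & forall z : 'rV[C]_n, (forall i, ab (z 0 i) < e) -> P z.
Proof.
split=> [/nbhs_ballP[_ /= /toC_gt0[e e0 ->] eP]|[e e0 eP]].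
  exists e => // z ze; apply: eP; split=> [|i j]; first by rewrite -toC0 toC_lt.
  by rewrite (ord1 i) mxE /ball /= sub0r normrN abE toC_lt.
apply/nbhs_ballP; exists (toC e) => /=; first by rewrite -toC0 toC_lt.
move=> z [_ ze]; apply: eP => i; have := ze 0 i.
by rewrite mxE /ball /= sub0r normrN abE toC_lt.
Qed.

Lemma rV_cvg0P (u : nat -> 'rV[C]_n) : u @ \oo --> (0 : 'rV[C]_n) <->
  forall e : R, 0 < e -> exists N, forall k, (N <= k)%N -> forall i, ab (u k 0 i) < e.
Proof.
split=> [u0 e e0|u0].
  have /u0 [N _ uN] : \forall z \near (0 : 'rV[C]_n), forall i, ab ((z : 'rV[C]_n) 0 i) < e.
    by apply/nbhs0P; exists e.
  by exists N => k /uN.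
move=> P /nbhs0P[e e0 eP]; have [N uN] := u0 e e0.
by exists N => // k /= /uN; apply: eP.
Qed.

Lemma open_rVP P : open P <-> forall a : 'rV[C]_n, P a ->
  exists2 e : R, 0 < e & forall z : 'rV[C]_n, (forall i, ab (z 0 i - a 0 i) < e) -> P z.
Proof.
rewrite openE; split=> oP a Pa.
  have /nbhs_ballP[_ /= /toC_gt0[e e0 ->] eP] := oP a Pa.
  exists e => // z ze; apply: eP; split=> [|i j]; first by rewrite -toC0 toC_lt.
  by rewrite (ord1 i) /ball /= abE toC_lt abBC.
have [e e0 eP] := oP a Pa.
apply/nbhs_ballP; exists (toC e) => /=; first by rewrite -toC0 toC_lt.
move=> z [_ ze]; apply: eP => i; have := ze 0 i.
by rewrite /ball /= abE toC_lt abBC.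
Qed.

End RowVectors.
End Modulus.

Section MinBounds.
Context {R : realType}.
Implicit Types r : R.

Lemma min_boundl r r' : 0 < r -> 0 < r' -> 0 <= Num.min r r' <= r.
Proof. by move=> r0 r'0; rewrite ge_min lexx andbT le_min !ltW. Qed.

Lemma min_boundr r r' : 0 < r -> 0 < r' -> 0 <= Num.min r r' <= r'.
Proof. by move=> r0 r'0; rewrite minC; apply: min_boundl. Qed.

Lemma min_gt0 r r' : 0 < r -> 0 < r' -> 0 < Num.min r r'.
Proof. by move=> r0 r'0; rewrite lt_min r0. Qed.

End MinBounds.

Section WeightedNorm.
Context {R : realType} {n : nat}.
Local Notation C := (Cplx R).
Implicit Types (p q : fps C n) (r M : R) (k m : multinom n) (d N : nat).

(* The weighted l^1 norm of [p] on the polydisc of radius [r] is at most [M]. *)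
Definition nb p r M := forall N, \sum_(k : bmultinom n N) ab (p k) * r ^+ mdeg k <= M.

Definition cv r p := exists M, nb p r M.

Lemma convergentP p : convergent p <-> exists2 r, 0 < r & cv r p.
Proof.
have E r N : \sum_(k : bmultinom n N) `|p k| * toC r ^+ mdeg k =
   toC (\sum_(k : bmultinom n N) ab (p k) * r ^+ mdeg k).
  by rewrite toC_sum; apply: eq_bigr => k _; rewrite toCM toCX abE.
split=> [[_ [M [/toC_gt0[r r0 ->] pM]]]|[r r0 [M pM]]].
  exists r => //; exists (complex.Re M) => N; have := pM N; rewrite E => pN.
  by move: pN; rewrite lecE => /andP[].
exists (toC r), (toC M); split; first by rewrite -toC0 toC_lt.
by move=> N; rewrite E toC_le.
Qed.

Lemma nb_ge0 p r M : nb p r M -> 0 <= M.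
Proof.
move=> /(_ 0%N); apply: le_trans; rewrite big1 // => k _.
by have := bmdeg k; rewrite ltn0.
Qed.

Lemma wterm_ge0 p r k : 0 <= r -> 0 <= ab (p k) * r ^+ mdeg k.
Proof. by move=> r0; rewrite mulr_ge0 ?ab_ge0 ?exprn_ge0. Qed.

Lemma nb_leM p r M M' : M <= M' -> nb p r M -> nb p r M'.
Proof. by move=> MM pM N; apply: le_trans (pM N) MM. Qed.

Lemma nb_mono p q r r' M : 0 <= r' <= r -> (forall k, ab (p k) <= ab (q k)) ->
  nb q r M -> nb p r' M.
Proof.
move=> /andP[r0 rr] pq qM N; apply: le_trans (qM N); apply: ler_sum => k _.
by rewrite ler_pM ?ab_ge0 ?exprn_ge0 // lerXn2r // nnegrE (le_trans r0).
Qed.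

Lemma nb_ler p r r' M : 0 <= r' <= r -> nb p r M -> nb p r' M.
Proof. by move=> rr; apply: nb_mono. Qed.

(** Every term present has degree at least [d], so that shrinking the radius by the factor [t] gains
    t^d, as in the Schwarz lemma. *)
Lemma nb_scale p r M t d : 0 <= r -> 0 <= t <= 1 -> eqd d p 0 ->
  nb p r M -> nb p (t * r) (t ^+ d * M).
Proof.
move=> r0 /andP[t0 t1] p0 pM N.
apply: le_trans (ler_wpM2l (exprn_ge0 d t0) (pM N)); rewrite mulr_sumr.
apply: ler_sum => k _; have [kd|dk] := ltnP (mdeg k) d.
  by rewrite p0 // fps0 ab0 !mul0r mulr0.
rewrite exprMn mulrCA ler_wpM2r ?wterm_ge0 //.
by rewrite ler_wiXn2l.
Qed.

Lemma nb_small p r M e : 0 < r -> p mnm0 = 0 -> nb p r M -> 0 < e ->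
  exists2 r', 0 < r' <= r & nb p r' e.
Proof.
move=> r0 p0 pM e0; have M0 := nb_ge0 pM.
(* The term 1 added to [M] keeps the quotient meaningful when [M] is 0. *)
pose t := Num.min 1 (e / (M + 1)).
have M1 : 0 < M + 1 by lra.
have t0 : 0 < t by rewrite lt_min ltr01 divr_gt0.
have t1 : t <= 1 by rewrite ge_min lexx.
exists (t * r); first by rewrite mulr_gt0 //= ler_piMl // ltW.
have tM : t * (M + 1) <= e by rewrite -ler_pdivlMr // ge_min lexx orbT.
apply: (@nb_leM _ _ (t ^+ 1 * M)).
  by rewrite expr1 (le_trans _ tM) // ler_wpM2l ?ltW // ; lra.
by apply: nb_scale => //; [exact: ltW | rewrite ltW | apply/eqd1].
Qed.

Lemma nbD p q r M M' : 0 <= r -> nb p r M -> nb q r M' -> nb (p + q) r (M + M').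
Proof.
move=> r0 pM qM N; apply: le_trans (lerD (pM N) (qM N)); rewrite -big_split /=.
apply: ler_sum => k _; rewrite -mulrDl ler_wpM2r ?exprn_ge0 //.
exact: abD.
Qed.

Lemma nbN p r M : nb p r M -> nb (- p) r M.
Proof.
move=> pM N; have := pM N; under eq_bigr do rewrite -abN.
by [].
Qed.

Lemma nbC c r : nb (fpsC c) r (ab c).
Proof.
move=> N; have [->|N0] := posnP N.
  by rewrite big1 ?ab_ge0 // => k _; have := bmdeg k; rewrite ltn0.
rewrite -(prednK N0) (bigD1 bm0) //= /fpsC eqxx mulr1n mdeg0 expr0 mulr1 big1 ?addr0 // => k /eqP kn.
case: eqP => [kE|]; last by rewrite ab0 mul0r.
by case: kn; apply: val_inj.
Qed.

Lemma nb0 r : nb 0 r 0.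
Proof. by move=> N; rewrite big1 // => k _; rewrite fps0 ab0 mul0r. Qed.

Lemma nbX i r : 0 <= r -> nb (fpsX i) r r.
Proof.
move=> r0 N; have [N1|N1] := leqP N 1.
  rewrite big1 // => k _; rewrite /fpsX; case: eqP => [kE|]; last by rewrite ab0 mul0r.
  by have := leq_trans (bmdeg k) N1; rewrite kE mdeg1.
have i1 : (mdeg (mnm1 i) < N)%N by rewrite mdeg1.
rewrite (bigD1 (BMultinom i1)) //= /fpsX eqxx ab1 mul1r mdeg1 expr1 big1 ?addr0 // => k /eqP kn.
case: eqP => [kE|]; last by rewrite ab0 mul0r.
by case: kn; apply: val_inj.
Qed.

(** The weights are multiplicative, so the truncated norm of the product is at most a sum over part
    of the square of pairs; the sum over the whole square is the product of the truncated norms. *)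
Lemma nbM p q r M M' : 0 <= r -> nb p r M -> nb q r M' -> nb (p * q) r (M * M').
Proof.
move=> r0 pM qM N.
pose Phi k l := (ab (p k) * r ^+ mdeg k) * (ab (q l) * r ^+ mdeg l).
apply: (@le_trans _ _ (\sum_(m : bmultinom n N) \sum_(k : bmultinom n N * bmultinom n N |
   m == mnm_add k.1 k.2 :> multinom n) Phi k.1 k.2)).
  apply: ler_sum => m _; rewrite (fpsME p q (bmdeg m)).
  apply: le_trans (ler_wpM2r _ (ab_sum _ _ _)) _; first by rewrite exprn_ge0.
  rewrite mulr_suml; apply: ler_sum => -[k l] /eqP -> /=.
  by rewrite /Phi abM mdegD exprD le_eqVlt; apply/orP; left; apply/eqP; ring.
rewrite bmsum_pairs.
apply: (@le_trans _ _ (\sum_(k : bmultinom n N * bmultinom n N) Phi k.1 k.2)).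
  rewrite [leRHS](bigID (fun k : bmultinom n N * bmultinom n N => (mdeg k.1 + mdeg k.2 < N)%N)) /=.
  rewrite lerDl; apply: sumr_ge0 => k _; by rewrite mulr_ge0 ?wterm_ge0.
rewrite -(pair_big xpredT xpredT (fun k l : bmultinom n N => Phi k l)) /=.
have -> : \sum_(i : bmultinom n N) \sum_(j : bmultinom n N) Phi i j =
  (\sum_(k : bmultinom n N) ab (p k) * r ^+ mdeg k) * (\sum_(k : bmultinom n N) ab (q k) * r ^+ mdeg k).
  by rewrite big_distrlr.
by apply: ler_pM => //; apply: sumr_ge0 => k _; exact: wterm_ge0.
Qed.

Lemma cv_nb r p M : nb p r M -> cv r p. Proof. by exists M. Qed.
Lemma cv_ler r r' p : 0 <= r' <= r -> cv r p -> cv r' p.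
Proof. by move=> rr [M pM]; exists M; apply: nb_ler pM. Qed.
Lemma cvD r p q : 0 <= r -> cv r p -> cv r q -> cv r (p + q).
Proof. by move=> r0 [M pM] [M' qM]; exists (M + M'); apply: nbD. Qed.
Lemma cvN r p : cv r p -> cv r (- p).
Proof. by move=> [M pM]; exists M; apply: nbN. Qed.
Lemma cvB r p q : 0 <= r -> cv r p -> cv r q -> cv r (p - q).
Proof. by move=> r0 pM qM; apply: cvD => //; apply: cvN. Qed.
Lemma cvC r c : cv r (fpsC c). Proof. by exists (ab c); apply: nbC. Qed.
Lemma cv0 r : cv r 0. Proof. by exists 0; apply: nb0. Qed.
Lemma cv1 r : cv r 1. Proof. exact: cvC. Qed.
Lemma cvX r i : 0 <= r -> cv r (fpsX i). Proof. by exists r; apply: nbX. Qed.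
Lemma cvM r p q : 0 <= r -> cv r p -> cv r q -> cv r (p * q).
Proof. by move=> r0 [M pM] [M' qM]; exists (M * M'); apply: nbM. Qed.
Lemma cvXn r p (k : nat) : 0 <= r -> cv r p -> cv r (p ^+ k).
Proof. by move=> r0 pr; elim: k => [|k IH]; [exact: cv1 | rewrite exprS; apply: cvM]. Qed.
Lemma cv_sum r (I : Type) (s : seq I) (P : pred I) (F : I -> fps C n) : 0 <= r ->
  (forall i, P i -> cv r (F i)) -> cv r (\sum_(i <- s | P i) F i).
Proof. by move=> r0 Fr; elim/big_rec: _ => [|i x Pi]; [exact: cv0 | apply: cvD => //; apply: Fr]. Qed.
Lemma cv_prod r (I : Type) (s : seq I) (P : pred I) (F : I -> fps C n) : 0 <= r ->
  (forall i, P i -> cv r (F i)) -> cv r (\prod_(i <- s | P i) F i).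
Proof. by move=> r0 Fr; elim/big_rec: _ => [|i x Pi]; [exact: cv1 | apply: cvM => //; apply: Fr]. Qed.

Lemma convergent_cv p q : convergent p -> convergent q -> exists2 r, 0 < r & cv r p /\ cv r q.
Proof.
move=> /convergentP[r r0 pr] /convergentP[r' r'0 qr].
exists (Num.min r r'); first by rewrite lt_min r0.
by split; [apply: cv_ler pr; apply: min_boundl | apply: cv_ler qr; apply: min_boundr].
Qed.

Lemma convergent_cvs (I : finType) (F : I -> fps C n) : (forall i, convergent (F i)) ->
  exists2 r, 0 < r & forall i, cv r (F i).
Proof.
move=> Fc.
suff [r r0 rF] : exists2 r, 0 < r & forall i, i \in enum I -> cv r (F i).
  by exists r => // i; apply: rF; rewrite mem_enum.
elim: (enum I) => [|i s [r r0 IH]]; first by exists 1.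
have /convergentP[r' r'0 Fr] := Fc i.
have rr : 0 <= Num.min r r' <= r by apply: min_boundl.
have rr' : 0 <= Num.min r r' <= r' by apply: min_boundr.
exists (Num.min r r'); first by rewrite lt_min r0.
move=> j; rewrite inE => /orP[/eqP ->|/IH]; [exact: cv_ler Fr | exact: cv_ler].
Qed.

Lemma convergentD p q : convergent p -> convergent q -> convergent (p + q).
Proof.
move=> pc qc; have [r r0 [pr qr]] := convergent_cv pc qc.
by apply/convergentP; exists r => //; apply: cvD => //; apply: ltW.
Qed.
Lemma convergentM p q : convergent p -> convergent q -> convergent (p * q).
Proof.
move=> pc qc; have [r r0 [pr qr]] := convergent_cv pc qc.
by apply/convergentP; exists r => //; apply: cvM => //; apply: ltW.
Qed.
Lemma convergentN p : convergent p -> convergent (- p).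
Proof. by move=> /convergentP[r r0 pr]; apply/convergentP; exists r => //; apply: cvN. Qed.
Lemma convergentB p q : convergent p -> convergent q -> convergent (p - q).
Proof. by move=> pc qc; apply: convergentD => //; apply: convergentN. Qed.
Lemma convergentC c : convergent (fpsC c : fps C n).
Proof. by apply/convergentP; exists 1 => //; apply: cvC. Qed.
Lemma convergent1 : convergent (1 : fps C n). Proof. exact: convergentC. Qed.
Lemma convergent0 : convergent (0 : fps C n).
Proof. by apply/convergentP; exists 1 => //; apply: cv0. Qed.
Lemma convergentX i : convergent (fpsX i : fps C n).
Proof. by apply/convergentP; exists 1 => //; apply: cvX. Qed.
Lemma convergentXn p (k : nat) : convergent p -> convergent (p ^+ k).
Proof. by move=> pc; elim: k => [|k IH]; [exact: convergent1 | rewrite exprS; apply: convergentM]. Qed.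
Lemma convergent_sum (I : Type) (s : seq I) (P : pred I) (F : I -> fps C n) :
  (forall i, P i -> convergent (F i)) -> convergent (\sum_(i <- s | P i) F i).
Proof. by move=> Fr; elim/big_rec: _ => [|i x Pi]; [exact: convergent0 | apply: convergentD; apply: Fr]. Qed.

Lemma nb_smalls (I : finType) (F : I -> fps C n) r e : 0 < r ->
    (forall i, F i mnm0 = 0) -> (forall i, cv r (F i)) -> 0 < e ->
  exists2 r', 0 < r' <= r & forall i, nb (F i) r' e.
Proof.
move=> r0 F0 Fr e0.
suff [r' r'0 Fr'] : exists2 r', 0 < r' <= r & forall i, i \in enum I -> nb (F i) r' e.
  by exists r' => // i; apply: Fr'; rewrite mem_enum.
elim: (enum _) => [|i s [r1 /andP[r10 r1r] IH]]; first by exists r; rewrite ?r0 ?lexx.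
have [Mi FM] := Fr i.
have [r2 /andP[r20 r2r] Fr2] := nb_small r0 (F0 i) FM e0.
have rr := min_boundl r10 r20; have rr' := min_boundr r10 r20.
exists (Num.min r1 r2); first by rewrite min_gt0 //= ge_min r1r.
by move=> j; rewrite inE => /orP[/eqP ->|/IH]; [apply: nb_ler rr' Fr2 | apply: nb_ler rr].
Qed.

End WeightedNorm.

Section NormComp.
Context {R : realType} {n p : nat}.
Local Notation C := (Cplx R).

Lemma nb_mmon (G : 'I_n -> fps C p) r rho k : 0 <= r -> (forall i, nb (G i) r rho) ->
  nb (mmon G k) r (rho ^+ mdeg k).
Proof.
move=> r0 Gr; rewrite /mmon mdegE.
elim/big_rec2: _ => [|i e f _ fe].
  by rewrite expr0 -ab1; apply: nbC.
rewrite exprD; apply: nbM => //.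
elim: (k i) => [|j IH]; first by rewrite !expr0 -ab1; apply: nbC.
by rewrite !exprS; apply: nbM.
Qed.

(** Each monomial of degree k in [G] has norm at most rho^k at radius [r]. After passing to absolute
    values, the two summations can be exchanged, which leaves the norm of [h] at radius [rho]. *)
Lemma nb_comp (h : fps C n) (G : 'I_n -> fps C p) r rho M :
  0 <= r -> 0 <= rho -> nb h rho M -> (forall i, nb (G i) r rho) -> nb (fps_comp h G) r M.
Proof.
move=> r0 rho0 hM Gr N; apply: le_trans (hM N).
apply: (@le_trans _ _ (\sum_(m : bmultinom p N) \sum_(k : bmultinom n N)
   ab (h k) * (ab (mmon G k m) * r ^+ mdeg m))).
  apply: ler_sum => m _; rewrite fps_compE psubE.
  apply: le_trans (ler_wpM2r _ (ab_sum _ _ _)) _; first by rewrite exprn_ge0.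
  rewrite [leRHS](bmsum_split (fun k => ab (h k) * (ab (mmon G k m) * r ^+ mdeg m)) (bmdeg m)).
  rewrite -[leLHS]addr0; apply: lerD.
    by rewrite mulr_suml; apply: ler_sum => k _; rewrite abM mulrA.
  by apply: sumr_ge0 => k _; rewrite !mulr_ge0 ?ab_ge0 ?exprn_ge0.
rewrite exchange_big /=; apply: ler_sum => k _; rewrite -mulr_sumr.
by rewrite ler_wpM2l ?ab_ge0 //; apply: nb_mmon.
Qed.

Lemma convergent_comp (h : fps C n) (G : 'I_n -> fps C p) : const0 G ->
  convergent h -> (forall i, convergent (G i)) -> convergent (fps_comp h G).
Proof.
move=> G0 /convergentP[rho rho0 [M hM]] Gc.
have [r r0 Gr] := convergent_cvs Gc.
have [r' /andP[r'0 rr'] Gr'] := nb_smalls r0 G0 Gr rho0.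
apply/convergentP; exists r' => //; exists M.
by apply: nb_comp Gr' => //; apply: ltW.
Qed.

End NormComp.

Section Evaluation.
Context {R : realType} {n : nat}.
Local Notation C := (Cplx R).
Implicit Types (p q : fps C n) (r M : R) (k m : multinom n) (d N : nat) (z w : 'rV[C]_n).

Definition pdisc r z := forall i, ab (z 0 i) <= r.

Definition zmon z k : C := \prod_i z 0 i ^+ k i.

Lemma zmonD z k m : zmon z (mnm_add k m) = zmon z k * zmon z m.
Proof. by rewrite /zmon -big_split; apply: eq_bigr => i _; rewrite mnmDE exprD. Qed.

Lemma ab_zmon z k : ab (zmon z k) = \prod_i ab (z 0 i) ^+ k i.
Proof. by rewrite ab_prod; apply: eq_bigr => i _; rewrite abX. Qed.

Lemma zmon_le r z k : pdisc r z -> ab (zmon z k) <= r ^+ mdeg k.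
Proof.
move=> zr; rewrite ab_zmon mdegE -prodrXr.
apply: ler_prod => i _; rewrite exprn_ge0 ?ab_ge0 //= lerXn2r ?nnegrE ?ab_ge0 //.
exact: le_trans (ab_ge0 _) (zr i).
Qed.

Lemma psumE p z N : psum p z N = \sum_(k : bmultinom n N) p k * zmon z k.
Proof. by []. Qed.

(** Halving the radius multiplies the terms of degree at least [N] by at most 2^-N. This geometric
    rate is the reason why evaluation is always restricted to [pdisc (r / 2)]. *)
Lemma half_tail r M p N N' : 0 <= r -> nb p r M ->
  \sum_(k : bmultinom n N' | (N <= mdeg k)%N) ab (p k) * (r / 2) ^+ mdeg k <= M * 2^-1 ^+ N.
Proof.
move=> r0 pM.
apply: (@le_trans _ _ (\sum_(k : bmultinom n N' | (N <= mdeg k)%N) (ab (p k) * r ^+ mdeg k) * 2^-1 ^+ N)).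
  apply: ler_sum => k Nk; rewrite exprMn mulrA ler_wpM2l ?wterm_ge0 //.
  by apply: ler_wiXn2l => //; rewrite ?invr_ge0 // invf_le1 // ler1n.
rewrite -mulr_suml ler_wpM2r ?exprn_ge0 ?invr_ge0 //.
apply: le_trans (pM N'); rewrite [leRHS](bigID (fun k : bmultinom n N' => (N <= mdeg k)%N)) /=.
by rewrite lerDl; apply: sumr_ge0 => k _; apply: wterm_ge0.
Qed.

Lemma psum_tail r M p z N N' : 0 <= r -> nb p r M -> pdisc (r / 2) z -> (N <= N')%N ->
  ab (psum p z N' - psum p z N) <= M * 2^-1 ^+ N.
Proof.
move=> r0 pM zr NN; rewrite !psumE (bmsum_split (fun k => p k * zmon z k) NN).
rewrite addrC addrA addNr add0r; apply: le_trans (half_tail N N' r0 pM).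
apply: le_trans (ab_sum _ _ _) _; apply: ler_sum => k _.
by rewrite abM ler_wpM2l ?ab_ge0 //; apply: zmon_le.
Qed.

(** A total function, with value 0 where the partial sums do not converge. *)
Definition ev p z : C := xget 0 [set l | seq_cvg (psum p z) l].

Lemma ev_eq p z l : seq_cvg (psum p z) l -> ev p z = l.
Proof.
by move=> pl; rewrite /ev; case: xgetP => [y _ py|/(_ l)] //; apply: seq_cvg_uniq py pl.
Qed.

Lemma psum_cvg r p z : 0 <= r -> cv r p -> pdisc (r / 2) z -> seq_cvg (psum p z) (ev p z).
Proof.
move=> r0 [M pM] zr.
have [|l ul] := @half_pow_cauchy _ (psum p z) M; last by rewrite (ev_eq ul).
by move=> N N' NN; apply: psum_tail pM zr NN.
Qed.

Lemma ev_approx r M p z N : 0 <= r -> nb p r M -> pdisc (r / 2) z ->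
  ab (ev p z - psum p z N) <= M * 2^-1 ^+ N.
Proof.
move=> r0 pM zr; apply: (seq_cvg_le (psum_cvg r0 (cv_nb pM) zr)).
by exists N => N' NN; apply: psum_tail pM zr NN.
Qed.

Lemma ev_le r M p z : 0 <= r -> nb p r M -> pdisc (r / 2) z -> ab (ev p z) <= M.
Proof.
move=> r0 pM zr; have := ev_approx 0 r0 pM zr.
rewrite expr0 mulr1 psumE big1 ?subr0 // => k _.
by have := bmdeg k; rewrite ltn0.
Qed.

Lemma psum0 p N : psum p 0 N.+1 = p mnm0.
Proof.
rewrite psumE (bigD1 bm0) //= big1 ?addr0 => [|k /eqP k0].
  by rewrite /zmon big1 ?mulr1 // => i _; rewrite mnm0E.
have [i ki] : exists i, k i != 0%N.
  apply: contrapT => /forallNP ki; apply: k0; apply/val_inj/mnmP => i; rewrite mnm0E.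
  by have /negP := ki i; rewrite negbK => /eqP.
by rewrite /zmon (bigD1 i) //= mxE expr0n (negbTE ki) mul0r mulr0.
Qed.

Lemma ev0 p : ev p 0 = p mnm0.
Proof.
by apply: ev_eq => e e0; exists 1%N => -[//|k _]; rewrite psum0 subrr ab0.
Qed.

Lemma evD r p q z : 0 <= r -> cv r p -> cv r q -> pdisc (r / 2) z ->
  ev (p + q) z = ev p z + ev q z.
Proof.
move=> r0 [M pM] [M' qM] zr; apply: ev_eq; apply: (@seq_cvg_half _ _ _ (M + M')) => N.
have -> : psum (p + q) z N = psum p z N + psum q z N.
  by rewrite !psumE -big_split; apply: eq_bigr => k _; rewrite fpsD mulrDl.
rewrite mulrDl; apply: le_trans (lerD (ev_approx N r0 pM zr) (ev_approx N r0 qM zr)).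
by rewrite opprD addrACA; apply: abD.
Qed.

Lemma evM r p q z : 0 <= r -> cv r p -> cv r q -> pdisc (r / 2) z ->
  ev (p * q) z = ev p z * ev q z.
Proof.
move=> r0 [M pM] [M' qM] zr.
have M0 := nb_ge0 pM; have M'0 := nb_ge0 qM.
(* Of the three errors, two come from truncating the factors and one from the pairs of total degree
   at least [N]. *)
apply: ev_eq; apply: (@seq_cvg_half _ _ _ (3 * (M * M'))) => N.
have r20 : 0 <= r / 2 by rewrite divr_ge0.
have hN : 0 <= 2^-1 ^+ N :> R by rewrite exprn_ge0 ?invr_ge0.
have PQ : ab (psum p z N * psum q z N - psum (p * q) z N) <= M * M' * 2^-1 ^+ N.
  pose Phi k l := (p k * zmon z k) * (q l * zmon z l).
  have -> : psum (p * q) z N = \sum_(k : bmultinom n N * bmultinom n N | (mdeg k.1 + mdeg k.2 < N)%N) Phi k.1 k.2.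
    rewrite -(bmsum_pairs N Phi) psumE; apply: eq_bigr => k _.
    rewrite (fpsME p q (bmdeg k)) mulr_suml; apply: eq_bigr => -[l1 l2] /eqP -> /=.
    by rewrite /Phi zmonD; ring.
  have -> : psum p z N * psum q z N = \sum_(k : bmultinom n N * bmultinom n N) Phi k.1 k.2.
    by rewrite !psumE big_distrlr pair_big.
  rewrite (bigID (fun k : bmultinom n N * bmultinom n N => (mdeg k.1 + mdeg k.2 < N)%N)) /=.
  rewrite addrAC subrr add0r.
  apply: le_trans (ab_sum _ _ _) _.
  pose W k l := (ab (p k) * r ^+ mdeg k) * (ab (q l) * r ^+ mdeg l).
  apply: (@le_trans _ _ (\sum_(k : bmultinom n N * bmultinom n N) W k.1 k.2 * 2^-1 ^+ N)).
    rewrite [leRHS](bigID (fun k : bmultinom n N * bmultinom n N => (mdeg k.1 + mdeg k.2 < N)%N)) /=.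
    rewrite -[leLHS]add0r; apply: lerD.
      by apply: sumr_ge0 => k _; rewrite mulr_ge0 // /W mulr_ge0 ?wterm_ge0.
    apply: ler_sum => -[k l] /=; rewrite -leqNgt => Nkl.
    apply: (@le_trans _ _ ((ab (p k) * (r / 2) ^+ mdeg k) * (ab (q l) * (r / 2) ^+ mdeg l))).
      by rewrite /Phi !abM ler_pM ?mulr_ge0 ?ab_ge0 // ler_wpM2l ?ab_ge0 //; apply: zmon_le.
    rewrite /W !exprMn.
    have -> : ab (p k) * (r ^+ mdeg k * 2^-1 ^+ mdeg k) * (ab (q l) * (r ^+ mdeg l * 2^-1 ^+ mdeg l))
       = W k l * 2^-1 ^+ (mdeg k + mdeg l) by rewrite /W exprD; ring.
    rewrite ler_wpM2l //; first by rewrite mulr_ge0 // wterm_ge0.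
    by apply: ler_wiXn2l => //; rewrite ?invr_ge0 // invf_le1 // ler1n.
  rewrite -mulr_suml ler_wpM2r //.
  rewrite -(pair_big xpredT xpredT (fun k l : bmultinom n N => W k l)) /=.
  have -> : \sum_(i : bmultinom n N) \sum_(j : bmultinom n N) W i j =
    (\sum_(k : bmultinom n N) ab (p k) * r ^+ mdeg k) * (\sum_(k : bmultinom n N) ab (q k) * r ^+ mdeg k).
    by rewrite big_distrlr.
  by apply: ler_pM => //; apply: sumr_ge0 => k _; exact: wterm_ge0.
have pN := ev_approx N r0 pM zr; have qN := ev_approx N r0 qM zr.
have eq := ev_le r0 qM zr.
have sp : ab (psum p z N) <= M.
  rewrite psumE; apply: le_trans (ab_sum _ _ _) _; apply: le_trans (pM N).
  apply: ler_sum => k _; rewrite abM ler_wpM2l ?ab_ge0 //.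
  apply: le_trans (zmon_le _ zr) _; rewrite lerXn2r ?nnegrE //.
  by rewrite ler_pdivrMr // ler_peMr // ler1n.
have -> : ev p z * ev q z - psum (p * q) z N =
  (ev p z - psum p z N) * ev q z + psum p z N * (ev q z - psum q z N) +
  (psum p z N * psum q z N - psum (p * q) z N) by ring.
apply: le_trans (abD _ _) _; apply: le_trans (lerD (abD _ _) PQ) _.
have A1 : ab ((ev p z - psum p z N) * ev q z) <= M * 2^-1 ^+ N * M'.
  by rewrite abM ler_pM ?ab_ge0.
have A2 : ab (psum p z N * (ev q z - psum q z N)) <= M * (M' * 2^-1 ^+ N).
  by rewrite abM ler_pM ?ab_ge0.
have -> : 3 * (M * M') * 2^-1 ^+ N = M * 2^-1 ^+ N * M' + M * (M' * 2^-1 ^+ N) + M * M' * 2^-1 ^+ N.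
  by ring.
by rewrite lerD2r lerD.
Qed.

Lemma evC c z : ev (fpsC c) z = c.
Proof.
apply: ev_eq => e e0; exists 1%N => -[//|k _].
rewrite psumE (bigD1 bm0) //= /fpsC eqxx mulr1n big1 ?addr0 => [|l /eqP l0].
  by rewrite /zmon big1 ?mulr1 ?subrr ?ab0 // => i _; rewrite mnm0E.
by case: eqP => [lE|]; [case: l0; apply: val_inj | rewrite mul0r].
Qed.

Lemma evX i z : ev (fpsX i) z = z 0 i.
Proof.
apply: ev_eq => e e0; exists 2%N => -[|[|k]] // _.
have i1 : (mdeg (mnm1 i) < k.+2)%N by rewrite mdeg1.
rewrite psumE (bigD1 (BMultinom i1)) //= /fpsX eqxx mul1r big1 ?addr0 => [|l /eqP l0].
  rewrite /zmon (bigD1 i) //= mnm1E eqxx expr1 big1 ?mulr1 ?subrr ?ab0 // => j ji.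
  by rewrite mnm1E eq_sym (negbTE ji).
by case: eqP => [lE|]; [case: l0; apply: val_inj | rewrite mul0r].
Qed.

Lemma ev_1 z : ev 1 z = 1. Proof. exact: evC. Qed.
Lemma ev_0 z : ev 0 z = 0.
Proof. by have -> : (0 : fps C n) = fpsC 0; [rewrite raddf0 | rewrite evC]. Qed.

Lemma evN r p z : 0 <= r -> cv r p -> pdisc (r / 2) z -> ev (- p) z = - ev p z.
Proof.
move=> r0 pr zr; apply/eqP; rewrite -addr_eq0 -(evD r0 _ pr zr) ?addNr ?ev_0 //.
exact: cvN.
Qed.

Lemma evB r p q z : 0 <= r -> cv r p -> cv r q -> pdisc (r / 2) z ->
  ev (p - q) z = ev p z - ev q z.
Proof. by move=> r0 pr qr zr; rewrite (evD r0 pr (cvN qr) zr) (evN r0 qr zr). Qed.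

Lemma ev_sum r z (I : Type) (s : seq I) (P : pred I) (F : I -> fps C n) : 0 <= r ->
  (forall i, P i -> cv r (F i)) -> pdisc (r / 2) z ->
  ev (\sum_(i <- s | P i) F i) z = \sum_(i <- s | P i) ev (F i) z.
Proof.
move=> r0 Fr zr; elim: s => [|i s IH]; first by rewrite !big_nil ev_0.
rewrite !big_cons; case: ifP => // Pi; rewrite (evD r0 (Fr i Pi)) ?IH //.
exact: cv_sum.
Qed.

Lemma ev_prod r z (I : Type) (s : seq I) (P : pred I) (F : I -> fps C n) : 0 <= r ->
  (forall i, P i -> cv r (F i)) -> pdisc (r / 2) z ->
  ev (\prod_(i <- s | P i) F i) z = \prod_(i <- s | P i) ev (F i) z.
Proof.
move=> r0 Fr zr; elim: s => [|i s IH]; first by rewrite !big_nil ev_1.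
rewrite !big_cons; case: ifP => // Pi; rewrite (evM r0 (Fr i Pi)) ?IH //.
exact: cv_prod.
Qed.

Lemma evXn r p (k : nat) z : 0 <= r -> cv r p -> pdisc (r / 2) z -> ev (p ^+ k) z = ev p z ^+ k.
Proof.
move=> r0 pr zr; elim: k => [|k IH]; first by rewrite !expr0 ev_1.
by rewrite !exprS (evM r0 pr) ?IH //; apply: cvXn.
Qed.

Lemma pdisc_le r r' z : r <= r' -> pdisc r z -> pdisc r' z.
Proof. by move=> rr zr i; apply: le_trans (zr i) rr. Qed.

Lemma pdisc_exists (z : 'rV[C]_n) : exists2 r : R, 0 <= r & pdisc (r / 2) z.
Proof.
exists (2 * (1 + \sum_j ab (z 0 j))); first by rewrite mulr_ge0 // addr_ge0 // sumr_ge0 // => j _; apply: ab_ge0.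
move=> j; rewrite mulrC mulKf // (bigD1 j) //= addrCA lerDl addr_ge0 //.
by apply: sumr_ge0 => k _; apply: ab_ge0.
Qed.

Lemma expansionP f a p : expansion f a p <->
  exists2 r, 0 < r & cv r p /\ forall z, pdisc (r / 2) z -> f (a + z) = ev p z.
Proof.
split=> [[/convergentP[r r0 pr] /nbhs0P[e e0 fe]]|[r r0 [pr fr]]].
  have m0 := min_gt0 r0 e0.
  have pr' : cv (Num.min r e) p by apply: cv_ler pr; apply: min_boundl.
  exists (Num.min r e) => //; split=> // z zr.
  apply/esym/ev_eq/seq_cvgP/fe => i; apply: le_lt_trans (zr i) _.
  rewrite ltr_pdivrMr // (@le_lt_trans _ _ e) ?ge_min ?lexx ?orbT //.
  by rewrite ltr_pMr // ltr1n.
split; first by apply/convergentP; exists r.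
apply/nbhs0P; exists (r / 2); first by rewrite divr_gt0.
move=> z zr; apply/seq_cvgP.
have zr' : pdisc (r / 2) z by move=> i; apply: ltW.
by rewrite fr //; apply: psum_cvg pr zr'; apply: ltW.
Qed.

Lemma ev_cont0 r p e : 0 < r -> cv r p -> 0 < e ->
  exists2 d, 0 < d & forall z, pdisc d z -> ab (ev p z - p mnm0) <= e.
Proof.
move=> r0 pr e0; have r0' := ltW r0.
have [M qM] : cv r (p - fpsC (p mnm0)) by apply: cvB => //; apply: cvC.
have q0 : (p - fpsC (p mnm0)) mnm0 = 0 by rewrite fpsB /fpsC eqxx subrr.
have [r' /andP[r'0 rr'] qr'] := nb_small r0 q0 qM e0.
exists (r' / 2); first by rewrite divr_gt0.
move=> z zr; have zr' : pdisc (r / 2) z by apply: pdisc_le zr; rewrite ler_wpM2r ?invr_ge0.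
have E := evB r0' pr (cvC _ (p mnm0)) zr'; rewrite evC in E; rewrite -E.
by apply: ev_le qr' zr; apply: ltW.
Qed.

End Evaluation.

Section EvalComp.
Context {R : realType} {n p : nat}.
Local Notation C := (Cplx R).

Definition evs (G : 'I_n -> fps C p) (z : 'rV[C]_p) : 'rV[C]_n := \row_i ev (G i) z.

Lemma evs_pdisc (G : 'I_n -> fps C p) r rho z : 0 <= r ->
  (forall i, nb (G i) r rho) -> pdisc (r / 2) z -> pdisc rho (evs G z).
Proof. by move=> r0 Gr zr i; rewrite mxE; apply: ev_le zr. Qed.

Lemma ev_mmon (G : 'I_n -> fps C p) r k z : 0 <= r -> (forall i, cv r (G i)) ->
  pdisc (r / 2) z -> ev (mmon G k) z = zmon (evs G z) k.
Proof.
move=> r0 Gr zr; rewrite /mmon (ev_prod _ r0) => [|i _|//]; last exact: cvXn.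
by apply: eq_bigr => i _; rewrite mxE; apply: evXn (Gr i) zr.
Qed.

(** [h] is cut at degree [N]. The head is a polynomial, for which evaluation commutes with
    substitution. The tail has norm at most M 2^-N at radius rho / 2, hence so has its composite
    with [G], and its value is as small. *)
Lemma ev_comp (h : fps C n) (G : 'I_n -> fps C p) r rho z :
  0 <= r -> 0 <= rho -> const0 G -> cv rho h -> (forall i, nb (G i) r (rho / 2)) ->
  pdisc (r / 2) z -> ev (fps_comp h G) z = ev h (evs G z).
Proof.
move=> r0 rho0 G0 [M hM] Gr zr; apply/esym.
apply: ev_eq; apply: (@seq_cvg_half _ _ _ M) => N.
have rho20 : 0 <= rho / 2 by rewrite divr_ge0.
pose t : fps C n := fun m => if (mdeg m < N)%N then 0 else h m.
have tb : nb t (rho / 2) (M * 2^-1 ^+ N).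
  move=> N'; have [N'N|NN'] := leqP N' N.
    rewrite big1 ?mulr_ge0 ?(nb_ge0 hM) ?exprn_ge0 ?invr_ge0 // => k _.
    by rewrite /t (leq_trans (bmdeg k)) // ab0 mul0r.
  apply: le_trans (half_tail N N' rho0 hM).
  rewrite (bigID (fun k : bmultinom n N' => (N <= mdeg k)%N)) /= [X in _ + X]big1 ?addr0.
    by apply: ler_sum => k; rewrite /t ltnNge => ->.
  by move=> k; rewrite -ltnNge /t => ->; rewrite ab0 mul0r.
have Gc i : cv r (G i) by exists (rho / 2).
have tc : cv r (fps_comp t G) by exists (M * 2^-1 ^+ N); apply: nb_comp tb Gr.
have hE : fps_comp h G = psub N h G + fps_comp t G.
  have -> : h = (h - t) + t by rewrite subrK.
  rewrite fps_compD; congr (_ + _); apply: fpsP => m.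
  have -> : psub N (h - t + t) G = psub N (h - t) G.
    by apply: eq_bigr => k _; rewrite fpsD !fpsB subrK /t bmdeg subr0.
  rewrite fps_compE !psubE.
  have z0 (k : multinom n) : (N <= mdeg k)%N -> (h - t) k = 0.
    by move=> Nk; rewrite fpsB /t ltnNge Nk subrr.
  pose F k := (h - t) k * mmon G k m.
  have [mN|Nm] := ltnP (mdeg m) N.
    rewrite [RHS](bmsum_split F mN) [X in _ = _ + X]big1 ?addr0 // => k mk.
    by rewrite /F mmon_ord ?mulr0.
  rewrite [LHS](bmsum_split F (leqW Nm)) [X in _ + X = _]big1 ?addr0 // => k Nk.
  by rewrite /F z0 ?mul0r.
have pc : cv r (psub N h G).
  apply: cv_sum => // k _; apply: cvM => //; first exact: cvC.
  by exists ((rho / 2) ^+ mdeg k); apply: nb_mmon.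
have -> : psum h (evs G z) N = ev (psub N h G) z.
  rewrite psumE (ev_sum _ r0) => [|k _|//]; last first.
    by apply: cvM => //; [exact: cvC | exists ((rho / 2) ^+ mdeg k); apply: nb_mmon].
  apply: eq_bigr => k _; rewrite (evM r0 (cvC _ _) _ zr); last first.
    by exists ((rho / 2) ^+ mdeg k); apply: nb_mmon.
  by rewrite evC (ev_mmon _ r0 Gc zr).
rewrite hE (evD r0 pc tc zr) addrAC subrr add0r.
by apply: ev_le zr => //; apply: nb_comp tb Gr.
Qed.

Lemma ev_comp_near (h : fps C n) (G : 'I_n -> fps C p) : const0 G ->
    convergent h -> (forall i, convergent (G i)) ->
  exists2 r, 0 < r & forall r', 0 < r' <= r ->
    cv r' (fps_comp h G) /\ forall z, pdisc (r' / 2) z -> ev (fps_comp h G) z = ev h (evs G z).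
Proof.
move=> G0 /convergentP[rho rho0 hr] Gc.
have [r1 r10 Gr1] := convergent_cvs Gc.
have rho2 : 0 < rho / 2 by rewrite divr_gt0.
have [r /andP[r0 _] Gr] := nb_smalls r10 G0 Gr1 rho2.
exists r => // r' /andP[r'0 r'r].
have Gr' i : nb (G i) r' (rho / 2) by apply: nb_ler (Gr i); rewrite ltW.
split=> [|z zr]; last by apply: ev_comp hr Gr' zr => //; apply: ltW.
have [M hM] := hr; exists M; apply: nb_comp Gr'; rewrite ?ltW //.
by apply: nb_ler hM; rewrite ltW //= ler_pdivrMr // ler_peMr ?ltW // ltr1n.
Qed.

End EvalComp.

(** * Majorants and the convergence of implicitly defined series *)

Section Majorant.
Context {R : realType}.
Local Notation C := (Cplx R).

Lemma nb1P (f : fps C 1) (r M : R) :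
  nb f r M <-> forall N, \sum_(j < N) ab (coef1 f j) * r ^+ j <= M.
Proof.
have E N : \sum_(k : bmultinom 1 N) ab (f k) * r ^+ mdeg k = \sum_(j < N) ab (coef1 f j) * r ^+ j.
  by rewrite (bmsum1 N (fun k => ab (f k) * r ^+ mdeg k)); under eq_bigr do rewrite mdeg_mn1.
by split=> fM N; have := fM N; rewrite E.
Qed.

Lemma geom_half_le N : \sum_(j < N) 2^-1 ^+ j <= 2 :> R.
Proof.
suff -> : \sum_(j < N) 2^-1 ^+ j = 2 - 2 * 2^-1 ^+ N :> R.
  by rewrite gerBl mulr_ge0 // exprn_ge0 // invr_ge0.
elim: N => [|N IH]; first by rewrite big_ord0 expr0 mulr1 subrr.
by rewrite big_ord_recr /= IH exprS; field.
Qed.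

Definition ftrunc (n N : nat) (f : fps C n) : fps C n :=
  fun m => if (mdeg m < N)%N then f m else 0.

Lemma eqd_ftrunc n N (f : fps C n) : eqd N f (ftrunc N f).
Proof. by move=> m mN; rewrite /ftrunc mN. Qed.

Lemma nb_ftrunc n N (f : fps C n) (r : R) : 0 <= r ->
  nb (ftrunc N f) r (\sum_(k : bmultinom n N) ab (f k) * r ^+ mdeg k).
Proof.
move=> r0 N'; rewrite (bigID (fun k : bmultinom n N' => (mdeg k < N)%N)) /=.
rewrite [X in _ + X]big1 ?addr0 => [|k]; last by rewrite /ftrunc => /negbTE ->; rewrite ab0 mul0r.
have E : \sum_(k : bmultinom n N' | (mdeg k < N)%N) ab (ftrunc N f k) * r ^+ mdeg k =
   \sum_(k : bmultinom n N' | (mdeg k < N)%N) ab (f k) * r ^+ mdeg k.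
  by apply: eq_bigr => k kN; rewrite /ftrunc kN.
rewrite E; have [NN|NN] := leqP N N'; first by rewrite (bmsum_lt (fun k => ab (f k) * r ^+ mdeg k) NN).
rewrite [leRHS](bmsum_split (fun k => ab (f k) * r ^+ mdeg k) (ltnW NN)).
rewrite (eq_bigl xpredT) => [|k]; last by rewrite (leq_trans (bmdeg k)) // ltnW.
by rewrite lerDl; apply: sumr_ge0 => k _; apply: wterm_ge0.
Qed.

(** Induction on the truncation degree shows that the truncated norms of all [y i] at a small radius
    stay at most [eps]. The coefficients below [N] contribute eps / 4, the series [e] another eps /
    4, and the terms [G j] of order 2 a multiple of eps^2, again at most eps / 4. *)
Lemma fps1_majorant (p q : nat) (y : 'I_p -> fps C 1) (G : 'I_q -> fps C p)
    (e : fps C 1) (K : R) (N : nat) :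
    const0 y -> e mnm0 = 0 -> convergent e -> (forall j, convergent (G j)) ->
    (forall j, eqd 2 (G j) 0) -> 0 <= K ->
    (forall k i, (N <= k)%N -> ab (coef1 (y i) k) <=
       K * (ab (coef1 e k) + \sum_j ab (coef1 (fps_comp (G j) y) k))) ->
  forall i, convergent (y i).
Proof.
move=> y0 e0 /convergentP[re re0 [Me eM]] Gc G2 K0 yK.
have [rho rho0 Gr] := convergent_cvs Gc.
have [M M0 GM] : exists2 M, 0 < M & forall j, nb (G j) rho M.
  exists (1 + \sum_j xget 0 [set M | nb (G j) rho M]).
    rewrite ltr_pwDl //; apply: sumr_ge0 => j _.
    by case: xgetP => [M _ /nb_ge0 //|].
  move=> j; have [Mj GMj] := Gr j.
  apply: (@nb_leM _ _ _ _ (xget 0 [set M | nb (G j) rho M])).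
    rewrite (bigD1 j) //= addrCA lerDl addr_ge0 //; apply: sumr_ge0 => i _.
    by case: xgetP => [M' _ /nb_ge0 //|].
  by case: xgetP => [M' _ //|/(_ Mj)].
pose A := K * q%:R * M.
have A0 : 0 <= A by rewrite !mulr_ge0 // ltW.
(* The second bound gives K q M (eps / rho)^2 <= eps / 4, the share of the terms of order 2. *)
pose eps := Num.min rho (rho ^+ 2 / (4 * A + 1)).
have A1 : 0 < 4 * A + 1 by lra.
have eps0 : 0 < eps by rewrite min_gt0 // divr_gt0 ?exprn_gt0.
have epsr : eps <= rho by rewrite ge_min lexx.
have epsA : 4 * A * eps <= rho ^+ 2.
  have : eps * (4 * A + 1) <= rho ^+ 2 by rewrite -ler_pdivlMr // ge_min lexx orbT.
  by nra.
have Geps j : nb (G j) eps ((eps / rho) ^+ 2 * M).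
  have -> : eps = (eps / rho) * rho by rewrite divfK // gt_eqF.
  rewrite [X in X ^+ 2](_ : _ = eps / rho); last by rewrite divfK // gt_eqF.
  apply: nb_scale => //; first exact: ltW.
  apply/andP; split; first by rewrite divr_ge0 // ltW.
  by rewrite ler_pdivrMr // mul1r.
have eps4 : 0 < eps / 4 by rewrite divr_gt0.
have epsK : 0 < eps / (4 * (K + 1)) by rewrite divr_gt0 // mulr_gt0 //; lra.
have [r1 /andP[r10 r1e] er1] := nb_small re0 e0 eM epsK.
have tc i : cv 1 (ftrunc N (y i)).
  by exists (\sum_(k : bmultinom 1 N) ab (y i k) * 1 ^+ mdeg k); apply: nb_ftrunc.
have t0 i : ftrunc N (y i) mnm0 = 0 by rewrite /ftrunc y0 if_same.
have [r2 /andP[r20 _] tr2] := nb_smalls ltr01 t0 tc eps4.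
pose r := Num.min r1 r2.
have r0 : 0 < r by apply: min_gt0.
have r0' := ltW r0.
have er : nb e r (eps / (4 * (K + 1))) by apply: nb_ler er1; apply: min_boundl.
have tr i : nb (ftrunc N (y i)) r (eps / 4) by apply: nb_ler (tr2 i); apply: min_boundr.
have main k : forall i, \sum_(j < k) ab (coef1 (y i) j) * r ^+ j <= eps.
  elim: k => [|k IH] i; first by rewrite big_ord0 ltW.
  have yt j : nb (ftrunc k (y j)) r eps.
    apply: nb_leM (nb_ftrunc k (y j) r0').
    rewrite (bmsum1 _ (fun m => ab (y j m) * r ^+ mdeg m)).
    by under eq_bigr do rewrite mdeg_mn1; apply: IH.
  have yt0 : const0 (fun j => ftrunc k (y j)) by move=> j; rewrite /ftrunc y0 if_same.
  pose H j := fps_comp (G j) (fun j => ftrunc k (y j)).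
  (* As [G j] has order at least 2, its coefficients up to degree [k] only see [y] below degree [k],
     where the induction hypothesis applies. *)
  have HE j l : (l < k.+1)%N -> coef1 (fps_comp (G j) y) l = coef1 (H j) l.
    move=> lk; have : eqd k.+1 (fps_comp (G j) y) (H j).
      by apply: eqd_comp_ord2 => // l'; apply: eqd_ftrunc.
    by move/eqd1P; apply.
  have HM j : nb (H j) r ((eps / rho) ^+ 2 * M).
    by apply: nb_comp (Geps j) yt => //; apply: ltW.
  pose T l := ab (coef1 (ftrunc N (y i)) l) * r ^+ l.
  pose E l := K * (ab (coef1 e l) * r ^+ l).
  pose L l := K * \sum_j ab (coef1 (H j) l) * r ^+ l.
  have bound : \sum_(l < k.+1) ab (coef1 (y i) l) * r ^+ l <= \sum_(l < k.+1) (T l + (E l + L l)).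
    apply: ler_sum => l _; have T0 : 0 <= T l by rewrite mulr_ge0 ?ab_ge0 ?exprn_ge0.
    have E0 : 0 <= E l by rewrite !mulr_ge0 ?ab_ge0 ?exprn_ge0.
    have L0 : 0 <= L l by rewrite mulr_ge0 // sumr_ge0 // => j _; rewrite mulr_ge0 ?ab_ge0 ?exprn_ge0.
    have [lN|Nl] := ltnP l N.
      have -> : ab (coef1 (y i) l) * r ^+ l = T l.
        by rewrite /T /coef1 /ftrunc -/(mn1 l) mdeg_mn1 lN.
      by rewrite lerDl addr_ge0.
    rewrite -[leLHS]add0r; apply: lerD => //.
    have -> : E l + L l = K * (ab (coef1 e l) + \sum_j ab (coef1 (H j) l)) * r ^+ l.
      by rewrite /E /L -mulr_suml; ring.
    rewrite ler_wpM2r ?exprn_ge0 //.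
    apply: le_trans (yK _ _ Nl) _; rewrite ler_wpM2l // lerD2l.
    by apply: ler_sum => j _; rewrite HE.
  apply: (le_trans bound); rewrite !big_split /=.
  have Tb : \sum_(l < k.+1) T l <= eps / 4 by move: (tr i) => /nb1P; apply.
  have Eb : \sum_(l < k.+1) E l <= eps / 4.
    rewrite -mulr_sumr; apply: (@le_trans _ _ (K * (eps / (4 * (K + 1))))).
      by rewrite ler_wpM2l //; move: er => /nb1P; apply.
    rewrite mulrA ler_pdivrMr ?mulr_gt0 //; [|lra].
    by rewrite mulrA divfK ?pnatr_eq0 //; nra.
  have Lb : \sum_(l < k.+1) L l <= eps / 4.
    rewrite -mulr_sumr exchange_big /=.
    apply: (@le_trans _ _ (K * (\sum_(j < q) (eps / rho) ^+ 2 * M))).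
      rewrite ler_wpM2l //; apply: ler_sum => j _; by move: (HM j) => /nb1P; apply.
    rewrite sumr_const card_ord -(mulr_natr ((eps / rho) ^+ 2 * M) q).
    have -> : K * ((eps / rho) ^+ 2 * M * q%:R) = A * eps * eps / rho ^+ 2.
      by rewrite /A; field; rewrite gt_eqF.
    rewrite ler_pdivrMr ?exprn_gt0 //; nra.
  lra.
move=> i; apply/convergentP; exists r => //; exists eps.
by apply/nb1P => k; apply: main.
Qed.

Lemma fps1_implicit_convergent (e Q y : fps C 1) : convergent e -> convergent Q ->
  e mnm0 = 0 -> eqd 2 Q 0 -> y mnm0 = 0 -> y = e + fps_comp Q (fun=> y) -> convergent y.
Proof.
move=> ec Qc e0 Q2 y0 yE.
apply: (@fps1_majorant 1 1 (fun=> y) (fun=> Q) e 1 0 _ _ _ _ _ _ _ ord0) => //.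
by move=> k i _; rewrite big_ord1 mul1r {1}yE coef1D; apply: abD.
Qed.

Lemma convergent_inverse (s g : fps C 1) : convergent s -> s mnm0 = 0 -> g mnm0 = 0 ->
  coef1 s 1 != 0 -> fps_comp s (fun=> g) = X1 -> convergent g.
Proof.
move=> sc s0 g0 s1 sg; apply: (fps1_implicit_convergent _ _ _ _ g0 (fps1_inverse_eq g0 s1 sg)).
- by apply: convergentM; [exact: convergentC | exact: convergentX].
- apply: convergentB; first exact: convergentX.
  by apply: convergentM => //; exact: convergentC.
- by rewrite fpsM0 X1_0 mulr0.
- apply/eqd1P => -[|[|k]] // _; rewrite coef1B coef1CM coef1_X.
    by rewrite coef10 s0 mulr0 subr0.
  by rewrite mulVf // subrr.
Qed.

Lemma convergent_binom_tail nu : convergent (binom_tail nu : fps C 1).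
Proof.
have X1c : convergent (X1 : fps C 1) by exact: convergentX.
rewrite /binom_tail; apply: convergentM; first exact: convergentC.
apply: convergentB; last by apply: convergentM => //; exact: convergentC.
apply: convergentB; last exact: convergent1.
by apply: convergentXn; apply: convergentD => //; exact: convergent1.
Qed.

Lemma convergent_root nu (e w : fps C 1) : (0 < nu)%N -> convergent e -> e mnm0 = 0 ->
  w mnm0 = 0 -> (1 + w) ^+ nu = 1 + e -> convergent w.
Proof.
move=> nu0 ec e0 w0 we.
have nuN : nu%:R != 0 :> C by rewrite pnatr_eq0 -lt0n.
have wE := iffLR (fps1_root_eq e nuN w0) we.
apply: (fps1_implicit_convergent _ _ _ _ w0 wE).
- by apply: convergentM => //; exact: convergentC.
- by apply: convergentN; exact: convergent_binom_tail.
- by rewrite fpsM0 e0 mulr0.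
- by rewrite -[0]oppr0; apply: eqdN; exact: binom_tail_ord.
Qed.

Lemma convergent_geom : convergent (geom : fps C 1).
Proof.
apply/convergentP; exists 2^-1; first by rewrite invr_gt0.
exists 2; apply/nb1P => N; under eq_bigr do rewrite coef1_ser ab1 mul1r.
exact: geom_half_le.
Qed.

Lemma convergent_inv n (f : fps C n) : f mnm0 != 0 -> convergent f -> convergent (fps_inv f).
Proof.
move=> f0 fc; have uc : convergent (1 - fpsC (f mnm0)^-1 * f).
  by apply: convergentB; [exact: convergent1 | apply: convergentM => //; exact: convergentC].
rewrite /fps_inv; apply: convergentM; first exact: convergentC.
apply: convergent_comp => //; last exact: convergent_geom.
by move=> i; rewrite fpsB fps1E eqxx fpsC_mul mulVf // subrr.
Qed.

Lemma convergent_shift k (u : fps C 1) : convergent (X1 ^+ k * u) -> convergent u.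
Proof.
move=> /convergentP[r r0 [M fM]]; apply/convergentP; exists r => //; exists (M / r ^+ k).
apply/nb1P => N; rewrite ler_pdivlMr ?exprn_gt0 // mulr_suml.
have /nb1P/(_ (k + N)%N) := fM; apply: le_trans.
rewrite big_split_ord /= -[leLHS]add0r; apply: lerD.
  by apply: sumr_ge0 => j _; rewrite mulr_ge0 ?ab_ge0 ?exprn_ge0 ?ltW.
apply: ler_sum => j _; rewrite coef1_XnM ltnNge leq_addr /= addKn exprD.
by rewrite le_eqVlt; apply/orP; left; apply/eqP; ring.
Qed.

End Majorant.

(** * Holomorphic germs *)

Section Lipschitz.
Context {R : realType} {n : nat}.
Local Notation C := (Cplx R).

(** The relation [T] is stable under products by the Leibniz rule. Multiplying the difference by [r]
    avoids the exponent mdeg k - 1, which would need a separate case in degree 0. *)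
Lemma zmon_lipschitz (z w : 'rV[C]_n) (r d : R) (k : multinom n) : 0 <= r ->
    pdisc r z -> pdisc r w -> (forall i, ab (z 0 i - w 0 i) <= d) ->
  r * ab (zmon z k - zmon w k) <= (mdeg k)%:R * r ^+ mdeg k * d.
Proof.
move=> r0 zr wr zw; rewrite /zmon mdegE.
pose T (e : nat) (x y : C) := [/\ ab x <= r ^+ e, ab y <= r ^+ e & r * ab (x - y) <= e%:R * r ^+ e * d].
have T0 : T 0%N 1 1 by rewrite /T subrr ab0 ab1 expr0 mulr0 !mul0r.
have TM e f x y x' y' : T e x y -> T f x' y' -> T (e + f)%N (x * x') (y * y').
  move=> [xe ye xy] [xf yf xy']; split; [by rewrite abM exprD ler_pM ?ab_ge0 | by rewrite abM exprD ler_pM ?ab_ge0 | rewrite exprD].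
  have -> : x * x' - y * y' = (x - y) * x' + y * (x' - y') by ring.
  apply: (@le_trans _ _ (r * (ab (x - y) * ab x' + ab y * ab (x' - y')))).
    by rewrite ler_wpM2l // -!abM abD.
  have A : r * ab (x - y) * ab x' <= e%:R * r ^+ e * d * r ^+ f.
    by apply: ler_pM; rewrite ?mulr_ge0 ?ab_ge0.
  have B : ab y * (r * ab (x' - y')) <= r ^+ e * (f%:R * r ^+ f * d).
    by apply: ler_pM; rewrite ?mulr_ge0 ?ab_ge0.
  rewrite natrD; lra.
have [_ _ //] : T (\sum_i k i)%N (\prod_i z 0 i ^+ k i) (\prod_i w 0 i ^+ k i).
apply: (@big_rec3 nat C C T) => // i e x y _ exy; apply: (TM) => //.
elim: (k i) => [//|j IH]; rewrite !exprS -add1n; apply: (TM) => //.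
by split; rewrite ?expr1 ?mul1r //; rewrite ler_wpM2l.
Qed.

Lemma ev_lipschitz (p : fps C n) (r : R) : 0 < r -> cv r p ->
  exists2 L : R, 0 <= L & forall z w d, pdisc (r / 4) z -> pdisc (r / 4) w ->
    (forall i, ab (z 0 i - w 0 i) <= d) -> 0 <= d -> ab (ev p z - ev p w) <= L * d.
Proof.
move=> r0 [M pM]; have M0 := nb_ge0 pM; exists (4 / r * M).
  by rewrite mulr_ge0 // divr_ge0 // ltW.
move=> z w d zr wr zw d0.
have r4 : 0 < r / 4 by rewrite divr_gt0.
have r42 : r / 4 <= r / 2 by lra.
have zr2 := pdisc_le r42 zr; have wr2 := pdisc_le r42 wr.
have psumL N : ab (psum p z N - psum p w N) <= 4 / r * M * d.
  have -> : psum p z N - psum p w N = \sum_(k : bmultinom n N) p k * (zmon z k - zmon w k).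
    by rewrite !psumE -sumrB; apply: eq_bigr => k _; rewrite mulrBr.
  apply: (@le_trans _ _ (\sum_(k : bmultinom n N) (ab (p k) * r ^+ mdeg k) * (4 / r * d))).
    apply: le_trans (ab_sum _ _ _) _; apply: ler_sum => k _; rewrite abM -mulrA.
    apply: ler_wpM2l; first exact: ab_ge0.
    rewrite -(ler_pM2l r4); apply: le_trans (zmon_lipschitz k (ltW r4) zr wr zw) _.
    have -> : r / 4 * (r ^+ mdeg k * (4 / r * d)) = r ^+ mdeg k * d by field; rewrite gt_eqF.
    rewrite ler_wpM2r // exprMn mulrCA ler_piMr ?exprn_ge0 ?ltW //.
    rewrite exprVn ltr_pdivrMr ?exprn_gt0 // mul1r -natrX ltr_nat.
    exact: ltn_expl.
  have c0 : 0 <= 4 / r * d by rewrite mulr_ge0 // divr_ge0 // ltW.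
  rewrite -mulr_suml; apply: le_trans (ler_wpM2r c0 (pM N)) _.
  by rewrite le_eqVlt; apply/orP; left; apply/eqP; ring.
have zc := psum_cvg (ltW r0) (cv_nb pM) zr2.
have wc := psum_cvg (ltW r0) (cv_nb pM) wr2.
apply/ler_addgt0Pl => e e0; have e2 : 0 < e / 2 by rewrite divr_gt0.
have [N zN] := zc _ e2; have [N' wN] := wc _ e2.
have := zN (maxn N N') (leq_maxl _ _); have := wN (maxn N N') (leq_maxr _ _).
have := psumL (maxn N N').
have := ab_tri (psum p z (maxn N N')) (ev p z) (ev p w).
have := ab_tri (psum p w (maxn N N')) (psum p z (maxn N N')) (ev p w).
rewrite (abBC (psum p w _) (ev p w)); lra.
Qed.

End Lipschitz.

Section Holomorphic.
Context {R : realType} {n : nat}.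
Local Notation C := (Cplx R).
Implicit Types (f g : 'rV[C]_n -> C) (a : 'rV[C]_n).

Lemma holomorphicP f a : holomorphic_at f a <->
  exists p, exists2 r : R, 0 < r & cv r p /\ forall z, pdisc (r / 2) z -> f (a + z) = ev p z.
Proof. by split=> -[p /expansionP]; exists p => //; apply/expansionP. Qed.

Lemma pdisc0 (r : R) : 0 <= r -> pdisc r (0 : 'rV[C]_n).
Proof. by move=> r0 i; rewrite mxE ab0. Qed.

Lemma holomorphic2 f g a (F : fps C n -> fps C n -> fps C n) (h : C -> C -> C) :
    holomorphic_at f a -> holomorphic_at g a ->
    (forall (r : R) p q, 0 <= r -> cv r p -> cv r q -> cv r (F p q)) ->
    (forall (r : R) p q z, 0 <= r -> cv r p -> cv r q -> pdisc (r / 2) z ->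
       ev (F p q) z = h (ev p z) (ev q z)) ->
  holomorphic_at (fun z => h (f z) (g z)) a.
Proof.
move=> /holomorphicP[p [r r0 [pr fr]]] /holomorphicP[q [r' r'0 [qr gr]]] cvF evF.
apply/holomorphicP; exists (F p q), (Num.min r r'); first exact: min_gt0.
have m0 := ltW (min_gt0 r0 r'0).
have /andP[_ ml] := min_boundl r0 r'0; have /andP[_ mr] := min_boundr r0 r'0.
have pm : cv (Num.min r r') p by apply: cv_ler pr; rewrite m0.
have qm : cv (Num.min r r') q by apply: cv_ler qr; rewrite m0.
split; first exact: cvF.
move=> z zr; rewrite (evF _ _ _ _ m0 pm qm zr) fr ?gr //; apply: pdisc_le zr;
  by rewrite ler_wpM2r ?invr_ge0.
Qed.

Lemma holomorphicD f g a : holomorphic_at f a -> holomorphic_at g a ->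
  holomorphic_at (fun z => f z + g z) a.
Proof. by move=> fa ga; apply: (holomorphic2 fa ga) => [r p q|r p q z]; [exact: cvD | exact: evD]. Qed.

Lemma holomorphicB f g a : holomorphic_at f a -> holomorphic_at g a ->
  holomorphic_at (fun z => f z - g z) a.
Proof. by move=> fa ga; apply: (holomorphic2 (F := fun p q => p - q) (h := fun x y => x - y) fa ga) => [r p q|r p q z]; [exact: cvB | exact: evB]. Qed.

Lemma holomorphicM f g a : holomorphic_at f a -> holomorphic_at g a ->
  holomorphic_at (fun z => f z * g z) a.
Proof. by move=> fa ga; apply: (holomorphic2 fa ga) => [r p q|r p q z]; [exact: cvM | exact: evM]. Qed.

Lemma holomorphicC c a : holomorphic_at (fun=> c) a.
Proof.
apply/holomorphicP; exists (fpsC c), 1 => //; split; first exact: cvC.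
by move=> z _; rewrite evC.
Qed.

Lemma holomorphicX i a : holomorphic_at (fun z => z 0 i) a.
Proof.
apply/holomorphicP; exists (fpsC (a 0 i) + fpsX i), 1 => //.
have cX : cv 1 (fpsX i : fps C n) by apply: cvX.
split; first by apply: cvD => //; apply: cvC.
by move=> z zr; rewrite (evD ler01 (cvC _ _) cX zr) evC evX mxE.
Qed.

Lemma holomorphicXn f a k : holomorphic_at f a -> holomorphic_at (fun z => f z ^+ k) a.
Proof.
move=> fa; elim: k => [|k IH]; first exact: holomorphicC.
have -> : (fun z => f z ^+ k.+1) = (fun z => f z * f z ^+ k) by apply/funext => z; rewrite exprS.
exact: holomorphicM fa IH.
Qed.

Lemma holomorphic_sum (I : Type) (s : seq I) (F : I -> 'rV[C]_n -> C) a :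
  (forall i, holomorphic_at (F i) a) -> holomorphic_at (fun z => \sum_(i <- s) F i z) a.
Proof.
move=> Fa; elim: s => [|i s IH].
  have -> : (fun z => \sum_(i <- [::]) F i z) = (fun=> 0) by apply/funext => z; rewrite big_nil.
  exact: holomorphicC.
have -> : (fun z => \sum_(j <- i :: s) F j z) = (fun z => F i z + \sum_(j <- s) F j z).
  by apply/funext => z; rewrite big_cons.
exact: holomorphicD (Fa i) IH.
Qed.

Lemma expansion_value f a p (r : R) : 0 < r ->
  (forall z, pdisc (r / 2) z -> f (a + z) = ev p z) -> p mnm0 = f a.
Proof.
by move=> r0 fr; rewrite -ev0 -fr ?addr0 //; apply: pdisc0; rewrite divr_ge0 // ltW.
Qed.

Lemma holomorphic_cont f a (e : R) : holomorphic_at f a -> 0 < e ->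
  exists2 d, 0 < d & forall z : 'rV[C]_n, (forall i, ab (z 0 i - a 0 i) <= d) -> ab (f z - f a) <= e.
Proof.
move=> /holomorphicP[p [r r0 [pr fr]]] e0.
have [d d0 dp] := ev_cont0 r0 pr e0.
have r2 : 0 < r / 2 by rewrite divr_gt0.
exists (Num.min (r / 2) d); first exact: min_gt0.
move=> z za; have zE : z = a + (z - a) by rewrite addrC subrK.
have zd i : ab ((z - a) 0 i) <= Num.min (r / 2) d by rewrite !mxE.
have /andP[_ ml] := min_boundl r2 d0; have /andP[_ mr] := min_boundr r2 d0.
rewrite zE fr; last by move=> i; apply: le_trans (zd i) ml.
rewrite -(expansion_value r0 fr); apply: dp => i.
exact: le_trans (zd i) mr.
Qed.

End Holomorphic.

(** * Holomorphic functions of one variable *)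

Section OneVariable.
Context {R : realType}.
Local Notation C := (Cplx R).

Lemma rV1E (z : 'rV[C]_1) : z = const_mx (z 0 0).
Proof. by apply/rowP => i; rewrite !mxE (ord1 i). Qed.

Definition ev1 (p : fps C 1) (x : C) : C := ev p (const_mx x).

Lemma pdisc1 (r : R) x : ab x <= r -> pdisc r (const_mx x : 'rV[C]_1).
Proof. by move=> xr i; rewrite mxE. Qed.

Definition hol1 (f : C -> C) (x : C) := holomorphic_at (fun z : 'rV[C]_1 => f (z 0 0)) (const_mx x).

Lemma hol1P f x : hol1 f x <->
  exists p, exists2 r : R, 0 < r & cv r p /\ forall y, ab y <= r / 2 -> f (x + y) = ev1 p y.
Proof.
split=> [/holomorphicP[p [r r0 [pr fr]]]|[p [r r0 [pr fr]]]].
  exists p, r => //; split=> // y yr.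
  by rewrite /ev1 -(fr _ (pdisc1 yr)) !mxE.
apply/holomorphicP; exists p, r => //; split=> // z zr.
by rewrite !mxE fr ?zr // /ev1 -rV1E.
Qed.

Lemma holomorphic_comp1 n (f : C -> C) (g : 'rV[C]_n -> C) a :
  hol1 f (g a) -> holomorphic_at g a -> holomorphic_at (fun z => f (g z)) a.
Proof.
move=> /hol1P[q [r r0 [qr fr]]] /holomorphicP[p [r' r'0 [pr gr]]].
have p0 := expansion_value r'0 gr.
pose p' : fps C n := p - fpsC (p mnm0).
have p'0 : p' mnm0 = 0 by rewrite /p' fpsB /fpsC eqxx subrr.
have [M p'M] : cv r' p' by apply: cvB; [exact: ltW | | exact: cvC].
have r2 : 0 < r / 2 by rewrite divr_gt0.
have [t /andP[t0 tr] p't] := nb_small r'0 p'0 p'M r2.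
have c0 : const0 (fun _ : 'I_1 => p') by move=> _.
apply/holomorphicP; exists (fps_comp q (fun=> p')), t => //; split.
  have [Q qQ] := qr; exists Q; apply: nb_comp (fun=> p't); rewrite ?ltW //.
  by apply: nb_ler qQ; rewrite ltW //= ler_pdivrMr // ler_peMr ?ltW // ltr1n.
move=> z zt; rewrite (ev_comp (ltW t0) (ltW r0) c0 qr (fun=> p't) zt).
have zr' : pdisc (r' / 2) z by apply: pdisc_le zt; rewrite ler_wpM2r ?invr_ge0.
rewrite gr //.
have evp' : ev p' z = ev p z - g a.
  by rewrite /p' (evB (ltW r'0) pr (cvC _ _) zr') evC p0.
have -> : evs (fun _ : 'I_1 => p') z = const_mx (ev p' z).
  by apply/rowP => i; rewrite !mxE.
rewrite -/(ev1 q _) -fr ?evp'; first by rewrite addrC subrK.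
by rewrite -evp'; apply: ev_le p't zt; apply: ltW.
Qed.

Lemma hol1_comp f g x : hol1 f (g x) -> hol1 g x -> hol1 (fun y => f (g y)) x.
Proof. by move=> fg gx; apply: (holomorphic_comp1 (g := fun z : 'rV[C]_1 => g (z 0 0))); rewrite ?mxE. Qed.

Lemma hol1_coord n (f : C -> C) (a : 'rV[C]_n) i : hol1 f (a 0 i) -> holomorphic_at (fun z => f (z 0 i)) a.
Proof. by move=> fa; apply: (holomorphic_comp1 (g := fun z => z 0 i)) => //; apply: holomorphicX. Qed.

Lemma hol1_cont f x (e : R) : hol1 f x -> 0 < e ->
  exists2 d, 0 < d & forall y, ab (y - x) <= d -> ab (f y - f x) <= e.
Proof.
move=> fx e0; have [d d0 fd] := holomorphic_cont fx e0.
exists d => // y yd; have := fd (const_mx y); rewrite !mxE; apply.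
by move=> i; rewrite !mxE.
Qed.

Lemma psum1E p (x : C) N : psum p (const_mx x : 'rV[C]_1) N = \sum_(j < N) coef1 p j * x ^+ j.
Proof.
rewrite psumE (bmsum1 N (fun k => p k * zmon (const_mx x : 'rV[C]_1) k)).
by apply: eq_bigr => j _; rewrite /zmon big_ord1 mxE.
Qed.

(* [q] is obtained by expanding every [(a + x) ^ k]. *)
Lemma ev1_recenter (p : fps C 1) (r : R) (a : C) : 0 < r -> cv r p -> ab a <= r / 4 ->
  exists q, cv (r / 4) q /\ forall x, ab x <= r / 8 -> ev1 p (a + x) = ev1 q x.
Proof.
move=> r0 [M pM] ar; have M0 := nb_ge0 pM.
pose rho := r / 2; have rho0 : 0 < rho by rewrite divr_gt0.
(* The divided derivative p^(m) / m!. Its norm at radius [rho] = r / 2 is bounded because binomial(k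
   + m, m) rho^k rho^m <= (rho + rho)^(k + m). *)
pose D m : fps C 1 := ser (fun k => coef1 p (k + m) *+ 'C(k + m, m)).
have DM m : nb (D m) rho (M / rho ^+ m).
  apply/nb1P => N; rewrite ler_pdivlMr ?exprn_gt0 // mulr_suml.
  have /nb1P/(_ (m + N)%N) := pM; apply: le_trans.
  rewrite big_split_ord /= -[leLHS]add0r; apply: lerD.
    by apply: sumr_ge0 => j _; rewrite mulr_ge0 ?ab_ge0 ?exprn_ge0 ?ltW.
  apply: ler_sum => j _; rewrite coef1_ser -mulr_natr abM -mulrA -mulrA addnC.
  rewrite ler_wpM2l ?ab_ge0 //.
  have abn k : ab (k%:R : C) = k%:R.
    by apply: toC_inj; rewrite -abE normr_nat /toC rmorph_nat.
  rewrite abn -mulrA -exprD [(j + m)%N]addnC.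
  have -> : r = rho + rho by rewrite /rho; field.
  rewrite exprDn (bigD1 (inord m : 'I_(m + j).+1)) //= inordK; last by rewrite ltnS leq_addr.
  rewrite -exprD subnK ?leq_addr // mulr_natl lerDl.
  by apply: sumr_ge0 => i _; rewrite mulrn_wge0 // mulr_ge0 ?exprn_ge0 ?ltW.
have ar2 : ab a <= rho / 2 by rewrite /rho; lra.
pose q : fps C 1 := ser (fun m => ev1 (D m) a).
have qm m : ab (coef1 q m) <= M / rho ^+ m.
  by rewrite coef1_ser; apply: ev_le (DM m) (pdisc1 ar2); apply: ltW.
have qb : nb q (r / 4) (2 * M).
  apply/nb1P => N; apply: (@le_trans _ _ (\sum_(j < N) M * 2^-1 ^+ j)).
    apply: ler_sum => j _.
    apply: le_trans (ler_wpM2r _ (qm j)) _; first by rewrite exprn_ge0 ?divr_ge0 // ltW.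
    have -> : (r / 4) ^+ j = rho ^+ j * 2^-1 ^+ j by rewrite -exprMn /rho; congr (_ ^+ _); field.
    rewrite mulrA divfK //.
    by rewrite expf_eq0 gt_eqF ?andbF.
  rewrite -mulr_sumr mulrC ler_wpM2r //.
  exact: geom_half_le.
exists q; split; first by exists (2 * M).
move=> x xr.
have axr : ab (a + x) <= r / 2 by apply: le_trans (abD _ _) _; lra.
apply: ev_eq; apply: (@seq_cvg_half _ _ _ (4 * M)) => J.
have xr8 : ab x <= (r / 4) / 2 by lra.
(* The partial sum of [p] at a + x, regrouped by powers of [x]. It differs from the partial sum of
   [q] by at most 2 M 2^-J, and that one from the value of [q] by as much again. *)
pose S := \sum_(m < J) x ^+ m * psum (D m) (const_mx a : 'rV[C]_1) (J - m).
have -> : psum p (const_mx (a + x) : 'rV[C]_1) J = S.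
  rewrite psum1E.
  transitivity (\sum_(j < J) \sum_(m < J | (m <= j)%N) coef1 p j * (a ^+ (j - m) * x ^+ m *+ 'C(j, m))).
    apply: eq_bigr => j _; rewrite exprDn mulr_sumr.
    rewrite (big_ord_widen_cond J xpredT (fun m => coef1 p j * (a ^+ (j - m) * x ^+ m *+ 'C(j, m)))) //.
  rewrite (exchange_big_dep xpredT) //=; apply: eq_bigr => m _.
  rewrite psum1E mulr_sumr.
  rewrite -(big_mkord (fun j => (m <= j)%N) (fun j => coef1 p j * (a ^+ (j - m) * x ^+ m *+ 'C(j, m)))).
  rewrite (big_cat_nat (leq0n m) (ltnW (ltn_ord m))) /= big_nat_cond big1 ?add0r => [|j]; last first.
    by move=> /andP[/andP[_ jm]]; rewrite leqNgt jm.
  rewrite big_nat_cond (eq_bigl (fun i => (m <= i < J)%N)) => [|j]; last first.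
    by case: (leqP m j) => //; rewrite andbT.
  rewrite -big_nat -{1}[val m]add0n big_addn big_mkord; apply: eq_bigr => j _.
  have -> : (j + val m - m)%N = j by rewrite addnK.
  by rewrite coef1_ser mulrnAr mulrnAl mulrnAr; congr (_ *+ _); rewrite mulrA mulrC.
have xle m : ab x ^+ m <= (r / 8) ^+ m by rewrite lerXn2r ?nnegrE ?ab_ge0 //; lra.
have E1 : ab (\sum_(m < J) coef1 q m * x ^+ m - S) <= 2 * M * 2^-1 ^+ J.
  rewrite /S -sumrB; apply: le_trans (ab_sum _ _ _) _.
  apply: (@le_trans _ _ (\sum_(m < J) M * 2^-1 ^+ J * 2^-1 ^+ m)).
    apply: ler_sum => m _; rewrite [coef1 q m * _]mulrC -mulrBr abM abX coef1_ser.
    have H : ab (ev1 (D m) a - psum (D m) (const_mx a : 'rV[C]_1) (J - m)) <= M / rho ^+ m * 2^-1 ^+ (J - m).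
      by apply: ev_approx (DM m) (pdisc1 ar2); apply: ltW.
    apply: le_trans (ler_pM _ _ (xle m) H) _; rewrite ?exprn_ge0 ?ab_ge0 //.
    have -> : r / 8 = rho * 2^-1 * 2^-1 by rewrite /rho; field.
    rewrite !exprMn.
    have J2 : 2^-1 ^+ J = 2^-1 ^+ (J - m) * 2^-1 ^+ m :> R by rewrite -exprD subnK // ltnW.
    rewrite J2 le_eqVlt; apply/orP; left; apply/eqP.
    have rn : r ^+ m != 0 by rewrite expf_neq0 // gt_eqF.
    have hn : 2^-1 ^+ m != 0 :> R by rewrite expf_neq0 // invr_eq0 pnatr_eq0.
    move: rn hn; move: (r ^+ m) (2^-1 ^+ m) (2^-1 ^+ (J - m)) => A B E rn hn.
    by field; rewrite rn hn.
  rewrite -mulr_sumr mulrAC ler_wpM2r ?exprn_ge0 ?invr_ge0 // mulrC ler_wpM2r //.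
  exact: geom_half_le.
have E2 : ab (ev1 q x - \sum_(m < J) coef1 q m * x ^+ m) <= 2 * M * 2^-1 ^+ J.
  by rewrite -psum1E; apply: ev_approx qb (pdisc1 xr8); rewrite divr_ge0 // ltW.
have := ab_tri (\sum_(m < J) coef1 q m * x ^+ m) (ev1 q x) S; lra.
Qed.

Lemma hol1_ev1 (p : fps C 1) (r : R) x : 0 < r -> cv r p -> ab x <= r / 4 -> hol1 (ev1 p) x.
Proof.
move=> r0 pr xr; have [q [qr pq]] := ev1_recenter r0 pr xr.
apply/hol1P; exists q, (r / 4); first by rewrite divr_gt0.
by split=> // y yr; apply: pq; lra.
Qed.

Lemma ev1_isolated (p : fps C 1) : convergent p -> p <> 0 ->
  exists2 d : R, 0 < d & forall x, ab x <= d -> x != 0 -> ev1 p x != 0.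
Proof.
move=> pc p0; have [k [u [pE u0]]] := fps1_order p0.
have uc : convergent u by apply: (@convergent_shift _ k); rewrite -pE.
have /convergentP[r r0 ur] := uc.
have Xr : cv r (X1 : fps C 1) by apply: cvX; apply: ltW.
have u00 : 0 < ab (u mnm0) / 2 by rewrite divr_gt0 // ab_gt0 -coef10; apply/eqP.
have [d d0 ud] := ev_cont0 r0 ur u00.
have r2 : 0 < r / 2 by rewrite divr_gt0.
exists (Num.min (r / 2) d); first exact: min_gt0.
move=> x xd x0; have /andP[_ ml] := min_boundl r2 d0; have /andP[_ mr] := min_boundr r2 d0.
have xr := le_trans xd ml.
rewrite /ev1 pE (evM (ltW r0) (cvXn _ (ltW r0) Xr) ur (pdisc1 xr)).
rewrite (evXn _ (ltW r0) Xr (pdisc1 xr)) evX mxE mulf_neq0 ?expf_neq0 //.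
apply/negP => /eqP ux; have := ud _ (pdisc1 (le_trans xd mr)); rewrite ux sub0r abN.
lra.
Qed.

Lemma ev1_eq0 (p : fps C 1) (d : R) : convergent p -> 0 < d ->
  (forall x, ab x <= d -> ev1 p x = 0) -> p = 0.
Proof.
move=> pc d0 px; apply: contrapT => p0; have [d' d'0 pd] := ev1_isolated pc p0.
pose x := toC (Num.min d d').
have ml := min_gt0 d0 d'0.
have xE : ab x = Num.min d d' by rewrite ab_toC // ltW.
have x0 : x != 0 by rewrite -ab_gt0 xE.
have := pd x; rewrite xE px ?eqxx ?xE ?ge_min ?lexx // orbT => /(_ isT x0).
by [].
Qed.

End OneVariable.

(** * Convergence of the parametrization *)

Section LinearCoefficients.
Context {K : comNzRingType} {n p : nat}.

Lemma bmsum2 (V : nmodType) (F : multinom n -> V) :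
  \sum_(k : bmultinom n 2) F k = F mnm0 + \sum_j F (mnm1 j).
Proof.
rewrite (bigD1 bm0) //=; congr (_ + _).
transitivity (\sum_(k : bmultinom n 2) \sum_(j | mnm1 j == k :> multinom n) F k).
  rewrite big_mkcond; apply: eq_bigr => k _; case: eqP => [->|/eqP k0] /=.
    by rewrite big1 // => j; rewrite mnm1_eq0.
  have : mdeg k == 1%N.
    have k1 := bmdeg k; have : mdeg k != 0%N by rewrite mdeg_eq0; apply: contra k0 => /eqP kE; apply/eqP/val_inj.
    by case: (mdeg k) k1 => [|[|?]].
  rewrite mdeg_eq1 => /existsP[j /eqP kj].
  by rewrite (big_pred1 j) // => i; rewrite kj eq_mnm1.
rewrite (exchange_big_dep xpredT) //=; apply: eq_bigr => j _.
by rewrite (bmsum_eq 2 (mnm1 j) F) mdeg1.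
Qed.

Lemma fps_comp_linear (h : fps K n) (G : 'I_n -> fps K p) m : mdeg m = 1%N ->
  fps_comp h G m = \sum_j h (mnm1 j) * G j m.
Proof.
move=> m1; rewrite fps_compE psubE m1 (bmsum2 (fun k => h k * mmon G k m)).
rewrite mmon0 fps1E -mdeg_eq0 m1 mulr0 add0r.
by apply: eq_bigr => j _; rewrite mmon1.
Qed.

End LinearCoefficients.

Section Reparametrization.
Context {R : realType} {n : nat}.
Local Notation C := (Cplx R).
Implicit Types (c d : 'I_n -> fps C 1) (Gamma : set (fps C n)).

Definition reparam c (h : fps C 1) i := fps_comp (c i) (fun=> h).

Lemma parametrization0 c : parametrization c -> const0 c.
Proof. by move=> [c0 _] i; rewrite -coef10. Qed.

Lemma parametrizes0 c Gamma : parametrizes c Gamma -> const0 c.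
Proof. by move=> [[/parametrization0]]. Qed.

Lemma fps1_comp_eq0 (f h : fps C 1) : h mnm0 = 0 -> coef1 h 1 != 0 ->
  fps_comp f (fun=> h) = 0 -> f = 0.
Proof.
move=> h0 h1 fh; have [g [g0 _ hg _]] := fps1_inverse h0 h1.
rewrite -(fps_comp_by_X1 f) -hg -(fps_compA f (const0_1 h0) (const0_1 g0)) fh.
exact: fps_comp0.
Qed.

Lemma parametrization_reparam c h : parametrization c -> h mnm0 = 0 -> coef1 h 1 != 0 ->
  parametrization (reparam c h).
Proof.
move=> [c0 [i ci]] h0 h1; split=> [j|]; first by rewrite coef10 /reparam fps_comp_const // -coef10.
by exists i => /(fps1_comp_eq0 h0 h1).
Qed.

Lemma parametrizes_reparam c h Gamma : parametrizes c Gamma -> h mnm0 = 0 ->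
  coef1 h 1 != 0 -> parametrizes (reparam c h) Gamma.
Proof.
move=> cG h0 h1; have c0 := parametrizes0 cG; case: cG => [[cp cirr] cG].
have hc := const0_1 h0.
split=> [|g]; last first.
  rewrite cG -(fps_compA g c0 hc); split=> [->|]; first exact: fps_comp0.
  exact: fps1_comp_eq0.
split=> [|d s dp s0 cE]; first exact: parametrization_reparam.
have [g [g0 g1 hg gh]] := fps1_inverse h0 h1.
have gc := const0_1 g0; have sc := const0_1 (eq_trans (esym (coef10 s)) s0).
have /cirr : forall i, c i = fps_comp (d i) (fun=> fps_comp s (fun=> g)).
  move=> i; rewrite -(fps_compA (d i) sc gc) -cE /reparam (fps_compA (c i) hc gc) hg.
  by rewrite fps_comp_by_X1.
move=> /(_ dp); rewrite coef10 fps_comp_const // -coef10 => /(_ s0).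
by rewrite coef1_comp1 // => sg s1; apply: sg; rewrite s1 mul0r.
Qed.

End Reparametrization.

Section Linearization.
Context {R : realType} {n : nat}.
Local Notation C := (Cplx R).

Lemma geometric_small (x e : R) : 0 <= x -> x < 1 -> 0 < e ->
  exists N, forall k, (N <= k)%N -> x ^+ k < e.
Proof.
move=> x0 x1 e0; have /cvgrPdist_lt/(_ e e0)[N _ xN] : x ^+ k @[k --> \oo] --> (0 : R).
  by apply: cvg_expr; rewrite ger0_norm.
exists N => k /xN /=; rewrite sub0r normrN ger0_norm // exprn_ge0 //.
Qed.

(* The coefficients of degree [k] satisfy (lam^k - A) c_k = [F_2 o c]_k, and A is
   invertible while lam^k tends to 0. *)
Lemma linearized_convergent (F : 'I_n -> fps C n) (B : 'M[C]_n) (lam : C)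
    (c : 'I_n -> fps C 1) :
    const0 F -> (forall i, convergent (F i)) ->
    B *m (\matrix_(i, j) F i (mnm1 j)) = 1%:M ->
    ab lam < 1 -> const0 c ->
    (forall i, fps_comp (F i) c = fps_comp (c i) (fun=> fpsC lam * X1)) ->
  forall i, convergent (c i).
Proof.
move=> F0 Fc BA lam1 c0 Fcc.
pose A := \matrix_(i, j) F i (mnm1 j); rewrite -/A in BA.
pose F2 i := F i - \sum_j fpsC (A i j) * fpsX j.
have lin_m i m : (\sum_j fpsC (A i j) * fpsX j : fps C n) m = \sum_j A i j * (m == mnm1 j)%:R.
  by rewrite fps_sum; apply: eq_bigr => j _; rewrite fpsC_mul.
have F2ord i : eqd 2 (F2 i) 0.
  move=> m m2; rewrite /F2 fpsB lin_m; have [m0|m0] := eqVneq m mnm0.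
    rewrite m0 F0 big1 ?subr0 // => j _.
    by rewrite eq_sym mnm1_eq0 mulr0.
  have : mdeg m == 1%N.
    by move: m0; rewrite -mdeg_eq0; case: (mdeg m) m2 => [|[|?]].
  rewrite mdeg_eq1 => /existsP[j /eqP ->].
  rewrite (bigD1 j) //= eqxx mulr1 mxE big1 ?addr0 ?subrr // => l lj.
  by rewrite eq_mnm1 eq_sym (negbTE lj) mulr0.
have F2c i : convergent (F2 i).
  apply: convergentB => //; apply: convergent_sum => j _.
  by apply: convergentM; [exact: convergentC | exact: convergentX].
have rec i k : \sum_j A i j * coef1 (c j) k + coef1 (fps_comp (F2 i) c) k = lam ^+ k * coef1 (c i) k.
  rewrite mulrC -coef1_comp_aX -Fcc /F2 fps_compB coef1B addrC fps_comp_sum coef1_sum.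
  suff -> : \sum_j A i j * coef1 (c j) k =
      \sum_j coef1 (fps_comp (fpsC (A i j) * fpsX j) c) k by rewrite subrK.
  by apply: eq_bigr => j _; rewrite fps_compM // fps_compC fps_compX // coef1CM.
have recB i k : coef1 (c i) k =
    \sum_l B i l * (lam ^+ k * coef1 (c l) k - coef1 (fps_comp (F2 l) c) k).
  have -> : \sum_l B i l * (lam ^+ k * coef1 (c l) k - coef1 (fps_comp (F2 l) c) k) =
     \sum_j (B *m A) i j * coef1 (c j) k.
    under [RHS]eq_bigr do rewrite mxE mulr_suml.
    rewrite exchange_big /=; apply: eq_bigr => l _.
    by rewrite -rec addrK mulr_sumr; apply: eq_bigr => j _; rewrite mulrA.
  rewrite BA (bigD1 i) //= mxE eqxx mul1r big1 ?addr0 // => j ji.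
  by rewrite mxE eq_sym (negbTE ji) mul0r.
pose b := \sum_i \sum_l ab (B i l).
have b0 : 0 <= b by apply: sumr_ge0 => i _; apply: sumr_ge0 => l _; apply: ab_ge0.
have Bb i l : ab (B i l) <= b.
  rewrite /b (bigD1 i) //= (bigD1 l) //= -addrA lerDl addr_ge0 //.
    by apply: sumr_ge0 => *; apply: ab_ge0.
  by apply: sumr_ge0 => *; apply: sumr_ge0 => *; apply: ab_ge0.
pose nb1 : R := n%:R * b; have nb0 : 0 <= nb1 by rewrite mulr_ge0.
(* Below this threshold, nb1 |lam|^k <= 1 / 2, and the term with lam^k is absorbed by the left-hand
   side at the cost of a factor 2. *)
have e0 : 0 < 1 / (2 * nb1 + 1) by rewrite divr_gt0 //; lra.
have [N lamN] := geometric_small (ab_ge0 lam) lam1 e0.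
pose S k := \sum_i ab (coef1 (c i) k).
pose g k := \sum_i ab (coef1 (fps_comp (F2 i) c) k).
have cb i k : ab (coef1 (c i) k) <= b * (ab lam ^+ k * S k + g k).
  rewrite {1}recB; apply: le_trans (ab_sum _ _ _) _.
  rewrite /S /g mulr_sumr -big_split mulr_sumr; apply: ler_sum => l _.
  rewrite abM ler_pM ?ab_ge0 //; apply: le_trans (abB _ _) _.
  by rewrite abM abX.
have g0 k : 0 <= g k by apply: sumr_ge0 => *; apply: ab_ge0.
have S0 k : 0 <= S k by apply: sumr_ge0 => *; apply: ab_ge0.
have Sb k : (N <= k)%N -> S k <= 2 * nb1 * g k.
  move=> /lamN lk.
  have S1 : S k <= nb1 * (ab lam ^+ k * S k + g k).
    apply: (@le_trans _ _ (\sum_(i < n) b * (ab lam ^+ k * S k + g k))).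
      by apply: ler_sum => i _; apply: cb.
    by rewrite sumr_const card_ord -mulr_natr /nb1; nra.
  have l2 : nb1 * ab lam ^+ k <= 1 / 2.
    move: lk; rewrite ltr_pdivlMr; [|lra]. nra.
  have : nb1 * (ab lam ^+ k * S k) <= 1 / 2 * S k by rewrite mulrA ler_wpM2r.
  lra.
apply: (@fps1_majorant _ n n c F2 0 (2 * nb1) N) => //.
- exact: convergent0.
- by rewrite mulr_ge0.
- move=> k i Nk; rewrite coef1_0 ab0 add0r; apply: le_trans (Sb k Nk).
  by rewrite /S (bigD1 i) //= lerDl; apply: sumr_ge0 => *; apply: ab_ge0.
Qed.

End Linearization.

Section SmallFilter.
Context {R : realType}.
Local Notation C := (Cplx R).

Definition small1 (P : C -> Prop) := exists2 d : R, 0 < d & forall x, ab x <= d -> P x.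

Lemma small1_and (P Q : C -> Prop) : small1 P -> small1 Q -> small1 (fun x => P x /\ Q x).
Proof.
move=> [d d0 Pd] [e e0 Qe]; exists (Num.min d e); first exact: min_gt0.
have /andP[_ ml] := min_boundl d0 e0; have /andP[_ mr] := min_boundr d0 e0.
by move=> x xd; split; [apply: Pd; apply: le_trans ml | apply: Qe; apply: le_trans mr].
Qed.

Lemma small1_imp (P Q : C -> Prop) : (forall x, P x -> Q x) -> small1 P -> small1 Q.
Proof. by move=> PQ [d d0 Pd]; exists d => // x /Pd/PQ. Qed.

Lemma small1_all (I : finType) (P : I -> C -> Prop) : (forall i, small1 (P i)) ->
  small1 (fun x => forall i, P i x).
Proof.
move=> PI; suff : small1 (fun x => forall i, i \in enum I -> P i x).
  by apply: small1_imp => x Px i; apply: Px; rewrite mem_enum.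
elim: (enum I) => [|i s IH]; first by exists 1.
apply: small1_imp (small1_and (PI i) IH) => x [Pi Ps] j.
by rewrite inE => /orP[/eqP ->//|]; apply: Ps.
Qed.

Context {n : nat}.
Definition small (P : 'rV[C]_n -> Prop) := exists2 d : R, 0 < d & forall z, pdisc d z -> P z.

Lemma small_and (P Q : 'rV[C]_n -> Prop) : small P -> small Q -> small (fun x => P x /\ Q x).
Proof.
move=> [d d0 Pd] [e e0 Qe]; exists (Num.min d e); first exact: min_gt0.
have /andP[_ ml] := min_boundl d0 e0; have /andP[_ mr] := min_boundr d0 e0.
by move=> x xd; split; [apply: Pd; apply: pdisc_le xd | apply: Qe; apply: pdisc_le xd].
Qed.

Lemma small_imp (P Q : 'rV[C]_n -> Prop) : (forall x, P x -> Q x) -> small P -> small Q.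
Proof. by move=> PQ [d d0 Pd]; exists d => // x /Pd/PQ. Qed.

Lemma small_all (I : finType) (P : I -> 'rV[C]_n -> Prop) : (forall i, small (P i)) ->
  small (fun x => forall i, P i x).
Proof.
move=> PI; suff : small (fun x => forall i, i \in enum I -> P i x).
  by apply: small_imp => x Px i; apply: Px; rewrite mem_enum.
elim: (enum I) => [|i s IH]; first by exists 1.
apply: small_imp (small_and (PI i) IH) => x [Pi Ps] j.
by rewrite inE => /orP[/eqP ->//|]; apply: Ps.
Qed.

Definition cpt (c : 'I_n -> fps C 1) (x : C) : 'rV[C]_n := evs c (const_mx x).

Lemma cptE c x i : cpt c x 0 i = ev1 (c i) x. Proof. by rewrite mxE. Qed.

Lemma cpt0 (c : 'I_n -> fps C 1) : const0 c -> cpt c 0 = 0.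
Proof. by move=> c0; apply/rowP => i; rewrite cptE mxE /ev1 -[const_mx 0]/(0 : 'rV[C]_1) ev0 c0. Qed.

Lemma small_curve (c : 'I_n -> fps C 1) (P : 'rV[C]_n -> Prop) :
  const0 c -> (forall i, convergent (c i)) -> small P -> small1 (fun x => P (cpt c x)).
Proof.
move=> c0 cc [d d0 Pd]; have [r r0 cr] := convergent_cvs cc.
have [r' /andP[r'0 _] cd] := nb_smalls r0 c0 cr d0.
exists (r' / 2); first by rewrite divr_gt0.
by move=> x xr; apply: Pd; apply: evs_pdisc (ltW r'0) cd (pdisc1 xr).
Qed.

Lemma ev1_comp_curve (h : fps C n) (c : 'I_n -> fps C 1) : const0 c -> convergent h ->
  (forall i, convergent (c i)) -> small1 (fun x => ev1 (fps_comp h c) x = ev h (cpt c x)).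
Proof.
move=> c0 hc cc; have [r r0 cr] := ev_comp_near c0 hc cc.
exists (r / 2); first by rewrite divr_gt0.
have /cr[_ H] : 0 < r <= r by rewrite r0 lexx.
by move=> x xr; rewrite /ev1 H //; apply: pdisc1.
Qed.

End SmallFilter.

Lemma cpt_comp (R : realType) (n : nat) (c : 'I_n -> fps (Cplx R) 1) (h : fps (Cplx R) 1) : h mnm0 = 0 ->
  (forall i, convergent (c i)) -> convergent h ->
  small1 (fun x => cpt (reparam c h) x = cpt c (ev1 h x)).
Proof.
move=> h0 cc hc.
apply: (@small1_imp _ (fun x => forall i, ev1 (reparam c h i) x = ev1 (c i) (ev1 h x))).
  by move=> x H; apply/rowP => i; rewrite !cptE.
apply: small1_all => i.
have := @ev1_comp_curve R 1 (c i) (fun=> h) (const0_1 h0) (cc i) (fun=> hc).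
apply: small1_imp => x; rewrite /reparam => ->; congr ev.
by apply/rowP => j; rewrite !mxE.
Qed.

Section Jets.
Context {R : realType} {n : nat}.
Local Notation C := (Cplx R).
Implicit Types (F H : 'rV[C]_n -> 'rV[C]_n).

Lemma taylorP (f : 'rV[C]_n -> C) a : holomorphic_at f a -> expansion f a (taylor f a).
Proof. by rewrite /taylor => fa; case: xgetP => [y _ //|fN]; case: fa => p /fN. Qed.

Definition holo0 F := F 0 = 0 /\ forall j, holomorphic_at (fun z => F z 0 j) 0.

Lemma jet_expansion F j : holo0 F -> convergent (jet F j) /\
  small (fun z => F z 0 j = ev (jet F j) z).
Proof.
move=> [_ /(_ j)/taylorP]; rewrite -/(jet F j) => FE; split; first by case: FE.
have /expansionP[r r0 [_ Fr]] := FE.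
exists (r / 2); first by rewrite divr_gt0.
by move=> z zr; rewrite -Fr // add0r.
Qed.

Lemma convergent_jet F j : holo0 F -> convergent (jet F j).
Proof. by move=> /(jet_expansion j)[]. Qed.

Lemma jet_ev F : holo0 F -> small (fun z => F z = evs (jet F) z).
Proof.
move=> F0; have := small_all (fun j => (jet_expansion j F0).2).
by apply: small_imp => z Fz; apply/rowP => j; rewrite mxE Fz.
Qed.

Lemma jet_const0 F : holo0 F -> const0 (jet F).
Proof.
move=> F0 j; have [d d0 /(_ 0)] := jet_ev F0.
move=> /(_ (pdisc0 (ltW d0))) /rowP/(_ j); rewrite F0.1 !mxE ev0.
by [].
Qed.

(** The chain rule at the origin. The composite of the jets takes the values of the identity near 0;
    restricted to each coordinate axis it is a series in one variable, determined by its values, and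
    its coefficients of degree 1 are compared. *)
Lemma jet_inverse F H : holo0 F -> holo0 H -> small (fun z => H (F z) = z) ->
  (\matrix_(i, j) jet H i (mnm1 j)) *m (\matrix_(i, j) jet F i (mnm1 j)) = 1%:M.
Proof.
move=> F0 H0 HF; have Fc0 := jet_const0 F0; have Hc0 := jet_const0 H0.
have Fc j := convergent_jet j F0; have Hc j := convergent_jet j H0.
apply/matrixP => i l.
pose v (j : 'I_n) : fps C 1 := fpsC (j == l)%:R * X1.
have v0 : const0 v by move=> j; rewrite /v fpsM0 X1_0 mulr0.
have vc j : convergent (v j) by apply: convergentM; [exact: convergentC | exact: convergentX].
pose p := fps_comp (jet H i) (jet F).
have pc : convergent p by apply: convergent_comp.
have pE : small (fun z => ev p z = z 0 i).
  have [r r0 Fr] := ev_comp_near Fc0 (Hc i) Fc.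
  have /Fr[_ pz] : 0 < r <= r by rewrite r0 lexx.
  have [d d0 dF] := small_and (jet_ev F0) HF.
  have [d' d'0 dH] := jet_ev H0.
  have [e e0 eF] : small (fun z => pdisc d' (evs (jet F) z)).
    have [t t0 Ft] := convergent_cvs Fc.
    have [t' /andP[t'0 _] Ft'] := nb_smalls t0 Fc0 Ft d'0.
    exists (t' / 2); first by rewrite divr_gt0.
    by move=> z; apply: evs_pdisc (ltW t'0) Ft'.
  have r2 : 0 < r / 2 by rewrite divr_gt0.
  apply: (@small_imp _ _ (fun z => [/\ pdisc (r / 2) z, F z = evs (jet F) z, H (F z) = z & pdisc d' (evs (jet F) z)])).
    move=> z [zr Fz HFz Fd]; rewrite pz // -[RHS](congr1 (fun w : 'rV[C]_n => w 0 i) HFz) Fz.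
    by rewrite (dH _ Fd) mxE.
  have rs : small (pdisc (r / 2) : 'rV[C]_n -> Prop) by exists (r / 2).
  have ds : small (fun z => F z = evs (jet F) z /\ H (F z) = z) by exists d.
  have es : small (fun z => pdisc d' (evs (jet F) z)) by exists e.
  by apply: small_imp (small_and rs (small_and ds es)) => z [? [[? ?] ?]].
have pv : fps_comp p v = fpsC (i == l)%:R * X1.
  have qc : convergent (fps_comp p v - fpsC (i == l)%:R * X1).
    apply: convergentB; first exact: convergent_comp.
    by apply: convergentM; [exact: convergentC | exact: convergentX].
  apply/eqP; rewrite -subr_eq0; apply/eqP.
  have [d d0 H1] := small1_and (ev1_comp_curve v0 pc vc) (small_curve v0 vc pE).
  have /convergent_cv/(_ (convergent_comp v0 pc vc))[r r0 [qr pr]] := qc.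
  have r2 : 0 < r / 2 by rewrite divr_gt0.
  apply: (ev1_eq0 qc (min_gt0 r2 d0)) => x xd.
  have /andP[_ ml] := min_boundl r2 d0; have /andP[_ mr] := min_boundr r2 d0.
  have xr := pdisc1 (le_trans xd ml).
  have Xr : cv r (fpsC (i == l)%:R * X1 : fps C 1).
    by apply: cvM; [exact: ltW | exact: cvC | apply: cvX; exact: ltW].
  have cX : cv r (X1 : fps C 1) by apply: cvX; exact: ltW.
  rewrite /ev1 (evB (ltW r0) pr Xr xr).
  have [E1 E2] := H1 x (le_trans xd mr); rewrite -/(ev1 _ x) E1 E2 cptE /ev1 /v.
  by rewrite subrr.
have := congr1 (fun f : fps C 1 => f (mn1 1)) pv.
rewrite fps_comp_linear ?mdeg_mn1 // fpsC_mul.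
have X11 : (X1 : fps C 1) (mn1 1) = 1 by exact: (coef1_X 1).
rewrite X11 mulr1 (bigD1 l) //= /v fpsC_mul eqxx X11 mulr1 mulr1 big1 => [|j jl]; last first.
  by rewrite (negbTE jl) fpsC_mul mul0r mulr0.
rewrite addr0 /p fps_comp_linear ?mdeg1 // mxE => E.
transitivity ((i == l)%:R : C); last by rewrite mxE.
rewrite -{}E; apply: eq_bigr => j _.
by congr (_ * _); rewrite mxE.
Qed.

End Jets.

Section NormalForm.
Context {R : realType} {n : nat}.
Local Notation C := (Cplx R).
Implicit Types (c d : 'I_n -> fps C 1) (Gamma : set (fps C n)).

(** Nonsingularity is witnessed by one parametrization and must be carried to [c]. If x_i is a
    parameter for the witness, then x_j - d_j(x_i) lies in [Gamma] for all j, hence c_j = d_j(c_i),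
    and irreducibility of [c] forces c_i to have order 1. *)
Lemma nonsingular_param c Gamma : nonsingular Gamma -> parametrizes c Gamma ->
  exists i, coef1 (c i) 1 <> 0.
Proof.
move=> [c' [c'G [i c'i]]] cG; have c'0 := parametrizes0 c'G; have c0 := parametrizes0 cG.
have c'i1 : coef1 (c' i) 1 != 0 by apply/eqP.
have [g [g0 g1 cg _]] := fps1_inverse (c'0 i) c'i1.
have dG := parametrizes_reparam c'G g0 g1; have d0 := parametrizes0 dG.
set d := reparam c' g in dG d0; have di : d i = X1 by rewrite /d /reparam.
have Xi0 : const0 (fun _ : 'I_1 => fpsX i : fps C n) by move=> _; rewrite /fpsX eq_sym mnm1_eq0.
have dE j : c j = fps_comp (d j) (fun=> c i).
  have : Gamma (fpsX j - fps_comp (d j) (fun=> fpsX i)).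
    apply/dG.2; rewrite fps_compB fps_compX // (fps_compA (d j) Xi0 d0).
    rewrite (fps_comp_ext (d j) (H := fun=> X1)) ?fps_comp_by_X1 ?subrr // => _.
    by rewrite fps_compX.
  move=> /cG.2; rewrite fps_compB fps_compX // (fps_compA (d j) Xi0 c0).
  rewrite (fps_comp_ext (d j) (H := fun=> c i)) => [/eqP|_]; last by rewrite fps_compX.
  by rewrite subr_eq0 => /eqP.
exists i; have [[_ cirr] _] := cG; have [[dp _] _] := dG.
by apply: (cirr d) => //; rewrite coef10.
Qed.

(** Writing f = a X^nu (1 + e), the series s = a^(1/nu) X (1 + e)^(1/nu) satisfies s^nu = f, and [h]
    is its inverse. The clause on nu = 1 is kept for nonsingular curves. *)
Lemma power_reparam (f : fps C 1) : convergent f -> f mnm0 = 0 -> f <> 0 ->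
  exists nu (s h : fps C 1), [/\ (0 < nu)%N, (coef1 f 1 <> 0 -> nu = 1%N),
    convergent s /\ convergent h, [/\ s mnm0 = 0, coef1 s 1 != 0, h mnm0 = 0 & coef1 h 1 != 0]
    & [/\ s ^+ nu = f, fps_comp f (fun=> h) = X1 ^+ nu & fps_comp h (fun=> s) = X1]].
Proof.
move=> fc f0 fN0; have [nu [u [fE u0]]] := fps1_order fN0.
have nu0 : (0 < nu)%N.
  by case: nu fE => // fE; case: u0; rewrite -[u]mul1r -(expr0 X1) -fE coef10.
have uc : convergent u by apply: (@convergent_shift _ nu); rewrite -fE.
pose a := coef1 u 0; have a0 : a != 0 by apply/eqP.
pose al : C := nu.-root a; have alE : al ^+ nu = a by rewrite rootCK.
have al0 : al != 0 by apply: contra_eq_neq alE => ->; rewrite expr0n -[nu == 0%N]negbK -lt0n nu0 eq_sym.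
pose e := fpsC a^-1 * u - 1.
have ec : convergent e.
  by apply: convergentB; [apply: convergentM => //; exact: convergentC | exact: convergent1].
have e0 : e mnm0 = 0 by rewrite /e fpsB fpsC_mul -coef10 -/a mulVf // fps1E eqxx subrr.
have nuN : nu%:R != 0 :> C by rewrite pnatr_eq0 -lt0n.
have [w [w0 wE]] := fps1_root nuN e0.
have wc := convergent_root nu0 ec e0 w0 wE.
pose s := fpsC al * (X1 * (1 + w)).
have X1c : convergent (X1 : fps C 1) by exact: convergentX.
have sc : convergent s.
  apply: convergentM; first exact: convergentC.
  by apply: convergentM => //; apply: convergentD => //; exact: convergent1.
have s0 : s mnm0 = 0 by rewrite /s fpsC_mul fpsM0 X1_0 mul0r mulr0.
have s1 : coef1 s 1 != 0.
  by rewrite /s coef1CM coef1_XM coef1D coef1_1 (coef10 w) w0 addr0 mulr1.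
have sE : s ^+ nu = f.
  have alC : fpsC al ^+ nu = fpsC a :> fps C 1 by rewrite -rmorphXn alE.
  have aK : fpsC a * fpsC a^-1 = 1 :> fps C 1 by rewrite -rmorphM mulfV // rmorph1.
  rewrite /s !exprMn wE alC /e [1 + _]addrC subrK fE.
  have -> : fpsC a * (X1 ^+ nu * (fpsC a^-1 * u)) = (fpsC a * fpsC a^-1) * (X1 ^+ nu * u) by ring.
  by rewrite aK mul1r.
have [h [h0 h1 sh hs]] := fps1_inverse s0 s1.
exists nu, s, h; split=> //.
- move=> f1; case: nu fE nu0 {nuN al alE al0 wE s sc s0 s1 sE sh hs} => [//|[//|nu]] fE _.
  by case: f1; rewrite fE coef1_XnM.
- by split=> //; apply: convergent_inverse sh.
- by split=> //; rewrite -sE fps_compXn // sh.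
Qed.

End NormalForm.

Section Normalization.
Context {R : realType} {n : nat}.
Local Notation C := (Cplx R).

Lemma diffeo_holo0 (U : set 'rV[C]_n) F : diffeo_germ U F -> holo0 F.
Proof. by move=> [U0 F0 [W [_ _ Fh _]]]; split=> // j; apply: Fh. Qed.

Lemma diffeo_inverse (U : set 'rV[C]_n) F : diffeo_germ U F ->
  exists H, [/\ holo0 H, forall z, U z -> H (F z) = z & (forall z, U z -> F z = 0 -> z = 0)].
Proof.
move=> [U0 F0 [W [oU oW Fh [H [Hh HF _]]]]].
have HFz z : U z -> H (F z) = z by move=> /HF[].
have W0 : W 0 by rewrite -F0; have [] := HF 0 U0.
exists H; split=> //; last by move=> z Uz Fz; rewrite -(HFz z Uz) Fz -[X in H X]F0 HFz.
split; last by move=> j; apply: Hh.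
by rewrite -[X in H X]F0 HFz.
Qed.

Lemma open_small (U : set 'rV[C]_n) : open U -> U 0 -> small U.
Proof.
move=> /open_rVP oU /oU[e e0 Ue]; exists (e / 2); first by rewrite divr_gt0.
move=> z ze; apply: Ue => i; rewrite mxE subr0; apply: le_lt_trans (ze i) _; lra.
Qed.

Lemma ab_ltP (x : C) : `|x| < 1 <-> ab x < 1.
Proof. by rewrite abE -toC1 toC_lt. Qed.

Lemma normal_param (U : set 'rV[C]_n) F (Gamma : set (fps C n)) lam :
    diffeo_germ U F -> multiplier F Gamma lam -> ab lam < 1 ->
  lam <> 0 /\ exists c, [/\ parametrizes c Gamma, forall i, convergent (c i) &
    forall i, fps_comp (jet F i) c = fps_comp (c i) (fun=> fpsC lam * X1)].
Proof.
move=> FU [c [t [cG t0 t1 tE lamE]]] lam1.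
have Fh := diffeo_holo0 FU; have c0 := parametrizes0 cG.
have lam0 : lam <> 0 by rewrite lamE.
split=> //.
(* There is no resonance: 0 < |lam| < 1 gives |lam|^k < |lam| for k at least 2. *)
have laml k : (2 <= k)%N -> lam ^+ k != lam.
  case: k => [|[|k]] // _; apply/eqP => /(congr1 ab); rewrite abX => E.
  have al0 : 0 < ab lam by rewrite ab_gt0; apply/eqP.
  have : ab lam ^+ k.+2 < ab lam.
    by rewrite exprS -[X in _ < X]mulr1 ltr_pM2l // exprn_ilt1 // ab_ge0.
  by rewrite E ltxx.
have [h [h0 h1 hE]] := koenigs t0 (esym lamE) laml.
rewrite coef10 in h0.
have h1' : coef1 h 1 != 0 by rewrite h1 oner_eq0.
have t0' : t mnm0 = 0 by rewrite -coef10.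
have hG := parametrizes_reparam cG h0 h1'; have hc0 := parametrizes0 hG.
exists (reparam c h).
have E i : fps_comp (jet F i) (reparam c h) = fps_comp (reparam c h i) (fun=> fpsC lam * X1).
  have hc := const0_1 h0.
  have -> : fps_comp (jet F i) (reparam c h) = fps_comp (fps_comp (jet F i) c) (fun=> h).
    by rewrite (fps_compA (jet F i) c0 hc).
  rewrite tE /reparam (fps_compA (c i) (const0_1 t0') hc) (fps_compA (c i) hc (const0_aX lam)).
  by rewrite hE.
split=> //.
have [H [Hh HF _]] := diffeo_inverse FU.
have HFs : small (fun z => H (F z) = z).
  case: FU => U0 _ [W [oU _ _ _]].
  by apply: small_imp (open_small oU U0).
apply: (linearized_convergent (jet_const0 Fh) _ (jet_inverse Fh Hh HFs) lam1 hc0 E).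
by move=> i; apply: convergent_jet.
Qed.

End Normalization.

(** * Norms over the series in a power of the variable *)

Section Sections.
Context {K : comNzRingType}.
Implicit Types (f g h : fps K 1).

(** For j < m, these are the coordinates of [f] in the basis 1, s, ..., s^(m-1) of the series in s
    over the series in s^m. *)
Definition sect (m j : nat) (f : fps K 1) : fps K 1 := ser (fun k => coef1 f (m * k + j)).

Variables (nu : nat) (nu0 : (0 < nu)%N).

Lemma sect_decomposition h :
  h = \sum_(j < nu) X1 ^+ j * fps_comp (sect nu j h) (fun=> X1 ^+ nu).
Proof.
apply: coef1P => k; rewrite coef1_sum.
have kn : (k %% nu < nu)%N by rewrite ltn_mod.
rewrite (bigD1 (Ordinal kn)) //= coef1_XnM ltnNge leq_mod /=.
have kE : (k - k %% nu = k %/ nu * nu)%N by rewrite {1}(divn_eq k nu) addnK.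
rewrite kE coef1_comp_Xn // dvdn_mull // mulnK // coef1_ser mulnC -divn_eq big1 ?addr0 // => j jk.
rewrite coef1_XnM; case: ltnP => // jlek; rewrite coef1_comp_Xn //; case: ifP => // /dvdnP[q kq].
case/negP: jk; apply/eqP/val_inj => /=.
by rewrite -(subnK jlek) kq modnMDl modn_small.
Qed.

Lemma sect_shift g i j : (i < nu)%N -> (j < nu)%N ->
  sect nu i (X1 ^+ j * fps_comp g (fun=> X1 ^+ nu)) = if i == j then g else 0.
Proof.
move=> iu ju; apply: coef1P => k; rewrite coef1_ser coef1_XnM coef1_comp_Xn //.
case: eqP => [->|ij].
  by rewrite ltnNge leq_addl /= addnK mulnC dvdn_mull // mulnK.
case: ltnP => // jlek; case: ifP => // /dvdnP[q kq]; case: ij.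
have : (nu * k + i = q * nu + j)%N by rewrite -kq subnK.
move/(congr1 (fun m => m %% nu)%N); rewrite mulnC !modnMDl !modn_small //.
Qed.

Lemma sectD i f g : sect nu i (f + g) = sect nu i f + sect nu i g.
Proof. by apply: coef1P => k; rewrite coef1D !coef1_ser. Qed.

Lemma sect_0 i : sect nu i 0 = 0.
Proof. by apply: coef1P => k; rewrite coef1_ser. Qed.

Lemma sect_sum i (I : Type) (s : seq I) (P : pred I) (F : I -> fps K 1) :
  sect nu i (\sum_(j <- s | P j) F j) = \sum_(j <- s | P j) sect nu i (F j).
Proof. exact: (big_morph _ (sectD i) (sect_0 i)). Qed.

Lemma sect_mul rho h i : (i < nu)%N ->
  sect nu i (fps_comp rho (fun=> X1 ^+ nu) * h) = rho * sect nu i h.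
Proof.
move=> iu; rewrite {1}(sect_decomposition h) mulr_sumr sect_sum (bigD1 (Ordinal iu)) //=.
have E (j : nat) : fps_comp rho (fun=> X1 ^+ nu) * (X1 ^+ j * fps_comp (sect nu j h) (fun=> X1 ^+ nu)) =
   X1 ^+ j * fps_comp (rho * sect nu j h) (fun=> X1 ^+ nu).
  by rewrite (fps_compM _ _ (const0_Xn nu0)) mulrCA.
rewrite E sect_shift // eqxx big1 ?addr0 // => j ji.
rewrite E sect_shift //; case: eqP => // ij.
by case/negP: ji; apply/eqP/val_inj.
Qed.

Lemma sect_eq0 h : (forall j, (j < nu)%N -> sect nu j h = 0) -> h = 0.
Proof.
move=> hj; rewrite (sect_decomposition h) big1 // => j _.
by rewrite hj // fps_comp0 mulr0.
Qed.

End Sections.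

Section Norms.
Context {R : realType}.
Local Notation C := (Cplx R).
Implicit Types (f g : fps C 1).

(** The substitution s -> z s. For z a nu-th root of unity it is an automorphism over the series in
    s^nu. *)
Definition rot (z : C) (f : fps C 1) : fps C 1 := fps_comp f (fun=> fpsC z * X1).

Lemma coef1_rot z f k : coef1 (rot z f) k = coef1 f k * z ^+ k.
Proof. exact: coef1_comp_aX. Qed.

Lemma rot_is_additive z : additive (rot z).
Proof. by move=> f g; apply: fps_compB. Qed.
HB.instance Definition _ z := GRing.isAdditive.Build (fps C 1) (fps C 1) (rot z) (rot_is_additive z).
Lemma rot_is_multiplicative z : multiplicative (rot z).
Proof.
by split=> [f g|]; [apply: fps_compM; exact: const0_aX | exact: fps_comp1].
Qed.
HB.instance Definition _ z :=
  GRing.isMultiplicative.Build (fps C 1) (fps C 1) (rot z) (rot_is_multiplicative z).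

Lemma rotM y z f : rot y (rot z f) = rot (z * y) f.
Proof. by apply: coef1P => k; rewrite !coef1_rot exprMn mulrA. Qed.

Lemma rot1 f : rot 1 f = f.
Proof. by apply: coef1P => k; rewrite coef1_rot expr1n mulr1. Qed.

Lemma convergent_rot z f : convergent f -> convergent (rot z f).
Proof.
move=> fc; apply: convergent_comp => //; first exact: const0_aX.
by move=> _; apply: convergentM; [exact: convergentC | exact: convergentX].
Qed.

Lemma rot0 z f : rot z f mnm0 = f mnm0.
Proof. by rewrite /rot fps_comp_const //; exact: const0_aX. Qed.

Lemma rot_eq0 z f : z != 0 -> rot z f = 0 -> f = 0.
Proof.
move=> z0 zf; apply: coef1P => k; apply/eqP.
have /eqP := congr1 (fun g => coef1 g k) zf; rewrite coef1_rot coef1_0 mulf_eq0.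
by rewrite expf_eq0 (negbTE z0) andbF orbF.
Qed.

(** X^nu - 1 splits and is separable in characteristic 0, so there are nu distinct roots of unity,
    and they form a cyclic group. *)
Lemma primitive_root_exists nu : (0 < nu)%N -> exists z : C, nu.-primitive_root z.
Proof.
move=> nu0; pose p : {poly C} := 'X^nu - 1.
have [rs pE] := closed_field_poly_normal p.
have pm : lead_coef p = 1 by apply/eqP; rewrite -monicE monic_Xn_sub_1.
rewrite pm scale1r in pE.
have sz : size rs = nu by have := size_Xn_sub_1 C nu0; rewrite -/p pE size_prod_XsubC => -[].
have pr : all nu.-unity_root rs.
  by apply/allP => z zr; rewrite /root_of_unity -/p pE root_prod_XsubC.
have us : uniq rs.
  rewrite -separable_prod_XsubC -pE.
  by apply: separable_Xn_sub_1; rewrite pnatr_eq0 -lt0n.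
have /hasP[z _ zp] := has_prim_root nu0 pr us (eq_leq (esym sz)).
by exists z.
Qed.

Variables (nu : nat) (z : C).
Hypotheses (nu0 : (0 < nu)%N) (zP : nu.-primitive_root z).

Lemma prim_neq0 : z != 0.
Proof.
apply/eqP => z0; have := prim_expr_order zP; rewrite z0 expr0n gtn_eqF //.
by move/eqP; rewrite eq_sym oner_eq0.
Qed.

Definition conjugates g : seq (fps C 1) := [seq rot (z ^+ j) g | j <- iota 0 nu].

(** For a primitive [z], the characteristic polynomial of multiplication by [g] on the free module
    of rank [nu] over the series in s^nu; its roots are the conjugates of [g]. *)
Definition charpoly g : {poly fps C 1} := \prod_(a <- conjugates g) ('X - a%:P).

Lemma size_conjugates g : size (conjugates g) = nu.
Proof. by rewrite size_map size_iota. Qed.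

Lemma coef_mulXsubC (p : {poly fps C 1}) a k :
  (('X - a%:P) * p)`_k = (if k is k'.+1 then p`_k' else 0) - a * p`_k.
Proof. by rewrite mulrBl coefB coefXM coefCM; case: k. Qed.

Lemma convergent_coef_prod (s : seq (fps C 1)) k : (forall a, a \in s -> convergent a) ->
  convergent ((\prod_(a <- s) ('X - a%:P))`_k).
Proof.
elim: s k => [|a s IH] k sc.
  by rewrite big_nil poly.coef1; case: (k == 0%N); [exact: convergent1 | exact: convergent0].
have IHs k' : convergent ((\prod_(a <- s) ('X - a%:P))`_k').
  by apply: IH => b bs; apply: sc; rewrite inE bs orbT.
rewrite big_cons coef_mulXsubC; apply: convergentB.
  by case: k => [|k]; [exact: convergent0 | exact: IHs].
by apply: convergentM => //; apply: sc; rewrite inE eqxx.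
Qed.

Lemma const_coef_prod (s : seq (fps C 1)) k : (forall a, a \in s -> a mnm0 = 0) ->
  (\prod_(a <- s) ('X - a%:P))`_k mnm0 = (k == size s)%:R.
Proof.
elim: s k => [|a s IH] k sc.
  by rewrite big_nil poly.coef1; case: (k == 0%N) => //=; rewrite mulr1n fps1E eqxx.
have IHs k' : (\prod_(a <- s) ('X - a%:P))`_k' mnm0 = (k' == size s)%:R.
  by apply: IH => b bs; apply: sc; rewrite inE bs orbT.
have a0 : a mnm0 = 0 by apply: sc; rewrite inE eqxx.
rewrite big_cons coef_mulXsubC fpsB fpsM0 a0 mul0r subr0.
by case: k => [|k] //=; rewrite IHs eqSS.
Qed.

(** Rotation by [z] shifts the list of conjugates by one place, and z^nu = 1 brings the last one
    back to the first. *)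
Lemma charpoly_rot g : map_poly (rot z) (charpoly g) = charpoly g.
Proof.
rewrite /charpoly /conjugates rmorph_prod !big_map /=.
have E j : map_poly (rot z) ('X - (rot (z ^+ j) g)%:P) = 'X - (rot (z ^+ j.+1) g)%:P.
  by rewrite rmorphB /= map_polyX map_polyC /= rotM -exprSr.
under eq_bigr do rewrite E.
have zm : z ^+ nu.-1.+1 = 1 by rewrite prednK // prim_expr_order.
rewrite -(prednK nu0); move: (nu.-1) zm => m zm.
rewrite -[in LHS](addn1 m) iotaD big_cat /= big_seq1 add0n zm.
rewrite [in RHS]big_cons expr0 [RHS]mulrC (iotaDl 1 0) big_map.
by [].
Qed.

(** The coefficient of the characteristic polynomial, read as a series in x = s^nu. *)
Definition chcoef g k : fps C 1 := sect nu 0 (charpoly g)`_k.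

(** At radius r^m, and up to the factor r^j, the terms of the section are among the terms of [f] at
    radius r. *)
Lemma convergent_sect m j f : (0 < m)%N -> convergent f -> convergent (sect m j f).
Proof.
move=> m0 /convergentP[r r0 [M fM]]; apply/convergentP; exists (r ^+ m); first by rewrite exprn_gt0.
exists (M / r ^+ j); apply/nb1P => N; rewrite ler_pdivlMr ?exprn_gt0 // mulr_suml.
have /nb1P/(_ (m * N + j)%N) := fM; apply: le_trans.
rewrite -(big_mkord xpredT (fun i => ab (coef1 f i) * r ^+ i)).
pose h k := (m * k + j)%N.
apply: (@le_trans _ _ (\sum_(i <- map h (iota 0 N)) ab (coef1 f i) * r ^+ i)).
  rewrite big_map -(big_mkord xpredT (fun k => ab (coef1 (sect m j f) k) * r ^+ m ^+ k * r ^+ j)).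
  rewrite /index_iota subn0 le_eqVlt; apply/orP; left; apply/eqP; apply: eq_bigr => k _.
  by rewrite coef1_ser -exprM -mulrA -exprD.
have hu : uniq (map h (iota 0 N)).
  rewrite map_inj_uniq ?iota_uniq // => k l /eqP; rewrite /h eqn_add2r eqn_pmul2l //.
  by move/eqP.
have hs : {subset map h (iota 0 N) <= index_iota 0 (m * N + j)}.
  move=> i /mapP[k]; rewrite mem_iota add0n /= => kN ->; rewrite mem_index_iota /= /h.
  by rewrite ltn_add2r ltn_pmul2l.
rewrite [leRHS](perm_big (map h (iota 0 N) ++ [seq i <- index_iota 0 (m * N + j) | i \notin map h (iota 0 N)])) /=.
  rewrite big_cat /= lerDl; apply: sumr_ge0 => i _.
  by rewrite mulr_ge0 ?ab_ge0 ?exprn_ge0 ?ltW.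
apply: uniq_perm; first by rewrite iota_uniq.
  rewrite cat_uniq hu filter_uniq ?iota_uniq // andbT; apply/hasPn => i.
  by rewrite mem_filter => /andP[].
move=> i; rewrite mem_cat mem_filter; have [ih|] := boolP (i \in map h _) => //=.
by rewrite hs.
Qed.

Lemma sect0_comp m f : (0 < m)%N -> (forall k, ~~ (m %| k)%N -> coef1 f k = 0) ->
  fps_comp (sect m 0 f) (fun=> X1 ^+ m) = f.
Proof.
move=> m0 fm; apply: coef1P => k; rewrite coef1_comp_Xn //; case: ifPn => [/dvdnP[q ->]|/fm ->//].
by rewrite mulnK // coef1_ser addn0 mulnC.
Qed.

(** The coefficients are invariant under s -> z s, so a nonzero term of degree m forces z^m = 1,
    that is, nu divides m. *)
Lemma chcoefE g k : fps_comp (chcoef g k) (fun=> X1 ^+ nu) = (charpoly g)`_k.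
Proof.
apply: sect0_comp => // m num.
have /(congr1 (fun p : {poly fps C 1} => coef1 p`_k m)) := charpoly_rot g.
rewrite coef_map coef1_rot => /eqP; rewrite -subr_eq0 -{2}[coef1 _ m]mulr1 -mulrBr mulf_eq0.
move=> /orP[/eqP //|]; rewrite subr_eq0 -(prim_order_dvd zP) => num'.
by rewrite num' in num.
Qed.

Lemma convergent_chcoef g k : convergent g -> convergent (chcoef g k).
Proof.
move=> gc; apply: convergent_sect => //; apply: convergent_coef_prod => a /mapP[j _ ->].
exact: convergent_rot.
Qed.

Lemma chcoef_lead g : (charpoly g)`_nu = 1.
Proof.
have : charpoly g \is monic by apply: monic_prod_XsubC.
by rewrite monicE lead_coefE size_prod_XsubC size_conjugates => /eqP.
Qed.

Lemma horner_charpoly g x :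
  \sum_(k < nu.+1) (charpoly g)`_k * x ^+ k = \prod_(j < nu) (x - rot (z ^+ j) g).
Proof.
have sz : (size (charpoly g) <= nu.+1)%N by rewrite size_prod_XsubC size_conjugates.
rewrite -(horner_coef_wide x sz) /charpoly horner_prod big_map -(big_mkord xpredT (fun j => x - rot (z ^+ j) g)).
by rewrite /index_iota subn0; apply: eq_bigr => j _; rewrite !hornerE.
Qed.

(** All conjugates vanish at s = 0, where the polynomial reduces to a pure power: it is a
    Weierstrass polynomial. *)
Lemma chcoef_lt0 g k : g mnm0 = 0 -> (k < nu)%N -> chcoef g k mnm0 = 0.
Proof.
move=> g0 knu; rewrite -coef10 coef1_ser muln0 addn0 coef10 const_coef_prod.
  by rewrite size_conjugates ltn_eqF.
by move=> a /mapP[j _ ->]; rewrite rot0.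
Qed.

(** Up to sign this coefficient is the product of the conjugates of [g], none of which vanishes in
    the domain of series. *)
Lemma chcoef0_neq0 g : g <> 0 -> chcoef g 0 <> 0.
Proof.
move=> g0 E; have := chcoefE g 0; rewrite E fps_comp0.
have := horner_charpoly g 0; rewrite big_ord_recl expr0 mulr1 big1 ?addr0 => [->|i _]; last first.
  by rewrite expr0n /= mulr0.
move=> /esym; elim: nu => [|m IH]; first by rewrite big_ord0 => /eqP; rewrite oner_eq0.
rewrite big_ord_recr /= => /fps1_domain[//|/eqP].
rewrite sub0r oppr_eq0 => /eqP /rot_eq0 H; apply: g0; apply: H.
by rewrite expf_neq0 // prim_neq0.
Qed.

End Norms.

Lemma mnm_le_mdeg n (m : multinom n) i : (m i <= mdeg m)%N.
Proof. by rewrite mdegE (bigD1 i) //= leq_addr. Qed.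

(** * The ideal of the curve *)

Section Monomials.
Context {K : comNzRingType} {n : nat}.
Implicit Types (f g : fps K n) (m al : multinom n).

Definition fpsmon al : fps K n := fun m => (m == al)%:R.

Lemma fpsmonME al g m :
  (fpsmon al * g) m = if lem al m then g (mnm_sub m al) else 0.
Proof.
rewrite (fpsME _ g (ltnSn (mdeg m))).
case: ifPn => [alm|alm].
  have a1 : (mdeg al < (mdeg m).+1)%N by rewrite ltnS -(submK alm) mdegD leq_addl.
  have a2 : (mdeg (mnm_sub m al) < (mdeg m).+1)%N by rewrite ltnS mdegB.
  rewrite (bigD1 (BMultinom a1, BMultinom a2)) /=; last by rewrite addmC submK.
  rewrite /fpsmon eqxx mul1r big1 ?addr0 // => -[k l] /andP[/eqP mkl kl] /=.
  case: eqP => k0; last by rewrite mul0r.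
  case/negP: kl; rewrite -pair_eqE /=; apply/andP; split; apply/eqP/val_inj => //=.
  by rewrite [in RHS]mkl /= k0 addmC addmK.
apply: big1 => -[k l] /eqP mkl /=; rewrite /fpsmon; case: eqP => k0; last by rewrite mul0r.
by case/negP: alm; rewrite mkl /= k0 lem_addr.
Qed.

Lemma fpsmonD al be : fpsmon (mnm_add al be) = fpsmon al * fpsmon be.
Proof.
apply: fpsP => m; rewrite fpsmonME /fpsmon; case: ifPn => alm.
  by rewrite -{1}(submK alm) addmC (inj_eq (@addmI _ al)).
by case: eqP => // mE; case/negP: alm; rewrite mE lem_addr.
Qed.

Lemma fpsXnE i k : fpsX i ^+ k = fpsmon (mnm_muln (mnm1 i) k).
Proof.
elim: k => [|k IH]; first by rewrite expr0 mulm0n.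
by rewrite exprS IH mulmS fpsmonD.
Qed.

Lemma fpsXnME i k g m : (fpsX i ^+ k * g) m =
  if (k <= m i)%N then g (mnm_sub m (mnm_muln (mnm1 i) k)) else 0.
Proof.
rewrite fpsXnE fpsmonME; congr (if _ then _ else _).
apply/mnm_lepP/idP => [/(_ i)|km j]; rewrite mulmnE mnm1E ?eqxx ?mul1n //.
by case: eqP => [<-|]; rewrite ?mul1n ?mul0n.
Qed.

End Monomials.

Lemma convergent_fpsmon (R : realType) n (al : multinom n) : convergent (fpsmon al : fps (Cplx R) n).
Proof.
rewrite [al]multinomUE_id; elim/big_ind: _ => [|a b ac bc|i _]; first exact: convergent1.
  by rewrite fpsmonD; apply: convergentM.
by rewrite -fpsXnE; apply: convergentXn; exact: convergentX.
Qed.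

Section Generated.
Context {T : comNzRingType}.
Implicit Types (J : set T).

Lemma generated_fin J (I : finType) (a b : I -> T) : (forall i, J (b i)) ->
  generated_ideal J (\sum_i a i * b i).
Proof.
move=> Jb; exists #|I|, (fun i => a (enum_val i)), (fun i => b (enum_val i)); split=> //.
by rewrite (reindex (@enum_val I I)) //=; apply: onW_bij; apply: enum_val_bij.
Qed.

Lemma generatedD J x y : generated_ideal J x -> generated_ideal J y -> generated_ideal J (x + y).
Proof.
move=> [k [a [b [Jb ->]]]] [l [a' [b' [Jb' ->]]]].
pose aa (i : 'I_k + 'I_l) := match i with inl i => a i | inr i => a' i end.
pose bb (i : 'I_k + 'I_l) := match i with inl i => b i | inr i => b' i end.
have -> : \sum_i a i * b i + \sum_i a' i * b' i = \sum_i aa i * bb i by rewrite big_sumType.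
by apply: generated_fin => -[].
Qed.

End Generated.

Section ValuationRing.
Context {R : realType}.
Local Notation C := (Cplx R).

(* Convergent series in one variable form a valuation ring, so Gaussian elimination with
   a pivot of least order stays inside it. *)
Lemma convergent_relations (I : finType) nu (rows : nat -> I -> fps C 1) (r : I -> fps C 1) :
    (forall j al, (j < nu)%N -> convergent (rows j al)) ->
    (forall j, (j < nu)%N -> \sum_al r al * rows j al = 0) ->
  exists (J : finType) (a : J -> fps C 1) (b : J -> I -> fps C 1),
    [/\ forall t al, convergent (b t al),
        forall t j, (j < nu)%N -> \sum_al b t al * rows j al = 0
      & forall al, r al = \sum_t a t * b t al].
Proof.
elim: nu rows r => [|nu IH] rows r hc hr.
  exists I, r, (fun be al => (be == al)%:R); split=> // [j al|al].
    by case: eqP => _; [exact: convergent1 | exact: convergent0].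
  rewrite (bigD1 al) //= eqxx mulr1 big1 ?addr0 // => be /negbTE ->.
  by rewrite mulr0.
pose h := rows nu.
have [h0|h0] := pselect (forall al, h al = 0).
  have [j al ju|j ju|J [a [b [bc br rE]]]] := IH rows r.
  - by apply: hc; apply: ltnW.
  - by apply: hr; apply: ltnW.
  exists J, a, b; split=> // t j; rewrite ltnS leq_eqVlt => /orP[/eqP ->|]; last exact: br.
  by apply: big1 => al _; rewrite -/h h0 mulr0.
have [k hk] : exists k, [exists al, coef1 (h al) k != 0].
  apply: contrapT => /forallNP hk; apply: h0 => al; apply: coef1P => k.
  by apply/eqP/negPn/negP => hal; apply: (hk k); apply/existsP; exists al.
have [k0 /existsP[al0 hal0] k0min] := ex_minnP (ex_intro (fun k => [exists al, coef1 (h al) k != 0]) k hk).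
have hord al : eqd k0 (h al) 0.
  apply/eqd1P => i ik; apply/eqP/negPn/negP => hi.
  have : [exists al, coef1 (h al) i != 0] by apply/existsP; exists al.
  by move=> /k0min; rewrite leqNgt ik.
pose w al := ser (fun i => coef1 (h al) (k0 + i)).
have hE al : h al = X1 ^+ k0 * w al by apply: eqd_Xn.
have wc al : convergent (w al).
  by apply: (@convergent_shift _ k0); rewrite -hE; apply: hc.
have w0 : w al0 mnm0 != 0 by rewrite -coef10 coef1_ser addn0.
pose v := fps_inv (w al0).
have wv : w al0 * v = 1 by apply: fps_invE.
pose q al := w al * v.
have qc al : convergent (q al) by apply: convergentM => //; exact: convergent_inv.
have hq al : h al = q al * h al0.
  rewrite (hE al) (hE al0) /q.
  have -> : w al * v * (X1 ^+ k0 * w al0) = X1 ^+ k0 * w al * (w al0 * v) by ring.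
  by rewrite wv mulr1.
have q0 : q al0 = 1 by rewrite /q wv.
(* Solves the pivot equation sum s q = 0 for the coordinate [al0], whose coefficient is 1. [Pi]
   keeps the other coordinates and fixes every solution, in particular [r]. *)
pose Pi (s : I -> fps C 1) al := if al == al0 then - \sum_(be | be != al0) q be * s be else s al.
have PiQ s : \sum_al Pi s al * q al = 0.
  rewrite (bigD1 al0) //= /Pi eqxx q0 mulr1 addrC; apply/eqP; rewrite subr_eq0; apply/eqP.
  by apply: eq_bigr => be /negbTE ->; rewrite mulrC.
have hsum s : \sum_al s al * h al = (\sum_al s al * q al) * h al0.
  by rewrite mulr_suml; apply: eq_bigr => al _; rewrite -mulrA -hq.
have hal0N : h al0 <> 0 by move=> h00; move: hal0; rewrite h00 coef1_0 eqxx.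
have Pir : forall al, Pi r al = r al.
  have : \sum_al r al * q al = 0 by have := hr nu (ltnSn nu); rewrite -/h hsum => /fps1_domain[].
  rewrite (bigD1 al0) //= q0 mulr1 => /eqP; rewrite addr_eq0 => /eqP E al.
  rewrite /Pi; case: eqP => // ->; rewrite E; congr (- _).
  by apply: eq_bigr => be _; rewrite mulrC.
(* The rows after elimination of the pivot column. Relations among them become, through [Pi],
   relations among the old rows that also satisfy the pivot equation. *)
pose red j al := if al == al0 then 0 else rows j al - q al * rows j al0.
have redE s j : \sum_al s al * red j al = \sum_al Pi s al * rows j al.
  rewrite [LHS](bigD1 al0) //= [RHS](bigD1 al0) //= /red /Pi eqxx mulr0 add0r.
  rewrite mulNr mulr_suml -sumrN -big_split /=; apply: eq_bigr => be bN.
  by rewrite (negbTE bN) mulrBr addrC; congr (_ - _); rewrite mulrA [s be * _]mulrC.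
have [j al ju|j ju|J [a [b [bc br rE]]]] := IH red r.
- rewrite /red; case: ifP => _; first exact: convergent0.
  apply: convergentB; first by apply: hc; apply: ltnW.
  by apply: convergentM => //; apply: hc; apply: ltnW.
- rewrite redE; under eq_bigr do rewrite Pir.
  by apply: hr; apply: ltnW.
exists J, a, (fun t => Pi (b t)); split=> [t al|t j|al].
- rewrite /Pi; case: ifP => _ //; apply: convergentN.
  by apply: convergent_sum => be _; apply: convergentM.
- rewrite ltnS leq_eqVlt => /orP[/eqP ->|ju]; last by rewrite -redE br.
  by rewrite -/h hsum PiQ mul0r.
rewrite -Pir /Pi; case: eqP => // _.
under [RHS]eq_bigr do rewrite mulrN mulr_sumr.
rewrite sumrN exchange_big /=; congr (- _); apply: eq_bigr => be _.
by rewrite rE mulr_sumr; apply: eq_bigr => t _; rewrite mulrCA.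
Qed.

End ValuationRing.

Section Lift.
Context {K : comNzRingType} {n : nat}.
Variable i0 : 'I_n.

Definition lift (b : fps K 1) : fps K n := fps_comp b (fun=> fpsX i0).

Lemma const0_X (i : 'I_n) : const0 (fun _ : 'I_1 => fpsX i : fps K n).
Proof. by move=> _; rewrite /fpsX eq_sym mnm1_eq0. Qed.

Lemma liftM a b : lift (a * b) = lift a * lift b.
Proof. by rewrite /lift (fps_compM _ _ (const0_X i0)). Qed.

Lemma lift1 : lift 1 = 1. Proof. exact: fps_comp1. Qed.
Lemma lift0 : lift 0 = 0. Proof. exact: fps_comp0. Qed.

Lemma lift_sum (I : Type) (s : seq I) (P : pred I) (F : I -> fps K 1) :
  lift (\sum_(j <- s | P j) F j) = \sum_(j <- s | P j) lift (F j).
Proof. exact: fps_comp_sum. Qed.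

Lemma lift_X1 : lift X1 = fpsX i0.
Proof. by rewrite /lift fps_comp_X1 // (const0_X i0 ord0). Qed.

Lemma lift_Xn k : lift (X1 ^+ k) = fpsX i0 ^+ k.
Proof. by rewrite /lift (fps_compXn _ _ (const0_X i0)) -/(lift X1) lift_X1. Qed.

Lemma lift_const0 b : lift b mnm0 = b mnm0.
Proof. by rewrite /lift (fps_comp_const _ (const0_X i0)). Qed.

Lemma lift_comp p b (d : 'I_n -> fps K p) : const0 d ->
  fps_comp (lift b) d = fps_comp b (fun=> d i0).
Proof.
move=> d0; rewrite /lift (fps_compA _ (const0_X i0) d0).
by apply: fps_comp_ext => _; rewrite fps_compX.
Qed.

Lemma liftE b m : lift b m = if m == mnm_muln (mnm1 i0) (m i0) then coef1 b (m i0) else 0.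
Proof.
rewrite /lift fps_compE psubE (bmsum1 _ (fun k => b k * mmon (fun=> fpsX i0) k m)).
have E k : mmon (fun _ : 'I_1 => fpsX i0 : fps K n) (mn1 k) m = (m == mnm_muln (mnm1 i0) k)%:R.
  by rewrite /mmon big_ord1 fpsXnE.
under eq_bigr do rewrite E.
case: ifPn => [/eqP mE|mN].
  have km : (m i0 < (mdeg m).+1)%N by rewrite ltnS {2}mE mdegMn mdeg1 mul1n.
  rewrite (bigD1 (Ordinal km)) //= -mE eqxx mulr1 big1 ?addr0 // => k kN.
  case: eqP => [mk|]; last by rewrite mulr0.
  have ki0 : m i0 = k by rewrite [in LHS]mk mulmnE mnm1E eqxx mul1n.
  by case/negP: kN; apply/eqP/val_inj; rewrite /= ki0.
apply: big1 => k _; case: eqP => [mk|]; last by rewrite mulr0.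
by case/negP: mN; rewrite {2}mk mulmnE mnm1E eqxx mul1n -mk.
Qed.

End Lift.

Lemma convergent_lift (R : realType) n (i0 : 'I_n) (b : fps (Cplx R) 1) :
  convergent b -> convergent (lift i0 b).
Proof. by move=> bc; apply: convergent_comp => //; [exact: const0_X | move=> _; exact: convergentX]. Qed.

(** * Simultaneous Weierstrass division by one polynomial in each variable *)

Section Division.
Context {K : comNzRingType} {n : nat}.
Variables (i0 : 'I_n) (nu : nat) (Q : 'I_n -> fps K n).
Implicit Types (f g : fps K n) (m : multinom n).

(** Assigns each reducible monomial to a single variable, so that the multiples of the various
    x_i^nu are partitioned and no term is divided twice. *)
Definition big_index m : option 'I_n := [pick i | (i != i0) && (nu <= m i)%N].

Definition rem0 f : fps K n := fun m => if big_index m is None then f m else 0.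

Definition quo0 i f : fps K n := fun m =>
  let m' := mnm_add m (mnm_muln (mnm1 i) nu) in
  if big_index m' == Some i then f m' else 0.

Lemma division0 f : f = rem0 f + \sum_i fpsX i ^+ nu * quo0 i f.
Proof.
apply: fpsP => m; rewrite fpsD fps_sum.
have E i : (fpsX i ^+ nu * quo0 i f) m = if big_index m == Some i then f m else 0.
  rewrite fpsXnME; case: ifPn => [km|]; last first.
    case: eqP => // mi; case/negP; move: mi; rewrite /big_index; case: pickP => // j /andP[_ jm].
    by case=> <-.
  rewrite /quo0 submK //; apply/mnm_lepP => j; rewrite mulmnE mnm1E.
  by case: eqP => [<-|]; rewrite ?mul1n ?mul0n.
under eq_bigr do rewrite E.
rewrite /rem0; case mE: (big_index m) => [i|]; last by rewrite big1 ?addr0 // => i _; case: eqP.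
rewrite (bigD1 i) //= eqxx big1 ?addr0 ?add0r // => j ji.
by case: eqP => // -[ij]; rewrite ij eqxx in ji.
Qed.

(** Equal to x_i^nu modulo x_i0. Division by the pure powers x_i^nu thus leaves an error divisible
    by x_i0, and the repeated division converges for the x_i0-adic topology. *)
Definition divisor i := fpsX i ^+ nu + fpsX i0 * Q i.

Definition next f : fps K n := - \sum_i Q i * quo0 i f.

Lemma division_step f :
  f = rem0 f + \sum_i quo0 i f * divisor i + fpsX i0 * next f.
Proof.
rewrite {1}(division0 f) -addrA; congr (_ + _).
rewrite /next mulrN mulr_sumr -sumrB; apply: eq_bigr => i _.
by rewrite /divisor; ring.
Qed.

(** The infinite sum of the x_i0^k u_k. A term with k > mdeg m has no coefficient at [m]. *)
Definition xsum (u : nat -> fps K n) : fps K n := fun m =>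
  \sum_(k < (mdeg m).+1) (fpsX i0 ^+ k * u k) m.

Lemma eqd_xsum D u : eqd D (xsum u) (\sum_(k < D) fpsX i0 ^+ k * u k).
Proof.
move=> m mD; rewrite fps_sum /xsum.
rewrite -[RHS](big_mkord xpredT (fun k => (fpsX i0 ^+ k * u k) m)).
rewrite (big_cat_nat (leq0n (mdeg m).+1) mD) /= big_mkord.
rewrite [X in _ + X](_ : _ = 0) ?addr0 // big_nat_cond big1 // => k /andP[/andP[mk _] _].
by rewrite fpsXnME leqNgt (leq_ltn_trans (mnm_le_mdeg _ _) mk).
Qed.

Definition iter_next f k := iter k next f.

Lemma division_iter f D : f =
  \sum_(k < D) fpsX i0 ^+ k * (rem0 (iter_next f k) + \sum_i quo0 i (iter_next f k) * divisor i)
  + fpsX i0 ^+ D * iter_next f D.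
Proof.
elim: D => [|D IH]; first by rewrite big_ord0 add0r mul1r.
rewrite big_ord_recr /= {1}IH -addrA; congr (_ + _).
by rewrite {1}(division_step (iter_next f D)) exprSr /=; ring.
Qed.

Definition remainder f := xsum (fun k => rem0 (iter_next f k)).
Definition quotient f i := xsum (fun k => quo0 i (iter_next f k)).

Lemma division f : f = remainder f + \sum_i quotient f i * divisor i.
Proof.
apply: eqdP => D; rewrite {1}(division_iter f D).
apply: (@eqd_trans _ _ _ _ (\sum_(k < D) fpsX i0 ^+ k * (rem0 (iter_next f k) + \sum_i quo0 i (iter_next f k) * divisor i))).
  rewrite -[X in eqd _ _ X]addr0; apply: eqdD => // m mD; rewrite fpsXnME; case: ifP => // Dm.
  by have := leq_trans Dm (mnm_le_mdeg m i0); rewrite leqNgt mD.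
apply/eqd_sym.
apply: (@eqd_trans _ _ _ _ (\sum_(k < D) fpsX i0 ^+ k * rem0 (iter_next f k) +
    \sum_i (\sum_(k < D) fpsX i0 ^+ k * quo0 i (iter_next f k)) * divisor i)).
  apply: eqdD; first exact: eqd_xsum.
  by apply: eqd_sum => i _; apply: eqdM => //; exact: eqd_xsum.
suff -> : \sum_(k < D) fpsX i0 ^+ k * rem0 (iter_next f k) +
    \sum_i (\sum_(k < D) fpsX i0 ^+ k * quo0 i (iter_next f k)) * divisor i =
  \sum_(k < D) fpsX i0 ^+ k * (rem0 (iter_next f k) + \sum_i quo0 i (iter_next f k) * divisor i) by [].
under [RHS]eq_bigr do rewrite mulrDr mulr_sumr.
rewrite big_split exchange_big /=; congr (_ + _); apply: eq_bigr => i _.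
by rewrite mulr_suml; apply: eq_bigr => k _; rewrite mulrA.
Qed.

Lemma remainder_small f m i : i != i0 -> (nu <= m i)%N -> remainder f m = 0.
Proof.
move=> ii0 im; apply: big1 => k _; rewrite fpsXnME; case: ifP => // km.
rewrite /rem0 /big_index; case: pickP => // /(_ i).
by rewrite ii0 mnmBE mulmnE mnm1E eq_sym (negbTE ii0) mul0n subn0 im.
Qed.

(** The exponents of the variables other than x_i0 are below [nu] in a remainder. It is therefore a
    combination, over the series in x_i0, of finitely many monomials of degree at most n * nu.
    Indices [al] that involve x_i0 receive the coefficient 0. *)
Lemma remainderE f : exists (D : nat) (r : bmultinom n D -> fps K 1),
  remainder f = \sum_al lift i0 (r al) * fpsmon al.
Proof.
pose D := (n * nu).+1; exists D.
exists (fun al : bmultinom n D => if al i0 == 0%N then ser (fun k => remainder f (mnm_add al (mnm_muln (mnm1 i0) k))) else 0).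
apply: fpsP => m; rewrite fps_sum.
pose m0 := mnm_sub m (mnm_muln (mnm1 i0) (m i0)).
have lei0 : lem (mnm_muln (mnm1 i0) (m i0)) m.
  by apply/mnm_lepP => j; rewrite mulmnE mnm1E; case: eqP => [<-|]; rewrite ?mul1n ?mul0n.
have mE : mnm_add m0 (mnm_muln (mnm1 i0) (m i0)) = m by rewrite submK.
have m0i0 : m0 i0 = 0%N by rewrite mnmBE mulmnE mnm1E eqxx mul1n subnn.
have term (al : bmultinom n D) : al i0 = 0%N -> lem al m ->
    mnm_sub m al = mnm_muln (mnm1 i0) (m i0) -> al = m0 :> multinom n.
  by move=> _ alm E; rewrite /m0 -E; apply/mnmP => j; rewrite !mnmBE subKn //; exact: (mnm_lepP alm).
have [mbig|msmall] := pselect (exists2 i, i != i0 & (nu <= m i)%N).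
  have [i ii0 im] := mbig; rewrite (remainder_small f ii0 im) big1 // => al _.
  rewrite mulrC fpsmonME; case: ifP => // alm; case: eqP => [ali|_]; last by rewrite lift0.
  rewrite liftE mnmBE ali subn0; case: ifP => // /eqP /(term _ ali alm) ->.
  by rewrite coef1_ser mE (remainder_small f ii0 im).
have m0D : (mdeg m0 < D)%N.
  rewrite /D ltnS mdegE -[n in (n * _)%N]card_ord -sum_nat_const; apply: leq_sum => i _.
  have [->|ii0] := eqVneq i i0; first by rewrite m0i0.
  rewrite mnmBE mulmnE mnm1E eq_sym (negbTE ii0) mul0n subn0 leqNgt; apply/negP => H.
  by apply: msmall; exists i => //; apply: ltnW.
rewrite (bigD1 (BMultinom m0D)) //= m0i0 eqxx mulrC fpsmonME.
have m0m : lem m0 m by apply: lem_subr.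
have E0 : mnm_sub m m0 = mnm_muln (mnm1 i0) (m i0) by rewrite -{1}mE addmC addmK.
rewrite m0m E0 liftE mulmnE mnm1E eqxx mul1n eqxx coef1_ser mE big1 ?addr0 // => al alN.
rewrite mulrC fpsmonME; case: ifP => // alm; case: eqP => [ali|_]; last by rewrite lift0.
rewrite liftE mnmBE ali subn0; case: ifP => // /eqP /(term _ ali alm) E.
by case/negP: alN; apply/eqP/val_inj.
Qed.

End Division.

Section KernelGenerated.
Context {R : realType} {n : nat}.
Local Notation C := (Cplx R).
Variables (d : 'I_n -> fps C 1) (i0 : 'I_n) (nu : nat).
Hypotheses (nu0 : (0 < nu)%N) (d0 : const0 d) (dc : forall i, convergent (d i))
  (di0 : d i0 = X1 ^+ nu).

Definition kernel : set (fps C n) := [set g | convergent g /\ fps_comp g d = 0].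

Lemma lift_d b : fps_comp (lift i0 b) d = fps_comp b (fun=> X1 ^+ nu).
Proof. by rewrite lift_comp // di0. Qed.

(* The characteristic polynomial of [g o d] over the series in [x_i0], at [g]. *)
Definition chseries z (g : fps C 1) (G : fps C n) : fps C n :=
  \sum_(k < nu.+1) lift i0 (chcoef nu z g k) * G ^+ k.

Lemma chseries_comp z g G : nu.-primitive_root z -> fps_comp G d = g ->
  fps_comp (chseries z g G) d = 0.
Proof.
move=> zP Gd; rewrite /chseries fps_comp_sum.
have E (k : 'I_nu.+1) : fps_comp (lift i0 (chcoef nu z g k) * G ^+ k) d = (charpoly nu z g)`_k * g ^+ k.
  by rewrite (fps_compM _ _ d0) lift_d (fps_compXn _ _ d0) Gd (chcoefE nu0 zP).
under eq_bigr do rewrite E.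
rewrite (horner_charpoly nu z g g) (bigD1 (Ordinal nu0)) //= expr0 rot1 subrr mul0r //.
Qed.

Lemma convergent_chseries z g G : convergent g -> convergent G -> convergent (chseries z g G).
Proof.
move=> gc Gc; apply: convergent_sum => k _; apply: convergentM.
  by apply: convergent_lift; apply: convergent_chcoef.
exact: convergentXn.
Qed.

(** The divisors lie in the kernel, so only the remainder of [f] matters. Its vanishing along the
    curve amounts to [nu] linear equations over the series in x, one for each residue of the
    exponent of s modulo nu. These equations have convergent coefficients and finitely many
    unknowns. *)
Lemma kernel_generates f : fps_comp f d = 0 -> generated_ideal kernel f.
Proof.
move=> fd; have [z zP] := @primitive_root_exists R nu nu0.
(* The lower coefficients of the characteristic polynomial of [d i] vanish at 0; [Q] collects their
   quotients by x_i0, and the divisor is that polynomial evaluated at x_i. *)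
pose Q i := \sum_(k < nu) lift i0 (ser (fun j => coef1 (chcoef nu z (d i) k) j.+1)) * fpsX i ^+ k.
have PE i : divisor i0 nu Q i = chseries z (d i) (fpsX i).
  rewrite /divisor /chseries big_ord_recr /= addrC.
  have -> : lift i0 (chcoef nu z (d i) nu) = 1.
    have -> : chcoef nu z (d i) nu = 1; last exact: lift1.
    rewrite /chcoef (chcoef_lead nu z (d i)); apply: coef1P => k.
    by rewrite coef1_ser !coef1_1 addn0 muln_eq0 -[nu == 0%N]negbK -lt0n nu0.
  rewrite mul1r; congr (_ + _); rewrite /Q mulr_sumr; apply: eq_bigr => k _.
  rewrite mulrA -lift_X1 -liftM; congr (lift i0 _ * _).
  apply: coef1P => j; rewrite coef1_XM; case: j => [|j]; last by rewrite coef1_ser.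
  by rewrite coef10 chcoef_lt0.
have PK i : kernel (divisor i0 nu Q i).
  rewrite PE; split; last by apply: chseries_comp => //; rewrite fps_compX.
  by apply: convergent_chseries => //; exact: convergentX.
rewrite (division i0 nu Q f); apply: generatedD; last exact: generated_fin.
have [D [r rE]] := remainderE i0 nu Q f.
have rd : fps_comp (remainder i0 nu Q f) d = 0.
  have := fd; rewrite {1}(division i0 nu Q f) fps_compD [X in _ + X]fps_comp_sum.
  rewrite [X in _ + X]big1 ?addr0 // => i _.
  by rewrite fps_compM // (PK i).2 mulr0.
pose h (al : bmultinom n D) := fps_comp (fpsmon al) d.
have hc al : convergent (h al) by apply: convergent_comp => //; exact: convergent_fpsmon.
have comb (s : bmultinom n D -> fps C 1) :
    fps_comp (\sum_al lift i0 (s al) * fpsmon al) d = \sum_al fps_comp (s al) (fun=> X1 ^+ nu) * h al.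
  by rewrite fps_comp_sum; apply: eq_bigr => al _; rewrite fps_compM // lift_d.
have sect_comb (s : bmultinom n D -> fps C 1) j : (j < nu)%N ->
    sect nu j (\sum_al fps_comp (s al) (fun=> X1 ^+ nu) * h al) = \sum_al s al * sect nu j (h al).
  by move=> ju; rewrite sect_sum; apply: eq_bigr => al _; rewrite sect_mul.
(* This is flatness of formal over convergent series: the formal solution [r] is a combination of
   convergent solutions. *)
have [j al ju|j ju|J [a [b [bc br rab]]]] := @convergent_relations R _ nu (fun j al => sect nu j (h al)) r.
- exact: convergent_sect.
- by rewrite -sect_comb // -comb -rE rd sect_0.
have -> : remainder i0 nu Q f = \sum_t lift i0 (a t) * (\sum_al lift i0 (b t al) * fpsmon al).
  rewrite rE; under [RHS]eq_bigr do rewrite mulr_sumr.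
  rewrite exchange_big /=; apply: eq_bigr => al _; rewrite rab lift_sum mulr_suml.
  by apply: eq_bigr => t _; rewrite liftM mulrA.
apply: generated_fin => t; split.
  apply: convergent_sum => al _; apply: convergentM; last exact: convergent_fpsmon.
  exact: convergent_lift.
rewrite comb; apply: (sect_eq0 nu0) => j ju.
by rewrite sect_comb // br.
Qed.

End KernelGenerated.

Section KernelIdeal.
Context {R : realType} {n : nat}.
Local Notation C := (Cplx R).
Local Notation conv := (@convergent R n).
Variables (d : 'I_n -> fps C 1) (i0 : 'I_n) (nu : nat).
Hypotheses (nu0 : (0 < nu)%N) (d0 : const0 d) (dc : forall i, convergent (d i))
  (di0 : d i0 = X1 ^+ nu).

Lemma kernel_prime : prime_of conv (kernel d).
Proof.
split.
- split=> [g []//|| f g [fc fd] [gc gd]|a f ac [fc fd]].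
  + by split; [exact: convergent0 | exact: fps_comp0].
  + by split; [exact: convergentD | rewrite fps_compD fd gd addr0].
  + by split; [exact: convergentM | rewrite (fps_compM _ _ d0) fd mulr0].
- by move=> [_ /eqP]; rewrite fps_comp1 oner_eq0.
- move=> f g fc gc [_]; rewrite (fps_compM _ _ d0) => /fps1_domain[fd|gd]; [left|right]; by split.
Qed.

Definition max_ideal : set (fps C n) := [set g | convergent g /\ g mnm0 = 0].

Lemma max_ideal_prime : prime_of conv max_ideal.
Proof.
split.
- split=> [g []//|| f g [fc f0] [gc g0]|a f ac [fc f0]].
  + by split; [exact: convergent0 |].
  + by split; [exact: convergentD | rewrite fpsD f0 g0 addr0].
  + by split; [exact: convergentM | rewrite fpsM0 f0 mulr0].
- by move=> [_ /eqP]; rewrite fps1E eqxx oner_eq0.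
- move=> f g fc gc [_ /eqP]; rewrite fpsM0 mulf_eq0 => /orP[] /eqP ?; [left|right]; by split.
Qed.

Lemma prime_sub_max P : prime_of conv P -> P `<=` max_ideal.
Proof.
move=> [[Pc _ _ PM] P1 _] f Pf; split; first exact: Pc.
apply/eqP/negPn/negP => f0; apply: P1.
rewrite -(fps_invE f0) mulrC; apply: PM => //; apply: convergent_inv => //; exact: Pc.
Qed.

Lemma chcoef_nu z (g : fps C 1) : chcoef nu z g nu = 1.
Proof.
rewrite /chcoef (chcoef_lead nu z g); apply: coef1P => k.
by rewrite coef1_ser !coef1_1 addn0 muln_eq0 -[nu == 0%N]negbK -lt0n nu0.
Qed.

Lemma prime_expr P f k : prime_of conv P -> convergent f -> P (f ^+ k) -> P f.
Proof.
move=> [_ P1 Pm] fc; elim: k => [|k IH]; first by rewrite expr0.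
by rewrite exprS => Pf; case: (Pm _ _ fc (convergentXn k fc) Pf).
Qed.

Lemma ideal_sum P (I : Type) (s : seq I) (F : I -> fps C n) : ideal_of conv P ->
  (forall i, P (F i)) -> P (\sum_(i <- s) F i).
Proof. by move=> [_ P0 PD _] PF; elim/big_rec: _ => // i x _; apply: PD. Qed.

Lemma ideal_subr P f g : ideal_of conv P -> P (f + g) -> P g -> P f.
Proof.
move=> [_ _ PD PM] Pfg Pg; rewrite -[f](addrK g); apply: PD => //.
rewrite -mulN1r; apply: PM => //; apply: convergentN; exact: convergent1.
Qed.

(** By Cayley-Hamilton, the characteristic polynomial of f o d evaluated at [f] lies in the kernel.
    Hence [P] contains its constant coefficient, a power of x_i0 times a unit, and so x_i0 itself.
    For any g with g(0) = 0, the same relation then shows that g^nu lies in [P], because all lower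
    coefficients are divisible by x_i0. *)
Lemma prime_above_kernel P f : prime_of conv P -> kernel d `<=` P -> P f -> ~ kernel d f ->
  max_ideal `<=` P.
Proof.
move=> Pp KP Pf Kf; have [Pid P1 Pm] := Pp; have [Pc P0 PD PM] := Pid.
have fc := Pc _ Pf; have [z zP] := @primitive_root_exists R nu nu0.
have chK G : convergent G -> P (chseries i0 nu z (fps_comp G d) G).
  move=> Gc; apply: KP; split; last exact: chseries_comp.
  by apply: convergent_chseries => //; exact: convergent_comp.
have bc G k : convergent G -> convergent (chcoef nu z (fps_comp G d) k).
  by move=> Gc; apply: convergent_chcoef => //; exact: convergent_comp.
have Px : P (fpsX i0).
  have fd : fps_comp f d <> 0 by move=> fd; apply: Kf.
  have := chK f fc; rewrite /chseries big_ord_recl expr0 mulr1 => Pch.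
  have Pb : P (lift i0 (chcoef nu z (fps_comp f d) 0)).
    apply: (ideal_subr Pid Pch); apply: ideal_sum => // i.
    rewrite exprS mulrCA mulrC; apply: PM => //.
    by apply: convergentM; [apply: convergent_lift; exact: bc | exact: convergentXn].
  have [k [u [bE u0]]] := fps1_order (chcoef0_neq0 nu0 zP fd).
  have uc : convergent u by apply: (@convergent_shift _ k); rewrite -bE; exact: bc.
  have u0' : lift i0 u mnm0 != 0 by rewrite lift_const0 -coef10; apply/eqP.
  apply: (@prime_expr P _ k) => //; first exact: convergentX.
  have Xkc : convergent (fpsX i0 ^+ k : fps C n) by apply: convergentXn; exact: convergentX.
  move: Pb; rewrite bE liftM lift_Xn => Pb.
  case: (Pm _ _ Xkc (convergent_lift i0 uc) Pb) => // Pu.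
   case: P1; rewrite -(fps_invE u0') mulrC; apply: PM => //.
  by apply: convergent_inv => //; exact: convergent_lift.
move=> g [gc g0]; apply: (@prime_expr P _ nu) => //.
have := chK g gc; rewrite /chseries big_ord_recr /= chcoef_nu lift1 mul1r addrC => Pch.
apply: (ideal_subr Pid Pch); apply: ideal_sum => // k.
set b := chcoef _ _ _ _.
have b0 : b mnm0 = 0 by apply: chcoef_lt0 => //; rewrite fps_comp_const.
pose b' := ser (fun j => coef1 b j.+1).
have bE : b = X1 ^+ 1 * b'.
  apply: coef1P => j; rewrite expr1 coef1_XM; case: j => [|j]; last by rewrite [RHS]coef1_ser.
  by rewrite coef10.
have b'c : convergent b' by apply: (@convergent_shift _ 1); rewrite -bE; exact: bc.
rewrite bE expr1 liftM lift_X1 -mulrA mulrC; apply: PM => //.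
by apply: convergentM; [exact: convergent_lift | exact: convergentXn].
Qed.

(** The second prime of a chain of length 2 would already contain the maximal ideal, which leaves no
    room for a third. *)
Lemma kernel_dim : quotient_dim conv (kernel d) 1.
Proof.
have Km : kernel d `<=` max_ideal by apply: prime_sub_max; exact: kernel_prime.
split.
  exists (fun i => if i is 0%N then kernel d else max_ideal); split=> -[|i] //= _.
  - by split=> //; exact: kernel_prime.
  - by split=> //; exact: max_ideal_prime.
  split=> // /(_ (fpsX i0)) H; have [|_] := H.
    by split; [exact: convergentX | rewrite /fpsX eq_sym mnm1_eq0].
  rewrite fps_compX // di0 => /(congr1 (fun f => coef1 f nu)).
  by rewrite coef1_Xn eqxx coef1_0 => /eqP; rewrite oner_eq0.
move=> [P [Pp Ps]].
have [P0 K0] := Pp 0%N isT; have [P1 K1] := Pp 1%N isT; have [P2 _] := Pp 2%N isT.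
have [P01 NP01] := Ps 0%N isT; have [P12 NP12] := Ps 1%N isT.
apply: NP12; apply: subset_trans (prime_sub_max P2) _.
have [f Pf Kf] : exists2 f, P 1%N f & ~ kernel d f.
  apply: contrapT => H; apply: NP01 => f Pf; apply: K0; apply: contrapT => Kf.
  by apply: H; exists f.
exact: prime_above_kernel Pf Kf.
Qed.

End KernelIdeal.

(** * The curve as an analytic set *)

Section LinearForms.
Context {R : realType} {n : nat}.
Local Notation C := (Cplx R).

Definition lform (t : nat) (y : 'rV[C]_n) : C := \sum_(i < n) t%:R ^+ i * y 0 i.

Lemma lformB t y w : lform t (y - w) = lform t y - lform t w.
Proof. by rewrite /lform -sumrB; apply: eq_bigr => i _; rewrite !mxE mulrBr. Qed.

(* [n] of the forms [lform t] have an invertible Vandermonde matrix. *)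
Lemma lform_bound (N : nat) : exists2 K : R, 0 <= K & forall (f : 'I_n -> 'I_N) (y : 'rV[C]_n) (e : R),
  injective f -> 0 <= e -> (forall j, ab (lform (f j) y) <= e) -> forall i, ab (y 0 i) <= K * e.
Proof.
pose V (f : {ffun 'I_n -> 'I_N}) : 'M[C]_n := Vandermonde n (\row_j (f j)%:R).
(* Summing over all choices of [n] forms makes the constant independent of [f]. *)
exists (\sum_(f : {ffun 'I_n -> 'I_N}) \sum_i \sum_j ab (invmx (V f) j i)).
  by do 3 (apply: sumr_ge0 => ? _); apply: ab_ge0.
move=> f y e finj e0 fy i; pose f' := [ffun j => f j].
have Vu : V f' \in unitmx.
  rewrite unitmxE det_Vandermonde unitfE; apply/prodf_neq0 => a _; apply/prodf_neq0 => b ab_.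
  rewrite !mxE !ffunE subr_eq0 eqr_nat; apply/eqP => /val_inj /finj ba.
  by rewrite ba ltnn in ab_.
have yE : y 0 i = \sum_j lform (f j) y * invmx (V f') j i.
  rewrite -{1}[y](mulmxK Vu) mxE; apply: eq_bigr => j _; congr (_ * _).
  by rewrite mxE; apply: eq_bigr => a _; rewrite !mxE ffunE mulrC.
rewrite yE; apply: le_trans (ab_sum _ _ _) _.
apply: (@le_trans _ _ ((\sum_j ab (invmx (V f') j i)) * e)).
  rewrite mulr_suml; apply: ler_sum => j _; rewrite abM mulrC.
  by rewrite ler_wpM2l ?ab_ge0.
rewrite ler_wpM2r // [leRHS](bigD1 f') //= [X in _ <= X + _](bigD1 i) //= -addrA lerDl addr_ge0 //.
  by do 2 (apply: sumr_ge0 => ? _); apply: ab_ge0.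
by do 3 (apply: sumr_ge0 => ? _); apply: ab_ge0.
Qed.

(* By the pigeonhole principle some [y j] is close to [z] along at least [n] forms. *)
Lemma product_bound (nu : nat) : (0 < nu)%N -> exists2 K : R, 0 <= K &
  forall (y : 'I_nu -> 'rV[C]_n) (z : 'rV[C]_n) (e : R), 0 <= e ->
    (forall t : 'I_(nu * n).+1, ab (\prod_j lform t (z - y j)) <= e ^+ nu) ->
  exists j, forall i, ab (z 0 i - y j 0 i) <= K * e.
Proof.
move=> nu0; have [K K0 KP] := lform_bound (nu * n).+1; exists K => // y z e e0 yz.
(* A product of [nu] factors of modulus at most e^nu has a factor of modulus at most e, but its
   index depends on [t]. *)
have close (t : 'I_(nu * n).+1) : exists j, ab (lform t (z - y j)) <= e.
  apply: contrapT => /forallNP H.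
  have := yz t; rewrite ab_prod leNgt => /negP; apply.
  have -> : e ^+ nu = \prod_(j < nu) e by rewrite prodr_const card_ord.
  apply: ltr_prod => [|j _]; first by apply/hasP; exists (Ordinal nu0) => //; rewrite mem_index_enum.
  by rewrite e0 /= ltNge; apply/negP; apply: H.
pose J t := projT1 (cid (close t)).
have JP (t : 'I_(nu * n).+1) : ab (lform t (z - y (J t))) <= e by rewrite /J; case: cid.
have [j nj] : exists j, (n <= #|[pred t | J t == j]|)%N.
  apply: contrapT => /forallNP H.
  have : (\sum_(t < (nu * n).+1) 1 <= \sum_(j < nu) n)%N.
    rewrite (partition_big J xpredT) //=; apply: leq_sum => j _.
    rewrite sum1_card; have /negP := H j; rewrite -ltnNge => /ltnW; apply: leq_trans.
    by rewrite leq_eqVlt; apply/orP; left; apply/eqP/eq_card => t.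
  by rewrite sum1_card card_ord sum_nat_const card_ord ltnn.
exists j; pose A := [pred t | J t == j].
pose f (i : 'I_n) : 'I_(nu * n).+1 := enum_val (widen_ord nj i).
have finj : injective f by move=> a b /enum_val_inj /(congr1 val) /= /val_inj.
move=> i; suff fe l : ab (lform (f l) (z - y j)) <= e.
  by have := KP f (z - y j) e finj e0 fe i; rewrite !mxE.
have : f l \in A by apply: enum_valP.
by rewrite inE => /eqP <-; apply: JP.
Qed.

End LinearForms.

Section CurveSet.
Context {R : realType} {n : nat}.
Local Notation C := (Cplx R).
Variables (d : 'I_n -> fps C 1) (i0 : 'I_n) (nu : nat) (zeta : C).
Hypotheses (nu0 : (0 < nu)%N) (d0 : const0 d) (dc : forall i, convergent (d i))
  (di0 : d i0 = X1 ^+ nu) (zP : nu.-primitive_root zeta).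

Definition lser t : fps C n := \sum_(i < n) fpsC (t%:R ^+ i) * fpsX i.
Definition lcurve t : fps C 1 := fps_comp (lser t) d.

(* Near the curve, [eqn t] is the norm of [lform t z - lform t (cpt d s)] over [s ^+ nu = z 0 i0]. *)
Definition eqn_ser t : fps C n := chseries i0 nu zeta (lcurve t) (lser t).
Definition eqn t (z : 'rV[C]_n) : C :=
  \sum_(k < nu.+1) ev1 (chcoef nu zeta (lcurve t) k) (z 0 i0) * lform t z ^+ k.

Lemma convergent_lser t : convergent (lser t).
Proof. by apply: convergent_sum => i _; apply: convergentM; [exact: convergentC | exact: convergentX]. Qed.

Lemma convergent_lcurve t : convergent (lcurve t).
Proof. by apply: convergent_comp => //; exact: convergent_lser. Qed.

Lemma ev_lser t z : ev (lser t) z = lform t z.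
Proof.
have [r r0 zr] := pdisc_exists z.
have cX i : cv r (fpsX i : fps C n) by apply: cvX.
rewrite (ev_sum _ r0) // => [|i _]; last by apply: cvM => //; exact: cvC.
apply: eq_bigr => i _; rewrite (evM r0 (cvC _ _) (cX i) zr) evC evX //.
Qed.

Lemma eqn_kernel t : kernel d (eqn_ser t).
Proof.
split; last exact: chseries_comp.
by apply: convergent_chseries => //; [exact: convergent_lcurve | exact: convergent_lser].
Qed.

Lemma ev1_Xn k (x : C) : ev1 (X1 ^+ k) x = x ^+ k.
Proof.
have r0 : 0 <= 2 * ab x by rewrite mulr_ge0 // ab_ge0.
have xr : pdisc (2 * ab x / 2) (const_mx x : 'rV[C]_1).
  by apply: pdisc1; rewrite mulrC mulKf.
by rewrite /ev1 (evXn _ r0 _ xr) ?evX ?mxE //; apply: cvX.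
Qed.

Lemma ev1_comp (f g : fps C 1) : convergent f -> convergent g -> g mnm0 = 0 ->
  small1 (fun x => ev1 (fps_comp f (fun=> g)) x = ev1 f (ev1 g x)).
Proof.
move=> fc gc g0; have := ev1_comp_curve (const0_1 g0) fc (fun=> gc).
apply: small1_imp => x ->; congr ev; apply/rowP => j; rewrite !mxE //.
Qed.

Lemma ev1_rot (z : C) (f : fps C 1) : convergent f -> small1 (fun x => ev1 (rot z f) x = ev1 f (z * x)).
Proof.
move=> fc; have zXc : convergent (fpsC z * X1) by apply: convergentM; [exact: convergentC | exact: convergentX].
have zX0 : (fpsC z * X1 : fps C 1) mnm0 = 0 by rewrite fpsC_mul X1_0 mulr0.
have := ev1_comp fc zXc zX0; apply: small1_imp => x; rewrite -/(rot z f) => ->; congr ev1.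
have r0 : 0 <= 2 * ab x by rewrite mulr_ge0 // ab_ge0.
have xr : pdisc (2 * ab x / 2) (const_mx x : 'rV[C]_1) by apply: pdisc1; rewrite mulrC mulKf.
by rewrite /ev1 (evM r0 (cvC _ _) (cvX _ r0) xr) evC evX mxE.
Qed.

(** Evaluates at s the factorization of the characteristic polynomial: the j-th conjugate of the
    form along the curve is its value at the point of parameter zeta^j s, and these points are the
    ones over x = s^nu. *)
Lemma eqn_product t : small1 (fun s => forall z : 'rV[C]_n, z 0 i0 = s ^+ nu ->
  eqn t z = \prod_(j < nu) lform t (z - cpt d (zeta ^+ j * s))).
Proof.
pose g := lcurve t; have gc : convergent g := convergent_lcurve t.
pose F (k : 'I_nu.+1 + 'I_nu) := match k with inl k => (charpoly nu zeta g)`_k | inr j => rot (zeta ^+ j) g end.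
have Fc k : convergent (F k).
  case: k => k /=; last exact: convergent_rot.
  by rewrite -chcoefE //; apply: convergent_comp; [exact: const0_Xn | exact: convergent_chcoef | move=> _; apply: convergentXn; exact: convergentX].
have [r r0 Fr] := convergent_cvs Fc.
have S1 : small1 (fun s => forall k : 'I_nu.+1, ev1 (charpoly nu zeta g)`_k s = ev1 (chcoef nu zeta g k) (s ^+ nu)).
  apply: small1_all => k.
  have Xc : convergent (X1 ^+ nu : fps C 1) by apply: convergentXn; exact: convergentX.
  have X0 : (X1 ^+ nu : fps C 1) mnm0 = 0 by exact: (const0_Xn nu0 ord0).
  have := ev1_comp (convergent_chcoef zeta nu0 k gc) Xc X0.
  by apply: small1_imp => s; rewrite chcoefE // ev1_Xn.
have S2 : small1 (fun s => forall j : 'I_nu, ev1 (rot (zeta ^+ j) g) s = lform t (cpt d (zeta ^+ j * s))).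
  apply: small1_all => j.
  have [e e0 eP] := ev1_comp_curve d0 (convergent_lser t) dc.
  have [e' e'0 eP'] := ev1_rot (zeta ^+ j) gc.
  have z1 : ab (zeta ^+ j) = 1.
    apply/eqP; rewrite -(@pexpr_eq1 _ _ nu) ?ab_ge0 // -abX -exprM mulnC exprM.
    by rewrite (prim_expr_order zP) expr1n ab1.
  exists (Num.min e e'); first exact: min_gt0.
  have /andP[_ ml] := min_boundl e0 e'0; have /andP[_ mr] := min_boundr e0 e'0.
  move=> s se; rewrite eP'; last exact: le_trans mr.
  by rewrite eP ?ev_lser // abM z1 mul1r; apply: le_trans ml.
have S3 : small1 (fun s => ab s <= r / 2) by exists (r / 2); first by rewrite divr_gt0.
apply: small1_imp (small1_and S3 (small1_and S1 S2)) => s [sr [E1 E2]] z zs.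
have sr' := pdisc1 sr.
have fr (k : 'I_nu.+1) : cv r (charpoly nu zeta g)`_k by exact: (Fr (inl k)).
have fr' (j : 'I_nu) : cv r (rot (zeta ^+ j) g) by exact: (Fr (inr j)).
(* The variable of the polynomial is specialized to the constant series with value [lform t z],
   which keeps the whole identity in one variable. *)
have := congr1 (fun f => ev1 f s) (horner_charpoly nu zeta g (fpsC (lform t z))).
have r0' := ltW r0; have yr := cvC r (lform t z) : cv r (fpsC (lform t z) : fps C 1).
rewrite /ev1 (ev_sum _ r0' _ sr') => [|k _]; last by apply: cvM => //; exact: cvXn.
rewrite (ev_prod _ r0' _ sr') => [|j _]; last exact: cvB.
have -> : eqn t z = \sum_(k < nu.+1) ev ((charpoly nu zeta g)`_k * fpsC (lform t z) ^+ k) (const_mx s).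
  apply: eq_bigr => k _; rewrite (evM r0' (fr k) (cvXn _ r0' yr) sr') (evXn _ r0' yr sr') evC.
  by rewrite -/(ev1 _ s) E1 zs.
move=> ->; apply: eq_bigr => j _.
by rewrite (evB r0' yr (fr' j) sr') evC -/(ev1 _ s) E2 lformB.
Qed.

Lemma eqn_ev t : small (fun z => ev (eqn_ser t) z = eqn t z).
Proof.
pose b k := chcoef nu zeta (lcurve t) k.
have bc k : convergent (b k) by apply: convergent_chcoef => //; exact: convergent_lcurve.
have [r1 r10 lr] := iffLR (convergentP (lser t)) (convergent_lser t).
pose L (k : 'I_nu.+1) := lift i0 (b k).
have Lc k : convergent (L k) by exact: convergent_lift.
have [r2 r20 Lr] := convergent_cvs Lc.
have S1 : small (fun z => forall k : 'I_nu.+1, ev (lift i0 (b k)) z = ev1 (b k) (z 0 i0)).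
  apply: small_all => k.
  have [r r0 /(_ r)] := ev_comp_near (const0_X i0) (bc k) (fun=> convergentX i0).
  rewrite r0 lexx => /(_ isT)[_ H]; exists (r / 2); first by rewrite divr_gt0.
  move=> z zr; rewrite /lift H //; congr ev; apply/rowP => j; rewrite !mxE evX //.
have m0 := min_gt0 r10 r20.
have S2 : small (pdisc (Num.min r1 r2 / 2) : 'rV[C]_n -> Prop).
  by exists (Num.min r1 r2 / 2); first by rewrite divr_gt0.
apply: small_imp (small_and S1 S2) => z [E zr].
have lr' : cv (Num.min r1 r2) (lser t) by apply: cv_ler lr; apply: min_boundl.
have Lr' k : cv (Num.min r1 r2) (L k) by apply: cv_ler (Lr k); apply: min_boundr.
have m0' := ltW m0.
rewrite /eqn_ser /chseries (ev_sum _ m0' _ zr) => [|k _]; last first.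
  exact: (cvM m0' (Lr' k) (cvXn k m0' lr')).
apply: eq_bigr => k _; rewrite (evM m0' (Lr' k) (cvXn _ m0' lr') zr) (evXn _ m0' lr' zr).
by rewrite E ev_lser.
Qed.

(** The equations are polynomials in linear forms with coefficients depending on x alone, so only
    the coordinate [i0] has to be small. *)
Lemma eqn_holomorphic : small1 (fun x => forall (t : 'I_(nu * n).+1) (a : 'rV[C]_n), a 0 i0 = x -> holomorphic_at (eqn t) a).
Proof.
apply: small1_all => t.
have bc k : convergent (chcoef nu zeta (lcurve t) k) by apply: convergent_chcoef => //; exact: convergent_lcurve.
have : small1 (fun x => forall k : 'I_nu.+1, hol1 (ev1 (chcoef nu zeta (lcurve t) k)) x).
  apply: small1_all => k; have /convergentP[r r0 br] := bc k.
  exists (r / 4); first by rewrite divr_gt0.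
  by move=> x xr; apply: hol1_ev1 br xr.
apply: small1_imp => x H a ax.
apply: holomorphic_sum => k; apply: holomorphicM.
  by apply: (@hol1_coord _ _ (ev1 (chcoef nu zeta (lcurve t) k))); rewrite ax.
apply: holomorphicXn; apply: holomorphic_sum => i; apply: holomorphicM; first exact: holomorphicC.
exact: holomorphicX.
Qed.

(** As x = s^nu along the curve, the first condition says exactly [ab s < rho]. *)
Definition box (rho e : R) : set 'rV[C]_n :=
  [set z | ab (z 0 i0) < rho ^+ nu /\ forall i, ab (z 0 i) < e].

Definition arc (rho : R) : set 'rV[C]_n := [set z | exists2 s, ab s < rho & z = cpt d s].

Lemma box_open rho e : open (box rho e).
Proof.
apply/open_rVP => a [a0 ae].
have ge0 : 0 < rho ^+ nu - ab (a 0 i0) by rewrite subr_gt0.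
pose g := \big[Num.min/(rho ^+ nu - ab (a 0 i0))]_i (e - ab (a 0 i)).
exists g; first by apply: lt_bigmin => // i _; rewrite subr_gt0.
move=> z zg; split=> [|i].
  have g1 : g <= rho ^+ nu - ab (a 0 i0) by apply: bigmin_le_id.
  have := zg i0; have := ab_tri (a 0 i0) (z 0 i0) 0; rewrite !subr0; lra.
have g1 : g <= e - ab (a 0 i) by apply: (bigmin_le_cond _ (fun i => e - ab (a 0 i))).
have := zg i; have := ab_tri (a 0 i) (z 0 i) 0; rewrite !subr0; lra.
Qed.

Lemma cpt_i0 s : cpt d s 0 i0 = s ^+ nu.
Proof. by rewrite cptE di0 ev1_Xn. Qed.

Lemma ab_zeta j : ab (zeta ^+ j) = 1.
Proof.
apply/eqP; rewrite -(@pexpr_eq1 _ _ nu) ?ab_ge0 // -abX -exprM mulnC exprM.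
by rewrite (prim_expr_order zP) expr1n ab1.
Qed.

Lemma root_exists (x : C) : exists s, s ^+ nu = x.
Proof. by exists (nu.-root x); rewrite rootCK. Qed.

Lemma ab_root (s : C) (rho : R) : 0 <= rho -> (ab s ^+ nu < rho ^+ nu) = (ab s < rho).
Proof. by move=> rho0; rewrite ltr_pXn2r // nnegrE ab_ge0. Qed.

Lemma ab_root_le (s : C) (rho : R) : 0 <= rho -> (ab s ^+ nu <= rho ^+ nu) = (ab s <= rho).
Proof. by move=> rho0; rewrite ler_pXn2r // nnegrE ab_ge0. Qed.

(** Combines the factorization of the equations with the choice of a common nearest point. Each
    equation is a product of [nu] factors, whence the bound e^nu for a distance of order e. *)
Lemma eqn_close : exists2 K : R, 0 <= K & small1 (fun s => forall (z : 'rV[C]_n) (e : R),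
  z 0 i0 = s ^+ nu -> 0 <= e -> (forall t : 'I_(nu * n).+1, ab (eqn t z) <= e ^+ nu) ->
  exists2 s', s' ^+ nu = s ^+ nu & forall i, ab (z 0 i - cpt d s' 0 i) <= K * e).
Proof.
have [K K0 KP] := @product_bound R n nu nu0; exists K => //.
have : small1 (fun s => forall t : 'I_(nu * n).+1, forall z : 'rV[C]_n, z 0 i0 = s ^+ nu ->
  eqn t z = \prod_(j < nu) lform t (z - cpt d (zeta ^+ j * s))).
  by apply: small1_all => t; exact: eqn_product.
apply: small1_imp => s E z e zs e0 ze.
have ze' (t : 'I_(nu * n).+1) : ab (\prod_(j < nu) lform t (z - cpt d (zeta ^+ j * s))) <= e ^+ nu.
  by rewrite -E.
have [j jP] := KP (fun j : 'I_nu => cpt d (zeta ^+ j * s)) z e e0 ze'.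
exists (zeta ^+ j * s) => //.
by rewrite exprMn -exprM mulnC exprM (prim_expr_order zP) expr1n mul1r.
Qed.

Lemma arc_equations (e : R) : 0 < e -> exists2 rho0 : R, 0 < rho0 & forall rho, 0 < rho <= rho0 ->
  [/\ arc rho `<=` box rho e,
      forall z, box rho e z -> (arc rho z <-> forall t : 'I_(nu * n).+1, eqn t z = 0)
    & forall (t : 'I_(nu * n).+1) a, box rho e a -> holomorphic_at (eqn t) a].
Proof.
move=> e0; have [K K0 KS] := eqn_close.
have S1 : small1 (fun s => forall t : 'I_(nu * n).+1, forall z : 'rV[C]_n, z 0 i0 = s ^+ nu ->
  eqn t z = \prod_(j < nu) lform t (z - cpt d (zeta ^+ j * s))).
  by apply: small1_all => t; exact: eqn_product.
have S2 : small1 (fun s => forall i, ab (cpt d s 0 i) < e).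
  have := @small_curve R n d (fun z => pdisc (e / 2) z) d0 dc.
  move=> H; apply: small1_imp (H _) => [s se i|]; first by apply: le_lt_trans (se i) _; lra.
  by exists (e / 2) => //; rewrite divr_gt0.
have [dd dd0 D] := small1_and S1 (small1_and S2 KS).
have [h h0 Hh] := eqn_holomorphic.
have [h' h'0 h'h] : exists2 h', 0 < h' & h' ^+ nu <= h.
  exists (Num.min 1 h); first exact: min_gt0.
  have /andP[m0 m1] := min_boundl ltr01 h0; have /andP[_ m2] := min_boundr ltr01 h0.
  by apply: le_trans m2; rewrite -[leRHS]expr1; apply: ler_wiXn2l.
exists (Num.min dd h'); first exact: min_gt0.
have /andP[_ ml] := min_boundl dd0 h'0; have /andP[_ mr] := min_boundr dd0 h'0.
move=> rho /andP[rho0 rhod].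
have rho0' := ltW rho0.
have Ds s : ab s < rho -> ab s <= dd by move=> /ltW sr; apply: le_trans sr (le_trans rhod ml).
split.
- move=> _ [s sr ->]; have [_ [se _]] := D s (Ds s sr); split=> //.
  by rewrite cpt_i0 abX ab_root.
- move=> z [z0 ze]; split=> [[s sr zE] t|zt].
    have [E _] := D s (Ds s sr); rewrite (E t z); last by rewrite zE cpt_i0.
    rewrite (bigD1 (Ordinal nu0)) //= expr0 mul1r -zE subrr.
    by rewrite /lform big1 ?mul0r // => i _; rewrite mxE mulr0.
  have [s sE] := root_exists (z 0 i0).
  have sr : ab s < rho by rewrite -ab_root // -abX sE.
  have [_ [_ H]] := D s (Ds s sr).
  (* With error 0 the point coincides with one of the points of the curve over the same x, whose
     parameter has the modulus of [s]. *)
  have [|s' s's zs'] := H z 0 (esym sE) (lexx 0).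
    by move=> t; rewrite zt ab0 exprn_ge0.
  exists s'; first by rewrite -ab_root // -abX s's abX ab_root.
  apply/rowP => i; apply/eqP; rewrite -subr_eq0; apply/eqP/ab_le0.
  by have := zs' i; rewrite mulr0.
- move=> t a [a0 _]; apply: (Hh (a 0 i0)) => //.
  apply: le_trans (ltW a0) (le_trans _ h'h).
  by apply: lerXn2r; rewrite ?nnegrE ?(ltW h'0) //; apply: le_trans rhod mr.
Qed.

(** Points of the arc close to 0 have small parameters, because the coordinate [i0] is s^nu; hence
    the germ does not depend on [rho]. Conversely, a series vanishing on the arc vanishes along [d]
    by the identity theorem. *)
Lemma germ_ideal_arc (rho : R) : 0 < rho -> germ_ideal (arc rho) = kernel d.
Proof.
move=> rho0; apply/seteqP; split=> g [gc gB]; split=> //.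
  have gdc : convergent (fps_comp g d) by exact: convergent_comp.
  have /nbhs0P[e e0 eP] := gB.
  have S : small1 (fun s => forall i, ab (cpt d s 0 i) < e).
    have := @small_curve R n d (fun z => pdisc (e / 2) z) d0 dc.
    move=> H; apply: small1_imp (H _) => [s se i|]; first by apply: le_lt_trans (se i) _; lra.
    by exists (e / 2) => //; rewrite divr_gt0.
  have [dd dd0 D] := small1_and S (ev1_comp_curve d0 gc dc).
  have rho2 : 0 < rho / 2 by rewrite divr_gt0.
  apply: (ev1_eq0 gdc (min_gt0 dd0 rho2)) => s sm.
  have /andP[_ ml] := min_boundl dd0 rho2; have /andP[_ mr] := min_boundr dd0 rho2.
  have [se sE] := D s (le_trans sm ml).
  rewrite sE; apply: ev_eq; apply/seq_cvgP; apply: eP => //.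
  by exists s => //; have := le_trans sm mr; lra.
have [dd dd0 D] := ev1_comp_curve d0 gc dc.
have /convergentP[r r0 gr] := gc.
apply/nbhs0P; exists (Num.min (dd ^+ nu) (r / 2)); first by rewrite min_gt0 ?exprn_gt0 // divr_gt0.
have ddn : 0 < dd ^+ nu by rewrite exprn_gt0.
have r2 : 0 < r / 2 by rewrite divr_gt0.
have /andP[_ ml] := min_boundl ddn r2; have /andP[_ mr] := min_boundr ddn r2.
move=> z zm [s sr zE]; apply/seq_cvgP.
have zr : pdisc (r / 2) z by move=> i; apply: le_trans (ltW (zm i)) mr.
have sd : ab s <= dd.
  by have := zm i0; rewrite zE cpt_i0 abX => sm; rewrite -ab_root_le ?(ltW dd0) //; apply: le_trans (ltW sm) ml.
have := psum_cvg (ltW r0) gr zr; rewrite {2}zE -(D s sd) gB.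
by have -> : ev1 (0 : fps C 1) s = 0 by exact: ev_0.
Qed.

End CurveSet.

Section OneVariableClosure.
Context {R : realType}.
Local Notation C := (Cplx R).
Implicit Types (f g : C -> C) (x c : C).

Lemma hol1C c x : hol1 (fun=> c) x. Proof. exact: holomorphicC. Qed.
Lemma hol1_id x : hol1 id x. Proof. exact: (holomorphicX 0). Qed.
Lemma hol1D f g x : hol1 f x -> hol1 g x -> hol1 (fun y => f y + g y) x.
Proof. exact: holomorphicD. Qed.
Lemma hol1B f g x : hol1 f x -> hol1 g x -> hol1 (fun y => f y - g y) x.
Proof. exact: holomorphicB. Qed.
Lemma hol1M f g x : hol1 f x -> hol1 g x -> hol1 (fun y => f y * g y) x.
Proof. exact: holomorphicM. Qed.
End OneVariableClosure.

Section Arc.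
Context {R : realType} {n : nat}.
Local Notation C := (Cplx R).
Variables (d : 'I_n -> fps C 1) (i0 : 'I_n) (nu : nat) (zeta : C).
Hypotheses (nu0 : (0 < nu)%N) (d0 : const0 d) (dc : forall i, convergent (d i))
  (di0 : d i0 = X1 ^+ nu) (zP : nu.-primitive_root zeta).
Local Notation eqn := (eqn d i0 nu zeta).
Local Notation arc := (arc d).
Local Notation box := (box i0 nu).

Lemma open_ball (a : 'rV[C]_n) (e : R) : open [set z : 'rV[C]_n | forall i, ab (z 0 i - a 0 i) < e].
Proof.
apply/open_rVP => b ba.
pose g := \big[Num.min/1]_i (e - ab (b 0 i - a 0 i)).
exists g; first by apply: lt_bigmin => // i _; rewrite subr_gt0.
move=> z zg i; have g1 : g <= e - ab (b 0 i - a 0 i) by apply: (bigmin_le_cond _ (fun i => e - ab (b 0 i - a 0 i))).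
have := zg i; have := ab_tri (b 0 i) (z 0 i) (a 0 i); lra.
Qed.

Lemma open_setD0 : open (~` [set (0 : 'rV[C]_n)]).
Proof.
apply/open_rVP => a a0.
have [i ai] : exists i, a 0 i != 0.
  apply: contrapT => /forallNP H; apply: a0; apply/rowP => i; rewrite mxE.
  by apply/eqP/negPn/negP; exact: H.
exists (ab (a 0 i)); first by rewrite ab_gt0.
move=> z zg z0; have := zg i; rewrite z0 mxE sub0r abN; lra.
Qed.

Section GoodRadius.
Variables (rho e : R).
Hypotheses (rho0 : 0 < rho) (arc_box : arc rho `<=` box rho e)
  (arcE : forall z, box rho e z -> (arc rho z <-> forall t : 'I_(nu * n).+1, eqn t z = 0))
  (eqn_hol : forall (t : 'I_(nu * n).+1) a, box rho e a -> holomorphic_at (eqn t) a).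

(** The arc is relatively closed in the box, by continuity of its equations. Local closedness and
    the final limit along orbits both use this form. *)
Lemma arc_limit z : box rho e z ->
  (forall h : R, 0 < h -> exists2 w, arc rho w & forall i, ab (w 0 i - z 0 i) <= h) -> arc rho z.
Proof.
move=> bz zw; apply/(arcE bz) => t; apply: ab_le0; rewrite leNgt; apply/negP => t0.
have t2 : 0 < ab (eqn t z) / 2 by rewrite divr_gt0.
have [h h0 hP] := holomorphic_cont (eqn_hol t bz) t2.
have [w aw wz] := zw _ h0.
have := hP w wz; have /(arcE (arc_box aw)) -> := aw.
rewrite sub0r abN; lra.
Qed.

Lemma arc0 : arc rho 0.
Proof. by exists 0; rewrite ?ab0 // (cpt0 d0). Qed.

Lemma arc_irreducible : irreducible_curve_germ (arc rho).
Proof.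
split.
- exists (box rho e), (nu * n).+1, (fun t => eqn t); split.
  + exact: box_open.
  + exact/arc_box/arc0.
  + by move=> t a /eqn_hol.
  + by move=> z /arcE.
- by rewrite (germ_ideal_arc nu0 d0 dc di0 rho0); apply: kernel_prime.
- by rewrite (germ_ideal_arc nu0 d0 dc di0 rho0); apply: (@kernel_dim _ _ _ i0 nu).
Qed.

Lemma arc_represents Gamma : parametrizes d Gamma -> represents (arc rho) Gamma.
Proof.
move=> [_ dG]; split; first exact: arc_irreducible.
rewrite (germ_ideal_arc nu0 d0 dc di0 rho0); apply/seteqP; split=> g.
  by move=> /dG gd; exact: (kernel_generates nu0 d0 dc di0 gd).
move=> [k [a [b [bK ->]]]]; apply/dG; rewrite fps_comp_sum big1 // => i _.
by rewrite (fps_compM _ _ d0) (bK i).2 mulr0.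
Qed.

Lemma arc_locally_closed O : open O -> locally_closed (arc rho `&` O).
Proof.
move=> Oo; exists (box rho e `&` O), (closure (arc rho)); split.
- by apply: openI => //; exact: box_open.
- exact: closed_closure.
- apply/seteqP; split=> z.
    by move=> [az Oz]; split; [split=> //; exact: arc_box | exact: subset_closure].
  move=> [[bz Oz] cz]; split=> //; apply: (arc_limit bz) => h h0.
  have [w [aw wz]] : arc rho `&` [set w : 'rV[C]_n | forall i, ab (w 0 i - z 0 i) < h] !=set0.
    apply: cz; apply: open_nbhs_nbhs; split; first exact: open_ball.
    by move=> i /=; rewrite subrr ab0.
  by exists w => // i; apply: ltW.
Qed.
End GoodRadius.

Lemma small1_radius (P : C -> Prop) : small1 P -> exists2 r : R, 0 < r & forall x, ab x < r -> P x.
Proof. by move=> [r r0 rP]; exists r => // x /ltW; apply: rP. Qed.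

Lemma small1_near (f : C -> C) x (e : R) : hol1 f x -> 0 < e ->
  small1 (fun y => ab (f (x + y) - f x) <= e).
Proof.
move=> fx e0; have [h h0 hP] := hol1_cont fx e0; exists h => // y yh.
by apply: hP; rewrite addrC addKr.
Qed.

(** The branch is s0 (1 + w(x / s0^nu - 1)), where 1 + w is the binomial series of (1 + X)^(1/nu).
    For nu = 1 it is the identity, which also covers s0 = 0. *)
Lemma root_branch (s0 : C) : s0 != 0 \/ nu = 1%N -> exists root : C -> C,
  root (s0 ^+ nu) = s0 /\ small1 (fun y => hol1 root (s0 ^+ nu + y) /\ root (s0 ^+ nu + y) ^+ nu = s0 ^+ nu + y).
Proof.
case=> [s00|->]; last first.
  exists id; split; first by rewrite expr1.
  exists 1 => // y _; rewrite !expr1; split=> //.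
  exact: hol1_id.
have x00 : s0 ^+ nu != 0 by rewrite expf_neq0.
have nuC : nu%:R != 0 :> C by rewrite pnatr_eq0 -lt0n.
have [w [w0 wE]] := fps1_root nuC (X1_0 : X1 mnm0 = 0 :> C).
have wc : convergent w := (convergent_root nu0 (convergentX _) X1_0 w0 wE).
have /convergentP[r r0 wr] := wc; have r0' := ltW r0.
have wX u : ab u <= r / 2 -> (1 + ev1 w u) ^+ nu = 1 + u.
  move=> /pdisc1 ur; have := congr1 (fun f => ev1 f u) wE.
  have c1 : cv r (1 : fps C 1) by apply: cv1.
  have cX : cv r (X1 : fps C 1) by apply: cvX.
  by rewrite /ev1 (evXn _ r0' (cvD r0' c1 wr) ur) (evD r0' c1 wr ur) (evD r0' c1 cX ur) ev_1 evX mxE.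
exists (fun x => s0 * (1 + ev1 w (x / s0 ^+ nu - 1))); split.
  by rewrite divff // subrr /ev1 -[const_mx 0]/(0 : 'rV[C]_1) ev0 w0 addr0 mulr1.
exists (r / 4 * ab (s0 ^+ nu)); first by rewrite mulr_gt0 ?ab_gt0 // divr_gt0.
move=> y yr.
have E : (s0 ^+ nu + y) / s0 ^+ nu - 1 = y / s0 ^+ nu by field.
have ur : ab (y / s0 ^+ nu) <= r / 4 by rewrite abM abV ler_pdivrMr ?ab_gt0.
split; last first.
  rewrite exprMn E wX; last by apply: le_trans ur _; lra.
  by field.
have h1 : hol1 (fun x => ev1 w (x / s0 ^+ nu - 1)) (s0 ^+ nu + y).
  apply: (@hol1_comp _ (ev1 w) (fun x => x / s0 ^+ nu - 1)).
    by rewrite E; apply: hol1_ev1 wr ur.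
  exact: (hol1B (hol1M (hol1_id _) (hol1C _ _)) (hol1C _ _)).
exact: (hol1M (hol1C _ _) (hol1D (hol1C _ _) h1)).
Qed.

Lemma open_holomorphic (I : finType) (P : set 'rV[C]_n) (f : I -> 'rV[C]_n -> C) (e : R) :
    open P -> (forall a, P a -> forall i, holomorphic_at (f i) a) ->
  open [set z | P z /\ forall i, ab (f i z) < e].
Proof.
move=> Po fh; apply/open_rVP => a [Pa fa].
have [e1 e10 Pe] := iffLR (open_rVP P) Po a Pa.
have S : small (fun z : 'rV[C]_n => forall i, ab (f i (a + z)) < e).
  apply: small_all => i; have ei : 0 < (e - ab (f i a)) / 2 by rewrite divr_gt0 // subr_gt0.
  have [h h0 hP] := holomorphic_cont (fh a Pa i) ei; exists h => // z zh.
  have := hP (a + z); have := fa i; have := ab_tri (f i a) (f i (a + z)) 0; rewrite !subr0.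
  move=> H1 H2 /(_ _)/wrap[j|]; last by lra.
  by rewrite mxE addrAC subrr add0r; apply: zh.
have [h h0 hP] := S.
have m0 := min_gt0 e10 h0.
have /andP[_ ml] := min_boundl e10 h0; have /andP[_ mr] := min_boundr e10 h0.
exists (Num.min e1 h) => // z zm; split=> [|i].
  by apply: Pe => i; apply: lt_le_trans (zm i) ml.
have -> : z = a + (z - a) by rewrite addrCA subrr addr0.
apply: hP => j; rewrite !mxE.
exact: le_trans (ltW (zm j)) mr.
Qed.

End Arc.

(** * Charts of the curve *)

Section Charts.
Context {R : realType} {n : nat}.
Local Notation C := (Cplx R).
Variables (d : 'I_n -> fps C 1) (i0 : 'I_n) (nu : nat) (zeta : C).
Hypotheses (nu0 : (0 < nu)%N) (d0 : const0 d) (dc : forall i, convergent (d i))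
  (di0 : d i0 = X1 ^+ nu) (zP : nu.-primitive_root zeta).
Local Notation arc := (arc d).
Local Notation box := (box i0 nu).

(** If every [d i] were invariant under this rotation, only exponents divisible by m = nu / gcd(nu,
    j) > 1 would occur, and [d] would factor through s^m, against irreducibility. *)
Lemma irreducible_rot Gamma (j : nat) : parametrizes d Gamma -> (0 < j < nu)%N ->
  exists i, rot (zeta ^+ j) (d i) <> d i.
Proof.
move=> [[dp dirr] _] /andP[j0 ju]; apply: contrapT => /forallNP H.
have rd i : rot (zeta ^+ j) (d i) = d i by apply: contrapT; apply: H.
pose m := (nu %/ gcdn nu j)%N.
have g0 : (0 < gcdn nu j)%N by rewrite gcdn_gt0 nu0.
have m1 : (1 < m)%N.
  rewrite /m ltn_divRL ?dvdn_gcdl // mul1n; apply: leq_ltn_trans ju.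
  by apply: dvdn_leq; rewrite ?dvdn_gcdr.
have m0 : (0 < m)%N by apply: ltn_trans m1.
have dm i k : ~~ (m %| k)%N -> coef1 (d i) k = 0.
  move=> mk; apply/eqP; apply: contraNT mk => dk.
  have := congr1 (fun f => coef1 f k) (rd i); rewrite coef1_rot => /eqP.
  rewrite -subr_eq0 -{2}[coef1 (d i) k]mulr1 -mulrBr mulf_eq0 (negbTE dk) /= subr_eq0 -exprM.
  rewrite -(prim_order_dvd zP) => nujk.
  have : (m * gcdn nu j %| (j %/ gcdn nu j) * k * gcdn nu j)%N.
    by rewrite /m divnK ?dvdn_gcdl // mulnAC divnK ?dvdn_gcdr.
  rewrite dvdn_pmul2r // Gauss_dvdr //.
  rewrite /coprime -(eqn_pmul2r g0) muln_gcdl mul1n /m !divnK ?dvdn_gcdl ?dvdn_gcdr //.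
have dE i : d i = fps_comp (sect m 0 (d i)) (fun=> X1 ^+ m).
  by rewrite sect0_comp // => k; apply: dm.
have := dirr (fun i => sect m 0 (d i)) (X1 ^+ m); case.
- split=> [i|]; first by rewrite coef1_ser muln0 addn0 coef10 d0.
  have [_ [i di]] := dp; exists i => si; apply: di.
  by rewrite (dE i) si fps_comp0.
- by rewrite coef1_Xn; case: (m) m0.
- exact: dE.
- by rewrite coef1_Xn; case: eqP m1 => // <-.
Qed.

(** Some coordinate differs on the two sheets as a series in s, and the zeros of the difference are
    isolated. *)
Lemma sheets_distinct Gamma : parametrizes d Gamma -> small1 (fun s => s != 0 ->
  forall j : 'I_nu, (0 < j)%N -> cpt d (zeta ^+ j * s) <> cpt d s).
Proof.
move=> dG.
have : small1 (fun s => forall j : 'I_nu, s != 0 -> (0 < j)%N -> cpt d (zeta ^+ j * s) <> cpt d s).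
  apply: small1_all => j; have [j0|j0] := posnP j; first by exists 1.
  have [|i di] := irreducible_rot (j := j) dG; first by rewrite j0 ltn_ord.
  have rc : convergent (rot (zeta ^+ j) (d i)) by apply: convergent_rot.
  have [r r0 [rr dr]] := convergent_cv rc (dc i).
  have fc := convergentB rc (dc i).
  have f0 : rot (zeta ^+ j) (d i) - d i <> 0 by move=> /eqP; rewrite subr_eq0 => /eqP.
  have [h h0 hP] := ev1_isolated fc f0.
  have S1 : small1 (fun s => s != 0 -> ev1 (rot (zeta ^+ j) (d i) - d i) s != 0) by exists h.
  have S2 : small1 (fun s => ab s <= r / 2) by exists (r / 2); first by rewrite divr_gt0.
  apply: small1_imp (small1_and S1 (small1_and S2 (ev1_rot (zeta ^+ j) (dc i)))) => s [sn [sr sE]] s0 _ ds.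
  have := sn s0; rewrite /ev1 (evB (ltW r0) rr dr (pdisc1 sr)) subr_eq0 => /eqP; apply.
  move: ds => /(congr1 (fun v : 'rV[C]_n => v 0 i)); rewrite !cptE; exact: etrans sE.
by apply: small1_imp => s H s0 j; apply: H.
Qed.

Section Chart.
Variables (rho : R) (s0 : C).
Hypotheses (rho0 : 0 < rho) (s0rho : ab s0 < rho) (s0nu : s0 != 0 \/ nu = 1%N)
  (d_hol : forall s, ab s < rho -> forall i, hol1 (ev1 (d i)) s)
  (distinct : forall j : 'I_nu, (0 < j)%N -> cpt d (zeta ^+ j * s0) <> cpt d s0).
Let x0 := s0 ^+ nu.

(** Near the point of parameter [s0] the arc is the graph of the branch through [s0]. For every
    other sheet, some coordinate has at x0 a gap of at least 2 eta from this branch, and over |x -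
    x0| < del the gap varies by at most half its value. A point of the arc within [eta] of the
    branch is thus on the branch. *)
Lemma chart_branch : exists (psi : 'I_n -> C -> C) (eta del : R),
  [/\ 0 < eta, 0 < del, forall i, psi i x0 = cpt d s0 0 i, (forall x, psi i0 x = x) &
   forall x, ab (x - x0) < del -> (s0 != 0 -> x != 0) /\ (forall i, hol1 (psi i) x) /\
     forall z : 'rV[C]_n, z 0 i0 = x -> (forall i, ab (z 0 i - psi i x) < eta) ->
     (arc rho z <-> forall i, z 0 i = psi i x)].
Proof.
have aux (a b c e : R) : a <= c + b -> b < e -> c <= a / 2 -> e <= a / 2 -> False by lra.
have aux2 (a : R) : 0 < a -> a <= a / 2 -> False by lra.
have [root [rx0 rootP]] := root_branch nu0 s0nu.
(* The coordinate [i0] is set to [x] itself, so that [psi i0 x = x] holds for all x and not only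
   where the root is controlled. *)
pose psi i x := if i == i0 then x else ev1 (d i) (root x).
pose D (j : 'I_nu) i y := ev1 (d i) (zeta ^+ j * root y) - ev1 (d i) (root y).
have ab_root' s (r : R) : 0 <= r -> (ab s ^+ nu < r ^+ nu) = (ab s < r).
  by move=> r0; apply: ab_root.
have x0rho : 0 < rho ^+ nu - ab x0 by rewrite subr_gt0 abX ab_root' // ltW.
have rho0' := ltW rho0.
have S1 : small1 (fun y => ab y <= (rho ^+ nu - ab x0) / 2).
  by exists ((rho ^+ nu - ab x0) / 2); first by rewrite divr_gt0.
have root_rho y : (hol1 root (x0 + y) /\ root (x0 + y) ^+ nu = x0 + y) ->
    ab y <= (rho ^+ nu - ab x0) / 2 -> ab (root (x0 + y)) < rho.
  move=> [_ E] yr; rewrite -ab_root' // -abX E; have := abD x0 y; lra.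
have root_rho0 : ab (root x0) < rho by rewrite rx0.
have hr0 : hol1 root x0.
  have [h h0 /(_ 0)] := rootP; rewrite ab0 addr0 => H; exact: (H (ltW h0)).1.
have Dh j i : hol1 (D j i) x0.
  apply: hol1B; last first.
    exact: (@hol1_comp R (ev1 (d i)) root x0 (d_hol root_rho0 i) hr0).
  apply: (@hol1_comp _ (ev1 (d i)) (fun y => zeta ^+ j * root y)).
    by apply: (d_hol _ i); rewrite abM (ab_zeta nu0 zP) mul1r.
  exact: (hol1M (hol1C _ _) hr0).
have Dx (j : 'I_nu) : (0 < j)%N -> exists i, D j i x0 != 0.
  move=> j0; apply: contrapT => /forallNP H; apply: (distinct j0).
  apply/rowP => i; rewrite !cptE; apply/eqP; rewrite -subr_eq0.
  by have /negP/negPn := H i; rewrite /D rx0.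
have S2 : small1 (fun h => forall j : 'I_nu, (0 < j)%N -> exists2 i, ab h <= ab (D j i x0) / 2 & D j i x0 != 0).
  apply: small1_all => j; have [j0|j0] := posnP j; first by exists 1.
  have [i di] := Dx j j0; exists (ab (D j i x0) / 2); first by rewrite divr_gt0 // ab_gt0.
  by move=> h hh _; exists i.
have [eta eta0 etaP] := S2.
have eta0' : 0 <= eta := ltW eta0.
have {}etaP := etaP (toC eta); rewrite ab_toC // lexx in etaP.
have {}etaP := etaP isT.
have S3 : small1 (fun y => forall (j : 'I_nu) i, D j i x0 != 0 -> ab (D j i (x0 + y) - D j i x0) <= ab (D j i x0) / 2).
  apply: small1_all => j; apply: small1_all => i; have [->|Dn] := eqVneq (D j i x0) 0; first by exists 1.
  have D2 : 0 < ab (D j i x0) / 2 by rewrite divr_gt0 // ab_gt0.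
  by apply: small1_imp (small1_near (Dh j i) D2) => y yD _.
have S4 : small1 (fun y => s0 != 0 -> x0 + y != 0).
  have [_|s00] := eqVneq s0 0; first by exists 1.
  have x00 : 0 < ab x0 by rewrite ab_gt0 expf_neq0.
  exists (ab x0 / 2) => [|y yx _]; first by rewrite divr_gt0.
  apply/eqP => /eqP; rewrite addr_eq0 => /eqP xy; move: yx; rewrite -[y]opprK -xy abN => yx.
  exact: aux2 yx.
have [del [del0 delP]] := small1_radius (small1_and rootP (small1_and S1 (small1_and S3 S4))).
exists psi, eta, del; split; [exact: eta0 | exact: del0 | | |].
- move=> i; rewrite /psi cptE; case: eqP => [->|_]; last by rewrite rx0.
  by rewrite di0 ev1_Xn.
- by move=> x; rewrite /psi eqxx.
move=> x xd; have := delP _ xd; rewrite addrC subrK => -[[hr rE] [xr [Dd xn]]].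
have rr : ab (root x) < rho.
  have := root_rho (x - x0); rewrite addrC subrK; apply=> //.
have psiE i : psi i x = cpt d (root x) 0 i.
  by rewrite /psi cptE; case: eqP => [->|_] //; rewrite di0 ev1_Xn rE.
split; first exact: xn.
split.
  move=> i; rewrite /psi; case: eqP => _.
    exact: hol1_id.
  exact: (@hol1_comp R (ev1 (d i)) root x (d_hol rr i) hr).
move=> z zx zpsi; split; last first.
  by move=> zE; exists (root x) => //; apply/rowP => i; rewrite zE psiE.
move=> [s sr zE] i.
suff sx : s = root x by rewrite psiE zE sx.
have snu : s ^+ nu = root x ^+ nu by rewrite rE -zx zE (cpt_i0 di0).
have [j sj] : exists j : 'I_nu, s = zeta ^+ j * root x.
  have [r0|r0] := eqVneq (root x) 0.
    exists (Ordinal nu0); rewrite r0 mulr0; apply/eqP.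
    by have /eqP := snu; rewrite r0 expr0n eqn0Ngt nu0 /= expf_eq0 nu0.
  have : (s / root x) ^+ nu = 1 by rewrite expr_div_n snu divff // expf_neq0.
  move=> /(prim_rootP zP)[j sj]; exists j; rewrite -sj divfK //.
have [j0|j0] := posnP j; first by rewrite sj j0 expr0 mul1r.
have [i' h1 h2] := etaP j j0.
have := Dd j i' h2; have := zpsi i'; rewrite zE sj psiE !cptE -/(D j i' x).
have := ab_tri (D j i' x) (D j i' x0) 0; rewrite !subr0 (abBC (D j i' x0)) => H1 H2 H3.
by have := aux _ _ _ _ H1 H2 H3 h1.
Qed.

(** Straightens the graph by z_i -> z_i - psi_i(x). The transposition [s] moves x to the first
    place, since a submanifold of dimension 1 is cut out by the remaining coordinates. For s0
    nonzero the domain avoids x = 0, hence the origin. *)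
Lemma chart_at : exists W W' (phi : 'rV[C]_n -> 'rV[C]_n),
  [/\ W (cpt d s0), (s0 != 0 -> forall z, W z -> z <> 0), biholomorphic W W' phi
    & forall z, W z -> (arc rho z <-> forall i : 'I_n, (1 <= i)%N -> phi z 0 i = 0)].
Proof.
have [psi [eta [del [eta0 del0 psix0 psii0 psiP]]]] := chart_branch.
have n0 : (0 < n)%N by apply: leq_ltn_trans (ltn_ord i0).
pose z0 : 'I_n := Ordinal n0; pose s l := if l == i0 then z0 else if l == z0 then i0 else l.
have ss l : s (s l) = l.
  by rewrite /s; have [->|l1] := eqVneq l i0; [rewrite eqxx; case: eqP | have [->|l2] := eqVneq l z0; rewrite ?eqxx // (negbTE l1) (negbTE l2)].
have sz0 : s z0 = i0 by rewrite /s eqxx; case: eqP.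
have sE l : (s l == i0) = (l == z0) by rewrite -sz0 (can_eq ss).
pose P := [set z : 'rV[C]_n | ab (z 0 i0 - x0) < del].
pose P' := [set w : 'rV[C]_n | ab (w 0 z0 - x0) < del].
have openP (i : 'I_n) : open [set z : 'rV[C]_n | ab (z 0 i - x0) < del].
  apply/open_rVP => a ai; exists (del - ab (a 0 i - x0)); first by rewrite subr_gt0.
  move=> z /(_ i) zi /=; have := ab_tri (a 0 i) (z 0 i) x0; lra.
pose f i (z : 'rV[C]_n) := z 0 i - psi i (z 0 i0).
pose phi (z : 'rV[C]_n) : 'rV[C]_n := \row_l (if l == z0 then z 0 i0 else f (s l) z).
pose H (w : 'rV[C]_n) : 'rV[C]_n := \row_i (if i == i0 then w 0 z0 else w 0 (s i) + psi i (w 0 z0)).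
pose f' i (w : 'rV[C]_n) : C := if i == i0 then 0 else w 0 (s i).
pose W := [set z : 'rV[C]_n | P z /\ forall i, ab (f i z) < eta].
pose W' := [set w : 'rV[C]_n | P' w /\ forall i, ab (f' i w) < eta].
have psi_hol i (z : 'rV[C]_n) k : ab (z 0 k - x0) < del -> holomorphic_at (fun z : 'rV[C]_n => psi i (z 0 k)) z.
  by move=> zx; apply: hol1_coord; exact: (psiP _ zx).2.1.
have f_hol (z : 'rV[C]_n) : P z -> forall i, holomorphic_at (f i) z.
  by move=> Pz i; apply: holomorphicB; [exact: holomorphicX | exact: psi_hol].
have f'_hol (z : 'rV[C]_n) : P' z -> forall i, holomorphic_at (f' i) z.
  move=> _ i; rewrite /f'; case: (i == i0); [exact: holomorphicC | exact: holomorphicX].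
have HW (z : 'rV[C]_n) : phi z 0 z0 = z 0 i0 by rewrite mxE eqxx.
have Hi0 (w : 'rV[C]_n) : H w 0 i0 = w 0 z0 by rewrite mxE eqxx.
have fphi i (z : 'rV[C]_n) : f' i (phi z) = f i z.
  rewrite /f' /f; case: eqP => [->|/eqP ii]; first by rewrite psii0 subrr.
  by rewrite mxE -sE ss (negbTE ii).
have fH i (w : 'rV[C]_n) : f i (H w) = f' i w.
  rewrite /f /f' Hi0; case: eqP => [->|/eqP ii]; first by rewrite Hi0 psii0 subrr.
  by rewrite mxE (negbTE ii) addrK.
exists W, W', phi; split.
- by split=> [|i]; rewrite /P /f /= (cpt_i0 di0) ?subrr ?ab0 // psix0 subrr ab0.
- move=> s00 z [Pz _] zz; have [/(_ s00) + _] := psiP _ Pz; by rewrite zz mxE eqxx.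
- split.
  + by apply: open_holomorphic f_hol; exact: openP.
  + by apply: open_holomorphic f'_hol; exact: openP.
  + move=> a [Pa _] l; have [l0|l0] := eqVneq l z0.
      by rewrite l0; under eq_fun do rewrite HW; exact: holomorphicX.
    rewrite /phi; under eq_fun do rewrite mxE (negbTE l0); exact: f_hol.
  + exists H; split.
    * move=> a [Pa _] i; have [ii|ii] := eqVneq i i0.
        by rewrite ii; under eq_fun do rewrite Hi0; exact: holomorphicX.
      rewrite /H; under eq_fun do rewrite mxE (negbTE ii).
      by apply: holomorphicD; [exact: holomorphicX | exact: psi_hol].
    * move=> z [Pz fz]; split; first by split=> [|i]; rewrite /P' /= ?HW ?fphi.
      apply/rowP => i; rewrite mxE HW; case: eqP => [->//|/eqP ii].
      by rewrite mxE -sE ss (negbTE ii) /f subrK.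
    * move=> w [Pw fw]; split; first by split=> [|i]; rewrite /P /= ?Hi0 ?fH.
      apply/rowP => l; rewrite mxE Hi0; case: eqP => [->//|/eqP ll].
      by rewrite fH /f' sE (negbTE ll) ss.
- move=> z [Pz fz]; have [_ [_ /(_ z erefl) zP']] := psiP _ Pz.
  have {}zP' := zP' fz; split.
    move=> /zP' zE l l1; rewrite mxE; case: eqP l1 => [->//|_ _].
    by rewrite /f zE subrr.
  move=> zE; apply/zP' => i; have [->|ii] := eqVneq i i0; first by rewrite psii0.
  have := zE (s i); rewrite mxE -sE ss (negbTE ii) => fz0.
  apply/eqP; rewrite -subr_eq0; apply/eqP; apply: fz0.
  by rewrite lt0n; apply: contra ii => /eqP si0; rewrite -(ss i) sE; apply/eqP/val_inj.
Qed.
End Chart.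
End Charts.

(** * Blow-ups and asymptotic orbits *)

Section Blowup.
Context {R : realType} {n : nat}.
Local Notation C := (Cplx R).
Implicit Types (v z : 'rV[C]_n) (g h : fps C n) (cs : nat -> 'I_n -> fps C 1).

Lemma convergent_fpsXdiv (i : 'I_n) (f : fps C n) : convergent (fpsX i * f) -> convergent f.
Proof.
move=> /convergentP[r r0 [M fM]]; apply/convergentP; exists r => //; exists (M / r) => N.
rewrite ler_pdivlMr // mulr_suml.
pose s (k : multinom n) := mnm_add (mnm1 i) k.
pose F (k : multinom n) := ab ((fpsX i * f) k) * r ^+ mdeg k.
apply: le_trans (fM N.+1).
have sN (k : bmultinom n N) : (mdeg (s k) < N.+1)%N by rewrite mdegD mdeg1 add1n ltnS bmdeg.
pose s' (k : bmultinom n N) : bmultinom n N.+1 := BMultinom (sN k).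
have s'inj : injective s'.
  move=> k l /(congr1 (fun m : bmultinom n N.+1 => m : multinom n)) /= /addmI kl.
  exact: val_inj.
rewrite [leRHS](bigID (mem (codom s'))) /= -[leLHS]addr0 lerD //; last first.
  by apply: sumr_ge0 => k _; apply: wterm_ge0; exact: ltW.
rewrite -[leRHS]big_uniq /=; last by rewrite map_inj_uniq // enum_uniq.
rewrite [leRHS]big_map [leRHS]big_enum /=; apply: ler_sum => k _.
by rewrite fpsXMS mdegD mdeg1 add1n exprSr mulrA.
Qed.

Definition chart_series (i : 'I_n) v (l : 'I_n) : fps C n :=
  fpsX i * (if l == i then 1 else fpsC (v 0 l) + fpsX l).

Lemma const0_chart i v : const0 (chart_series i v).
Proof. by move=> l; rewrite /chart_series fpsM0 /fpsX eq_sym mnm1_eq0 mul0r. Qed.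

Lemma cv_chart (r : R) i v l : 0 <= r -> cv r (chart_series i v l).
Proof.
move=> r0; apply: cvM => //; first exact: cvX.
case: (l == i); first exact: cv1.
by apply: cvD => //; [exact: cvC | exact: cvX].
Qed.

Lemma convergent_chart i v l : convergent (chart_series i v l).
Proof. by apply/convergentP; exists 1 => //; apply: cv_chart. Qed.

Lemma evs_chart i v z : evs (chart_series i v) z = blowup_chart i v z.
Proof.
have [r r0 zr] := pdisc_exists z.
have cX j : cv r (fpsX j : fps C n) by apply: cvX.
apply/rowP => l; rewrite !mxE /chart_series; have [_|li] := eqVneq l i.
  by rewrite mulr1 evX.
have cs1 : cv r (fpsC (v 0 l) + fpsX l) by apply: cvD => //; exact: cvC.
by rewrite (evM r0 (cX i) cs1 zr) (evD r0 (cvC _ _) (cX l) zr) !evX evC.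
Qed.

(** Every nonconstant monomial contains a coordinate, and in the chart all coordinates are divisible
    by the equation of the exceptional divisor. *)
Lemma comp_chart_div i v (f : fps C n) : f mnm0 = 0 ->
  exists f1, fps_comp f (chart_series i v) = fpsX i * f1.
Proof.
move=> f0; exists (fun m => fps_comp f (chart_series i v) (mnm_add (mnm1 i) m)).
apply: fpsX_div => m mi; rewrite fps_compE psubE; apply: big1 => k _.
have [k0|k0] := eqVneq (k : multinom n) mnm0; first by rewrite k0 f0 mul0r.
have [l kl] : exists l, k l != 0%N.
  apply: contrapT => /forallNP H; move/eqP: k0; apply; apply/mnmP => l; rewrite mnm0E.
  by apply/eqP/negPn/negP; exact: H.
rewrite /mmon (bigD1 l) //= -(prednK (n := k l)) ?lt0n // exprS {1}/chart_series -!mulrA fpsXM0 ?mulr0 //.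
Qed.

(** [blowdown] is defined by peeling off the last blow-up; the induction on the order along the
    curve needs the first one. *)
Lemma blowdown_shift (i : nat -> 'I_n) (v : nat -> 'rV[C]_n) J u :
  blowdown i v J.+1 u = blowup_chart (i 0%N) (v 0%N) (blowdown (i \o S) (v \o S) J u).
Proof. by elim: J u => [|J IH] u //=; rewrite -IH. Qed.

Lemma small_evs (p : nat) (G : 'I_n -> fps C p) (P : 'rV[C]_n -> Prop) :
  const0 G -> (forall i, convergent (G i)) -> small P -> small (fun u => P (evs G u)).
Proof.
move=> G0 Gc [e e0 eP]; have [r r0 Gr] := convergent_cvs Gc.
have [r' /andP[r'0 _] Gr'] := nb_smalls r0 G0 Gr e0.
exists (r' / 2); first by rewrite divr_gt0.
by move=> u ur; apply: eP; apply: evs_pdisc (ltW r'0) Gr' ur.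
Qed.

Lemma small_blowdown (i : nat -> 'I_n) (v : nat -> 'rV[C]_n) J (P : 'rV[C]_n -> Prop) :
  small P -> small (fun u => P (blowdown i v J u)).
Proof.
elim: J P => [|J IH] P //= sP.
have := small_evs (const0_chart (i J) (v J)) (convergent_chart (i J) (v J)) (IH P sP).
by apply: small_imp => u; rewrite evs_chart.
Qed.

(** Compares the coefficients of lowest degree [nu] in c_l = c_i (v_l + c'_l), where c_i has leading
    coefficient x: they give x v_l = x (v_l + c'_l(0)). *)
Lemma strict_transform_const0 (i : 'I_n) v (c c' : 'I_n -> fps C 1) : const0 c -> tangent_line c v ->
  v 0 i = 1 -> strict_transform i v c c' -> c i <> 0 /\ const0 c'.
Proof.
move=> c0 [_ [nu [x [x0 cv]]]] vi [c'i c'l].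
have ci : coef1 (c i) nu = x by rewrite (cv i).1 vi mulr1.
split=> [ci0|l]; first by apply: x0; rewrite -ci ci0 coef1_0.
have [->|/eqP li] := eqVneq l i; first by rewrite c'i.
have := congr1 (fun f => coef1 f nu) (c'l l li); rewrite (cv l).1 coef1M big_ord_recr /= subnn ci.
rewrite big1 ?add0r => [|k _]; last by rewrite ((cv i).2 k) // mul0r.
rewrite coef1D coef1C eqxx mulr1n => /(mulfI (introN eqP x0)) /eqP.
by rewrite -{1}[v 0 l]addr0 (inj_eq (addrI _)) eq_sym coef10 => /eqP.
Qed.

Lemma chart_strict_transform (i : 'I_n) v (c c' : 'I_n -> fps C 1) : const0 c' -> strict_transform i v c c' ->
  forall l, fps_comp (chart_series i v l) c' = c l.
Proof.
move=> c'0 [c'i c'l] l; rewrite /chart_series (fps_compM _ _ c'0) (fps_compX _ c'0) c'i.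
case: eqP => [->|/eqP li]; first by rewrite fps_comp1 mulr1.
by rewrite fps_compD fps_compC (fps_compX _ c'0) -c'l //; apply/eqP.
Qed.

Lemma order_uniq (p q : nat) (u w : fps C 1) : X1 ^+ p * u = X1 ^+ q * w ->
  coef1 u 0 <> 0 -> coef1 w 0 <> 0 -> p = q.
Proof.
wlog : p q u w / (p <= q)%N.
  by move=> H uw u0 w0; case: (leqP p q) => [|/ltnW] pq; [apply: (H p q u w) | apply/esym/(H q p w u)].
rewrite leq_eqVlt => /orP[/eqP //|pq] uw u0 _; case: u0.
have := congr1 (fun f => coef1 f p) uw; rewrite !coef1_XnM ltnn subnn pq; exact.
Qed.

(* Pulling back by the chart divides both series by the equation of the exceptional
   divisor, which lowers the order of [h] along the curve. *)
Lemma blowup_dominated (p : nat) : forall (i : nat -> 'I_n) (v : nat -> 'rV[C]_n) cs g h,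
    const0 (cs 0%N) -> iterated_tangents (cs 0%N) i v cs -> convergent g -> convergent h ->
    fps_comp g (cs 0%N) = 0 -> (exists u, fps_comp h (cs 0%N) = X1 ^+ p * u /\ coef1 u 0 <> 0) ->
  exists J (K : R), 0 <= K /\
    small (fun u => ab (ev g (blowdown i v J u)) <= K * ab (ev h (blowdown i v J u))).
Proof.
elim/ltn_ind: p => p IH i v cs g h c0 [_ csP] gc hc gcs [w [hcs w0]].
(* Terminal case: [h] does not vanish at the current centre, so near it |h| is at least |h(0)| / 2
   while [g] is bounded, and no further blow-up is needed. *)
have [h0|h0] := eqVneq (h mnm0) 0; last first.
  have h2 : 0 < ab (h mnm0) / 2 by rewrite divr_gt0 // ab_gt0.
  have /convergentP[r r0 hr] := hc; have [e e0 he] := ev_cont0 r0 hr h2.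
  have /convergentP[r' r'0 [M gM]] := gc.
  have M0 : 0 <= M := nb_ge0 gM.
  exists 0%N, (M / (ab (h mnm0) / 2)); split; first by rewrite divr_ge0 // ltW.
  have S1 : small (pdisc e : 'rV[C]_n -> Prop) by exists e.
  have S2 : small (pdisc (r' / 2) : 'rV[C]_n -> Prop) by exists (r' / 2); first by rewrite divr_gt0.
  apply: small_imp (small_and S1 S2) => u [/he hu /(ev_le (ltW r'0) gM) gu] /=.
  apply: le_trans gu _; rewrite -mulrA ler_peMr // ler_pdivlMl // mulr1.
  have := ab_tri (ev h u) (h mnm0) 0; rewrite !subr0 abBC; lra.
have [tl vi st] := csP 0%N.
have [ci c1] := strict_transform_const0 c0 tl vi st.
have g0 : g mnm0 = 0.
  by have := congr1 (fun f : fps C 1 => f mnm0) gcs; rewrite fps_comp_const.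
have [g1 g1E] := comp_chart_div (i 0%N) (v 0%N) g0.
have [h1 h1E] := comp_chart_div (i 0%N) (v 0%N) h0.
have chc := convergent_chart (i 0%N) (v 0%N); have ch0 := const0_chart (i 0%N) (v 0%N).
have g1c : convergent g1 by apply: (@convergent_fpsXdiv (i 0%N)); rewrite -g1E; exact: convergent_comp.
have h1c : convergent h1 by apply: (@convergent_fpsXdiv (i 0%N)); rewrite -h1E; exact: convergent_comp.
have stE f : fps_comp (fps_comp f (chart_series (i 0%N) (v 0%N))) (cs 1%N) = fps_comp f (cs 0%N).
  rewrite (fps_compA _ ch0 c1); congr fps_comp; apply/funext => l; exact: chart_strict_transform.
have c10 : cs 1%N (i 0%N) = cs 0%N (i 0%N) by case: st.
have g1cs : fps_comp g1 (cs 1%N) = 0.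
  have := gcs; rewrite -stE g1E (fps_compM _ _ c1) (fps_compX _ c1) c10 => /fps1_domain[]//.
have [q [y [cE y0]]] := fps1_order ci.
have h1n : fps_comp h1 (cs 1%N) <> 0.
  move=> h10; apply: w0; have := hcs; rewrite -stE h1E (fps_compM _ _ c1) h10 mulr0.
  by move=> /(congr1 (fun f => coef1 f p)); rewrite coef1_0 coef1_XnM ltnn subnn.
have [q' [y' [hE y'0]]] := fps1_order h1n.
(* The order of [h] along the curve splits as the order q >= 1 of the exceptional coordinate plus
   the order of the quotient, which is therefore strictly smaller. *)
have pE : p = (q + q')%N.
  have := hcs; rewrite -stE h1E (fps_compM _ _ c1) (fps_compX _ c1) c10 cE hE mulrACA -exprD => E.
  apply/esym/(order_uniq E) => //.
  by rewrite coef1M big_ord1 => /eqP; rewrite mulf_eq0 => /orP[]/eqP.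
have q0 : (0 < q)%N.
  rewrite lt0n; apply/eqP => q0; apply: y0; have := c0 (i 0%N).
  by rewrite cE q0 expr0 mul1r -coef10.
have q'p : (q' < p)%N by rewrite pE -[X in (X < _)%N]add0n ltn_add2r.
have it : iterated_tangents (cs 1%N) (i \o S) (v \o S) (cs \o S).
  by split=> // j; exact: (csP j.+1).
have [J [K [K0 gh]]] := IH q' q'p (i \o S) (v \o S) (cs \o S) g1 h1 c1 it g1c h1c g1cs
  (ex_intro _ y' (conj hE y'0)).
exists J.+1, K; split=> //.
have comp_small (f f1 : fps C n) : convergent f -> convergent f1 ->
    fps_comp f (chart_series (i 0%N) (v 0%N)) = fpsX (i 0%N) * f1 ->
  small (fun z => ev f (blowup_chart (i 0%N) (v 0%N) z) = z 0 (i 0%N) * ev f1 z).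
  move=> fc f1c fE; have [r r0 rP] := ev_comp_near ch0 fc chc.
  have /convergentP[r' r'0 f1r] := f1c.
  have m0 := min_gt0 r0 r'0; have /andP[_ ml] := min_boundl r0 r'0; have mr := min_boundr r0 r'0.
  exists (Num.min r r' / 2); first by rewrite divr_gt0.
  move=> z zm; have [|_ E] := rP (Num.min r r'); first by rewrite m0.
  by rewrite -evs_chart -E // fE (evM (ltW m0) (cvX _ (ltW m0)) (cv_ler mr f1r) zm) evX.
have S' := small_and (comp_small g g1 gc g1c g1E) (comp_small h h1 hc h1c h1E).
apply: small_imp (small_and gh (small_blowdown (i \o S) (v \o S) J S')) => u [H [E1 E2]].
by rewrite blowdown_shift E1 E2 !abM mulrCA ler_wpM2l ?ab_ge0.
Qed.

Lemma asymptotic_cvg (a : nat -> 'rV[C]_n) Gamma : asymptotic a Gamma -> a @ \oo --> (0 : 'rV[C]_n).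
Proof.
move=> [c [i [v [cs [_ _ H]]]]]; have [u [[N _ uN] u0]] := H 0%N.
apply/rV_cvg0P => e e0; have [N' uN'] := iffLR (rV_cvg0P u) u0 e e0.
exists (maxn N N') => k; rewrite geq_max => /andP[Nk N'k] l.
by have := uN k Nk => /= <-; apply: uN'.
Qed.

(** Since [h] is not in [Gamma], it has a finite order along the curve; finitely many blow-ups
    suffice, and the lifts of the orbit tend to the centre reached. *)
Lemma asymptotic_dominated (a : nat -> 'rV[C]_n) Gamma g h : asymptotic a Gamma ->
    convergent g -> convergent h -> Gamma g -> ~ Gamma h ->
  exists2 K : R, 0 <= K & exists N, forall k, (N <= k)%N -> ab (ev g (a k)) <= K * ab (ev h (a k)).
Proof.
move=> [c [i [v [cs [cG it H]]]]] gc hc Gg Gh.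
have c0 := parametrizes0 cG; have [_ cGE] := cG; have [cs0 _] := it.
have hn : fps_comp h (cs 0%N) <> 0 by rewrite cs0 => /cGE.
have [p hp] := fps1_order hn.
rewrite -cs0 in c0 it.
have gcs : fps_comp g (cs 0%N) = 0 by rewrite cs0; apply/cGE.
have [J [K [K0 [e e0 eP]]]] := blowup_dominated c0 it gc hc gcs hp.
exists K => //; have [u [[N _ uN] u0]] := H J.
have [N' uN'] := iffLR (rV_cvg0P u) u0 e e0.
exists (maxn N N') => k; rewrite geq_max => /andP[Nk N'k].
by have := uN k Nk => /= <-; apply: eP => l; apply/ltW/uN'.
Qed.

End Blowup.

(** * Dynamics on the curve *)

Section NearOrigin.
Context {R : realType} {n : nat}.
Local Notation C := (Cplx R).

Lemma ev_fpsXn i k (z : 'rV[C]_n) : ev (fpsX i ^+ k) z = z 0 i ^+ k.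
Proof.
by have [r r0 zr] := pdisc_exists z; rewrite (evXn k r0 (cvX i r0) zr) evX.
Qed.

Definition lipschitz0 (G : 'rV[C]_n -> 'rV[C]_n) (L : R) := exists2 r : R, 0 < r &
  forall z w (e : R), pdisc r z -> pdisc r w -> 0 <= e -> (forall i, ab (z 0 i - w 0 i) <= e) ->
    forall i, ab (G z 0 i - G w 0 i) <= L * e.

Lemma holo0_lipschitz G : holo0 G -> exists2 L, 0 <= L & lipschitz0 G L.
Proof.
move=> hG; have [r r0 Gr] := convergent_cvs (fun j => convergent_jet j hG).
have /fin_all_exists2[L L0 LP] : forall j, exists2 L : R, 0 <= L & forall z w d, pdisc (r / 4) z ->
    pdisc (r / 4) w -> (forall i, ab (z 0 i - w 0 i) <= d) -> 0 <= d ->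
    ab (ev (jet G j) z - ev (jet G j) w) <= L * d.
  by move=> j; apply: ev_lipschitz.
have [e e0 eP] := jet_ev hG.
have r4 : 0 < r / 4 by rewrite divr_gt0.
have /andP[_ ml] := min_boundl e0 r4; have /andP[_ mr] := min_boundr e0 r4.
exists (\sum_j L j); first by apply: sumr_ge0.
exists (Num.min e (r / 4)); first exact: min_gt0.
move=> z w h zm wm h0 zw i.
have zE := eP z (pdisc_le ml zm); have wE := eP w (pdisc_le ml wm).
rewrite zE wE !mxE; apply: le_trans (LP i z w h (pdisc_le mr zm) (pdisc_le mr wm) zw h0) _.
by rewrite ler_wpM2r // (bigD1 i) //= lerDl sumr_ge0.
Qed.

Lemma ev1_contracts (t : fps C 1) (mu : R) : convergent t -> t mnm0 = 0 -> ab (coef1 t 1) < mu ->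
  small1 (fun w => ab (ev1 t w) <= mu * ab w).
Proof.
move=> tc t0 tmu; pose u := ser (fun k => coef1 t k.+1).
have tE : t = X1 * u.
  apply: coef1P => k; rewrite coef1_XM; case: k => [|k]; last by rewrite [RHS]coef1_ser.
  by rewrite coef10.
have uc : convergent u by apply: (@convergent_shift _ 1); rewrite expr1 -tE.
have [r r0 [tr ur]] := convergent_cv tc uc.
have e0 : 0 < mu - ab (coef1 t 1) by rewrite subr_gt0.
have [d d0 dP] := ev_cont0 r0 ur e0.
have r2 : 0 < r / 2 by rewrite divr_gt0.
have /andP[_ ml] := min_boundl d0 r2; have /andP[_ mr] := min_boundr d0 r2.
exists (Num.min d (r / 2)) => [|w wm]; first exact: min_gt0.
have wr := pdisc1 (le_trans wm mr); have wd := pdisc1 (le_trans wm ml).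
rewrite /ev1 tE (evM (ltW r0) (cvX _ (ltW r0)) ur wr) evX mxE abM mulrC ler_wpM2r ?ab_ge0 //.
have u0 : u mnm0 = coef1 t 1 by rewrite -coef10 coef1_ser.
have := dP _ wd; rewrite u0.
have := ab_tri (coef1 t 1) (ev u (const_mx w)) 0; rewrite !subr0; lra.
Qed.

Lemma small1_scale (P : C -> Prop) (mu : C) : small1 P -> small1 (fun x => P (mu * x)).
Proof.
move=> [d d0 dP]; have mu1 : 0 < 1 + ab mu by have := ab_ge0 mu; lra.
exists (d / (1 + ab mu)) => [|x xd]; first by rewrite divr_gt0.
apply: dP; rewrite abM; apply: (@le_trans _ _ ((1 + ab mu) * ab x)).
  by rewrite ler_wpM2r ?ab_ge0 // lerDr.
by rewrite mulrC -ler_pdivlMr.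
Qed.

Lemma small1_ev (P : C -> Prop) (h : fps C 1) : convergent h -> h mnm0 = 0 -> small1 P ->
  small1 (fun x => P (ev1 h x)).
Proof.
move=> hc h0 [d d0 dP].
have := @small_curve R 1 (fun=> h) (fun z => pdisc d z) (const0_1 h0) (fun=> hc).
move=> H; apply: small1_imp (H _) => [x /(_ 0) xd|]; last by exists d.
by apply: dP; move: xd; rewrite cptE.
Qed.

(* [T = s o (mu .) o h] is the map [x |-> mu x] read in the parameter of [c o h]. *)
Lemma reparam_dynamics (G : 'rV[C]_n -> 'rV[C]_n) (c : 'I_n -> fps C 1) (s h : fps C 1) (mu : C) :
    const0 c -> (forall i, convergent (c i)) -> convergent s -> convergent h ->
    s mnm0 = 0 -> h mnm0 = 0 -> fps_comp h (fun=> s) = X1 ->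
    small1 (fun x => G (cpt c x) = cpt c (mu * x)) ->
  small1 (fun w => G (cpt (reparam c h) w) =
    cpt (reparam c h) (ev1 (fps_comp s (fun=> fpsC mu * h)) w)).
Proof.
move=> c0 cc sc hc s0 h0 hs GE.
have muhc : convergent (fpsC mu * h) by apply: convergentM => //; exact: convergentC.
have muh0 : (fpsC mu * h) mnm0 = 0 by rewrite fpsC_mul h0 mulr0.
have dc i : convergent (reparam c h i) by apply: convergent_comp => //; exact: const0_1.
have d0 : const0 (reparam c h) by move=> i; rewrite /reparam fps_comp_const ?c0 //; exact: const0_1.
have dsE : reparam (reparam c h) s = c.
  apply/funext => i; rewrite /reparam (fps_compA _ (const0_1 h0) (const0_1 s0)).
  by rewrite hs fps_comp_by_X1.
have S1 := cpt_comp h0 cc hc.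
have S2 := cpt_comp s0 dc sc; rewrite dsE in S2.
have S3 := ev1_comp sc muhc muh0.
have [r r0 hr] := iffLR (convergentP h) hc.
have S4 : small1 (fun w => ev1 (fpsC mu * h) w = mu * ev1 h w).
  exists (r / 2) => [|w wr]; first by rewrite divr_gt0.
  by rewrite /ev1 (evM (ltW r0) (cvC _ _) hr (pdisc1 wr)) evC.
have S5 := small1_ev hc h0 GE.
have S6 := small1_ev muhc muh0 S2.
apply: small1_imp (small1_and S1 (small1_and S3 (small1_and S4 (small1_and S5 S6)))) => w [E1 [E3 [E4 [E5 E6]]]].
exact: etrans (congr1 G E1) (etrans E5 (etrans (congr1 (cpt c) (esym E4)) (etrans E6 (congr1 (cpt (reparam c h)) (esym E3))))).
Qed.

End NearOrigin.

Section Dynamics.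
Context {R : realType} {n : nat}.
Local Notation C := (Cplx R).
Variables (d : 'I_n -> fps C 1) (i0 : 'I_n) (nu : nat) (zeta : C) (Gamma : set (fps C n)).
Hypotheses (nu0 : (0 < nu)%N) (d0 : const0 d) (dc : forall i, convergent (d i))
  (di0 : d i0 = X1 ^+ nu) (zP : nu.-primitive_root zeta) (dG : parametrizes d Gamma).
Variables (F H : 'rV[C]_n -> 'rV[C]_n) (T T' : C -> C) (mu0 : R).
Hypotheses (mu00 : 0 <= mu0) (mu01 : mu0 < 1)
  (FT : small1 (fun w => F (cpt d w) = cpt d (T w))) (Tmu : small1 (fun w => ab (T w) <= mu0 * ab w)).
Local Notation arc := (arc d).
Local Notation box := (box i0 nu).

Lemma arc_stable : exists2 r : R, 0 < r & forall rho, rho <= r ->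
  F @` arc rho `<=` arc rho /\
  forall z, arc rho z -> (fun k => iter k F z) @ \oo --> (0 : 'rV[C]_n).
Proof.
have [r [r0 rP]] : exists r : R, 0 < r /\ forall w, ab w < r ->
    F (cpt d w) = cpt d (T w) /\ ab (T w) <= mu0 * ab w.
  by have [r r0 rP] := small1_radius (small1_and FT Tmu); exists r.
exists r => // rho rhor.
have Trho w : ab w < rho -> ab (T w) < rho.
  move=> wr; have [_ H1] := rP w (lt_le_trans wr rhor); apply: le_lt_trans H1 _.
  by apply: le_lt_trans wr; rewrite ler_piMl ?ab_ge0 // ltW.
split.
  move=> _ [_ [w wr ->] <-]; exists (T w); first exact: Trho.
  by have [-> _] := rP w (lt_le_trans wr rhor).
move=> _ [w wr ->].
have it k : ab (iter k T w) < rho /\ ab (iter k T w) <= mu0 ^+ k * ab w /\ iter k F (cpt d w) = cpt d (iter k T w).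
  elim: k => [|k [h1 [h2 h3]]]; first by rewrite expr0 mul1r.
  have [E1 E2] := rP _ (lt_le_trans h1 rhor).
  split; first exact: Trho.
  split; last by rewrite !iterS h3.
  by rewrite iterS exprS -mulrA; apply: le_trans E2 _; rewrite ler_wpM2l.
apply/rV_cvg0P => e e0.
have e2 : small (fun z : 'rV[C]_n => forall i, ab (z 0 i) < e).
  by exists (e / 2) => [|z ze i]; [rewrite divr_gt0 | apply: le_lt_trans (ze i) _; lra].
have [h h0 hP] := small_curve d0 dc e2.
have hw : 0 < h / (1 + ab w) by rewrite divr_gt0 //; have := ab_ge0 w; lra.
have [N NP] := geometric_small mu00 mu01 hw.
exists N => k /NP kN i; have [_ [h2 ->]] := it k; apply: hP.
apply: le_trans h2 _; apply: (@le_trans _ _ (h / (1 + ab w) * (1 + ab w))).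
  by apply: ler_pM; rewrite ?exprn_ge0 ?ab_ge0 //; [exact: ltW | rewrite lerDr].
by rewrite divfK // gt_eqF //; have := ab_ge0 w; lra.
Qed.

Section Orbit.
Variable a : nat -> 'rV[C]_n.
Hypotheses (aF : forall k, a k.+1 = F (a k)) (aG : asymptotic a Gamma).
Local Notation x k := (a k 0 i0).

Lemma orbit_small (P : 'rV[C]_n -> Prop) : small P -> exists N, forall k, (N <= k)%N -> P (a k).
Proof.
move=> [e e0 eP]; have [N NP] := iffLR (rV_cvg0P a) (asymptotic_cvg aG) e e0.
by exists N => k /NP kN; apply: eP => i; apply/ltW.
Qed.

Lemma orbit_x_small (e : R) : 0 < e -> exists N, forall k, (N <= k)%N -> ab (x k) <= e.
Proof.
move=> e0; have [|N NP] := @orbit_small (pdisc e); first by exists e.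
by exists N => k /NP; apply.
Qed.

Lemma orbit_root_small (P : C -> Prop) : small1 P ->
  exists N, forall k, (N <= k)%N -> forall s, s ^+ nu = x k -> P s.
Proof.
move=> [e e0 eP]; have [|N NP] := @orbit_x_small (e ^+ nu); first exact: exprn_gt0.
exists N => k /NP kN s sx; apply: eP; rewrite -(ab_root_le nu0 s (ltW e0)) -abX sx; exact: kN.
Qed.

(** The equations of the curve belong to [Gamma], hence are dominated along the orbit by any power
    of x. The exponent M * nu is taken because the equations control the nu-th power of the
    distance. *)
Lemma orbit_close (M : nat) : exists2 K : R, 0 <= K & exists N, forall k, (N <= k)%N ->
  exists s, s ^+ nu = x k /\ forall i, ab (a k 0 i - cpt d s 0 i) <= K * ab (x k) ^+ M.
Proof.
have [K K0 KS] := eqn_close i0 nu0 d0 dc zP.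
have dom (t : 'I_(nu * n).+1) : exists p : R * nat, 0 <= p.1 /\ forall k, (p.2 <= k)%N ->
    ab (ev (eqn_ser d i0 nu zeta t) (a k)) <= p.1 * ab (ev (fpsX i0 ^+ (M * nu)) (a k)).
  have [gc gd] := eqn_kernel nu0 d0 dc di0 zP t.
  have hc : convergent (fpsX i0 ^+ (M * nu) : fps C n) by apply: convergentXn; exact: convergentX.
  have Gg : Gamma (eqn_ser d i0 nu zeta t) by apply/dG.2.
  have Gh : ~ Gamma (fpsX i0 ^+ (M * nu)).
    move=> /dG.2; rewrite (fps_compXn _ _ d0) (fps_compX _ d0) di0 -exprM.
    move=> /(congr1 (fun f => coef1 f (nu * (M * nu))%N)).
    by rewrite coef1_Xn eqxx coef1_0 => /eqP; rewrite oner_eq0.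
  by have [K' K'0 [N NP]] := asymptotic_dominated aG gc hc Gg Gh; exists (K', N).
have [p pP] := fin_all_exists dom.
(* At least 1, so that K1 <= K1^nu and the constant can be moved inside the nu-th power. *)
pose K1 := 1 + \sum_t (p t).1.
have K1t t : (p t).1 <= K1.
  rewrite /K1 (bigD1 t) //= addrCA lerDl addr_ge0 // sumr_ge0 // => t' _; exact: (pP t').1.
have K11 : 1 <= K1 by rewrite /K1 lerDl sumr_ge0 // => t _; exact: (pP t).1.
have K10 : 0 <= K1 by apply: le_trans K11.
exists (K * K1); first exact: mulr_ge0.
have [N1 N1P] := orbit_root_small KS.
have Se : small (fun z => forall t : 'I_(nu * n).+1, ev (eqn_ser d i0 nu zeta t) z = eqn d i0 nu zeta t z).
  by apply: small_all => t; exact: eqn_ev.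
have [N2 N2P] := orbit_small Se.
exists (maxn (maxn N1 N2) (\max_t (p t).2)) => k; rewrite !geq_max => /andP[/andP[k1 k2] /bigmax_leqP k3].
have [s sx] := root_exists nu0 (x k).
have e0 : 0 <= K1 * ab (x k) ^+ M by rewrite mulr_ge0 // exprn_ge0 // ab_ge0.
have [|s' s's zs'] := N1P k k1 s sx (a k) (K1 * ab (x k) ^+ M) (esym sx) e0; last first.
  by exists s'; split=> [|i]; [rewrite s's | rewrite -mulrA].
move=> t; rewrite -(N2P k k2); apply: le_trans ((pP t).2 k (k3 t isT)) _.
rewrite ev_fpsXn abX exprMn -exprM; apply: ler_wpM2r; first by rewrite exprn_ge0 // ab_ge0.
by apply: le_trans (K1t t) _; rewrite -{1}[K1]expr1; apply: ler_weXn2l.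
Qed.

(** The orbit is within K |x|^2 of the curve, where the coordinate is multiplied by at most [mu0] in
    modulus. The Lipschitz bound for [F] adds L K |x|^2, which is below (1 - mu0) / 2 times |x| for
    small x. *)
Lemma orbit_contracts (L : R) : 0 <= L -> lipschitz0 F L -> exists2 mu : R, 0 <= mu < 1 &
  exists N, forall k, (N <= k)%N -> ab (x k.+1) <= mu * ab (x k).
Proof.
move=> L0 [r r0 FL]; have [K K0 [N NP]] := orbit_close 2.
have Sd : small1 (fun w => pdisc r (cpt d w)) by apply: small_curve => //; exists r.
have [N1 N1P] := orbit_root_small (small1_and Sd (small1_and FT Tmu)).
have Sr : small (pdisc r : 'rV[C]_n -> Prop) by exists r.
have [N2 N2P] := orbit_small Sr.
have LK : 0 <= L * K by apply: mulr_ge0.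
have g0 : 0 < (1 - mu0) / 2 / (1 + L * K) by rewrite !divr_gt0 ?subr_gt0 //; lra.
have [N3 N3P] := orbit_x_small g0.
have m0 := mu00; have m1 := mu01.
exists ((1 + mu0) / 2); first by apply/andP; split; lra.
exists (maxn (maxn N N1) (maxn N2 N3)) => k; rewrite !geq_max => /andP[/andP[k0 k1] /andP[k2 k3]].
have [s [sx sP]] := NP k k0; have [sr [FE TE]] := N1P k k1 s sx.
have e0 : 0 <= K * ab (x k) ^+ 2 by rewrite mulr_ge0 // exprn_ge0 // ab_ge0.
have := FL _ _ _ (N2P k k2) sr e0 sP i0; rewrite -aF FE (cpt_i0 di0) => h1.
have h2 : ab (T s ^+ nu) <= mu0 * ab (x k).
  rewrite abX -sx abX; apply: (@le_trans _ _ ((mu0 * ab s) ^+ nu)).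
    by rewrite lerXn2r ?nnegrE ?ab_ge0 // mulr_ge0 // ab_ge0.
  rewrite exprMn ler_wpM2r ?exprn_ge0 ?ab_ge0 // -{2}[mu0]expr1.
  by apply: ler_wiXn2l => //; exact: ltW.
have h3 := ab_tri (T s ^+ nu) (x k.+1) 0; rewrite !subr0 in h3.
have h4 : L * (K * ab (x k) ^+ 2) <= (1 - mu0) / 2 * ab (x k).
  rewrite expr2 !mulrA ler_wpM2r ?ab_ge0 //.
  have := N3P k k3; rewrite ler_pdivlMr; last lra.
  apply: le_trans; rewrite mulrC ler_wpM2l ?ab_ge0 //; lra.
lra.
Qed.

Variables (rho e : R).
Hypotheses (rho0 : 0 < rho) (e0 : 0 < e)
  (limit : forall z, box rho e z ->
    (forall h : R, 0 < h -> exists2 w, arc rho w & forall i, ab (w 0 i - z 0 i) <= h) -> arc rho z).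
Hypotheses (HT : small1 (fun w => H (cpt d w) = cpt d (T' w))) (HF : small (fun z => H (F z) = z)).

(* The curve attracts the backward orbit: an error [K |x|^M] at time [k + j] is multiplied
   by at most [L mu^M <= 1/2] for each step back in time. *)
Lemma orbit_in_arc (LF LH : R) : 0 <= LF -> 0 <= LH -> lipschitz0 F LF -> lipschitz0 H LH ->
  exists N, forall k, (N <= k)%N -> arc rho (a k).
Proof.
move=> LF0 LH0 FL [r r0 HL].
have [mu /andP[mu_ge0 mu_lt1] [N1 N1P]] := orbit_contracts LF0 FL.
have [M MP] : exists M, LH * mu ^+ M.+1 <= 2^-1.
  have l0 : 0 < (2 * (1 + LH))^-1 by rewrite invr_gt0; lra.
  have [M MP] := geometric_small mu_ge0 mu_lt1 l0; exists M.
  have /ltW := MP M.+1 (leqnSn M); rewrite invfM -ler_pdivrMr ?invr_gt0; last lra.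
  rewrite invrK => h; apply: le_trans _ h; rewrite mulrC ler_wpM2l ?exprn_ge0 //; lra.
have [K K0 [N2 N2P]] := orbit_close M.+1.
have Sd : small1 (fun w => pdisc r (cpt d w)) by apply: small_curve => //; exists r.
have [q1 q10 q1P] := small1_and Sd HT.
have rho2 : 0 < rho / 2 by rewrite divr_gt0.
pose q := Num.min q1 (rho / 2).
have q0 : 0 < q by exact: min_gt0.
have /andP[_ ml] := min_boundl q10 rho2; have /andP[_ mr] := min_boundr q10 rho2.
have Sr : small (pdisc r : 'rV[C]_n -> Prop) by exists r.
have [N3 N3P] := orbit_small (small_and Sr HF).
have [|N4 N4P] := @orbit_x_small 1; first exact: ltr01.
have [|N5 N5P] := @orbit_x_small (q ^+ nu / (1 + K)); first by rewrite divr_gt0 ?exprn_gt0 //; lra.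
have Sb : small (box rho e).
  apply: open_small; first exact: box_open.
  by split=> [|i]; rewrite mxE ab0 // exprn_gt0.
have [N6 N6P] := orbit_small Sb.
pose N := maxn (maxn (maxn N1 N2) (maxn N3 N4)) (maxn N5 N6).
(* [err j k] bounds the distance from [a k] to the curve after the estimate at time k + j has been
   pulled back [j] times. *)
exists N; pose err (j k : nat) := K * 2^-1 ^+ j * ab (x k) ^+ M.+1.
have half1 j : 2^-1 ^+ j <= 1 :> R by rewrite exprn_ile1 //; lra.
have half0 j : 0 <= 2^-1 ^+ j :> R by rewrite exprn_ge0 //; lra.
have err0 j k : 0 <= err j k by rewrite /err !mulr_ge0 // exprn_ge0 // ab_ge0.
(* The approximating points must stay where [H] is known along the curve. Since |x| <= 1, the error
   is at most K |x|, hence |y|^nu <= (1 + K) |x| <= q^nu. *)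
have yq j k y : (N <= k)%N -> ab (a k 0 i0 - cpt d y 0 i0) <= err j k -> ab y <= q.
  rewrite !geq_max => /andP[/andP[_ /andP[_ k4]] /andP[k5 _]]; rewrite (cpt_i0 di0) => ye.
  rewrite -(ab_root_le nu0) ?(ltW q0) // -abX.
  have h1 : err j k <= K * ab (x k).
    rewrite /err exprS -mulrA ler_wpM2l //.
    rewrite mulrCA ler_piMr ?ab_ge0 // mulr_ile1 ?exprn_ge0 ?ab_ge0 // exprn_ile1 ?ab_ge0 //.
    exact: N4P.
  have := N5P k k5; rewrite ler_pdivlMr; last lra.
  have := ab_tri (x k) (y ^+ nu) 0; rewrite !subr0 (abBC (y ^+ nu)); lra.
have claim j : forall k, (N <= k)%N -> exists2 y, ab y <= q &
    forall i, ab (a k 0 i - cpt d y 0 i) <= err j k.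
  elim: j => [|j IH] k kN; have := kN; rewrite !geq_max => /andP[/andP[/andP[k1 k2] /andP[k3 k4]] _].
    have [s [_ sP]] := N2P k k2.
    have sP' i : ab (a k 0 i - cpt d s 0 i) <= err 0%N k by rewrite /err expr0 mulr1.
    by exists s => //; exact: (yq 0%N k).
  have [y yq' yP] := IH k.+1 (leqW kN).
  have [yr HE] := q1P y (le_trans yq' ml).
  have k3' : (N3 <= k.+1)%N by exact: leqW.
  have [ar _] := N3P _ k3'; have [_ HFE] := N3P _ k3.
  have := HL _ _ _ ar yr (err0 j k.+1) yP; rewrite aF HFE HE => yP'.
  have {}yP' i : ab (a k 0 i - cpt d (T' y) 0 i) <= err j.+1 k.
    apply: le_trans (yP' i) _; rewrite /err.
    apply: (@le_trans _ _ (LH * (K * 2^-1 ^+ j * (mu ^+ M.+1 * ab (x k) ^+ M.+1)))).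
      rewrite ler_wpM2l // ler_wpM2l ?mulr_ge0 // -exprMn.
      by rewrite lerXn2r ?nnegrE ?mulr_ge0 ?ab_ge0 // N1P.
    have -> : LH * (K * 2^-1 ^+ j * (mu ^+ M.+1 * ab (x k) ^+ M.+1)) =
      (LH * mu ^+ M.+1) * (K * 2^-1 ^+ j * ab (x k) ^+ M.+1) by ring.
    rewrite [2^-1 ^+ j.+1]exprS.
    have -> : K * (2^-1 * 2^-1 ^+ j) * ab (x k) ^+ M.+1 = 2^-1 * (K * 2^-1 ^+ j * ab (x k) ^+ M.+1) by ring.
    by rewrite ler_wpM2r //; exact: err0.
  by exists (T' y) => //; exact: (yq j.+1 k).
(* At fixed [k], letting [j] grow puts points of the arc arbitrarily close to [a k]; as q <= rho /
   2, their parameters remain inside the arc. *)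
move=> k kN; apply: limit; first by apply: N6P; move: kN; rewrite !geq_max => /andP[_ /andP[]].
move=> h h0; have [j jP] := half_pow_small (K * ab (x k) ^+ M.+1) h0.
have [y yq' yP] := claim j k kN; exists (cpt d y).
  by exists y => //; apply: le_lt_trans yq' (le_lt_trans mr _); lra.
move=> i; rewrite abBC; apply: le_trans (yP i) _; apply/ltW/le_lt_trans/(jP j (leqnn j)).
by rewrite /err mulrAC.
Qed.

End Orbit.
End Dynamics.

(** * Assembly of the proof: choice of the parameter, of the radius and of the charts *)

Section Linearized.
Context {R : realType} {n : nat}.
Local Notation C := (Cplx R).

Lemma linearized_forward (F : 'rV[C]_n -> 'rV[C]_n) (c : 'I_n -> fps C 1) (lam : C) :
    holo0 F -> const0 c -> (forall i, convergent (c i)) ->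
    (forall i, fps_comp (jet F i) c = fps_comp (c i) (fun=> fpsC lam * X1)) ->
  small1 (fun x => F (cpt c x) = cpt c (lam * x)).
Proof.
move=> hF c0 cc cF.
have S1 := small_curve c0 cc (jet_ev hF).
have S2 : small1 (fun x => forall j, ev1 (fps_comp (jet F j) c) x = ev (jet F j) (cpt c x)).
  by apply: small1_all => j; apply: ev1_comp_curve => //; exact: convergent_jet.
have S3 : small1 (fun x => forall j, ev1 (rot lam (c j)) x = ev1 (c j) (lam * x)).
  by apply: small1_all => j; exact: ev1_rot.
apply: small1_imp (small1_and S1 (small1_and S2 S3)) => x [-> [E2 E3]].
apply/rowP => j; rewrite cptE -E3 mxE -E2 cF //.
Qed.

(** A point c(x) is the image under [F] of c(x / lam), which lies in [U] for small x. *)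
Lemma linearized_backward (U : set 'rV[C]_n) (F H : 'rV[C]_n -> 'rV[C]_n) (c : 'I_n -> fps C 1) (lam : C) :
    open U -> U 0 -> (forall z, U z -> H (F z) = z) -> lam != 0 ->
    const0 c -> (forall i, convergent (c i)) -> small1 (fun x => F (cpt c x) = cpt c (lam * x)) ->
  small1 (fun x => H (cpt c x) = cpt c (lam^-1 * x)).
Proof.
move=> Uo U0 HF lam0 c0 cc cF.
have S1 := small1_scale lam^-1 (small_curve c0 cc (open_small Uo U0)).
apply: small1_imp (small1_and S1 (small1_scale lam^-1 cF)) => x [Ux E].
by rewrite -[RHS](HF _ Ux) E mulVKf.
Qed.

(** One coordinate must serve both cases: it is nonzero along the curve and, when the curve is
    nonsingular, of order 1, so that nu = 1 afterwards. *)
Lemma curve_coordinate (c : 'I_n -> fps C 1) Gamma : parametrizes c Gamma ->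
  exists i, c i <> 0 /\ (nonsingular Gamma -> coef1 (c i) 1 <> 0).
Proof.
move=> cG; have [ns|ns] := pselect (nonsingular Gamma).
  have [i ci] := nonsingular_param ns cG; exists i; split=> // c0; apply: ci.
  by rewrite c0 coef1_0.
by have [[[_ [i ci]] _] _] := cG; exists i.
Qed.

End Linearized.

Theorem proposition2 (R : realType) (n : nat)
    (U : set 'rV[Cplx R]_n) (F : 'rV[Cplx R]_n -> 'rV[Cplx R]_n)
    (Gamma : set (fps (Cplx R) n)) (lam : Cplx R)
    (F_diff : diffeo_germ U F) (Gamma_curve : formal_curve Gamma)
    (Gamma_inv : invariant_curve F Gamma) (lamE : multiplier F Gamma lam) (lam_lt1 : `|lam| < 1) :
  analytic_curve Gamma /\
  exists V B : set 'rV[Cplx R]_n,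
    [/\ represents B Gamma,
        stable_set U F V B,
        stable_manifold U F V (B `\ 0),
        (nonsingular Gamma -> stable_manifold U F V B)
      & forall a : nat -> 'rV[Cplx R]_n,
          nontrivial_orbit U F a -> asymptotic a Gamma ->
          \forall k \near \oo, B (a k)].
Proof.
have [U0 F0 [W [Uo _ _ _]]] := F_diff.
have hF := diffeo_holo0 F_diff.
have [H [hH HF F_inj]] := diffeo_inverse F_diff.
have lam1 : ab lam < 1 by apply/ab_ltP.
have [/eqP lam0 [c [cG cc cF]]] := normal_param F_diff lamE lam1.
have c0 := parametrizes0 cG.
have [i0 [ci0 ns_i0]] := curve_coordinate cG.
have [nu [s [h [nu0 nu1 [sc hc] [s0 s1 h0 h1] [_ chE hsE]]]]] := power_reparam (cc i0) (c0 i0) ci0.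
have [zeta zP] := @primitive_root_exists R nu nu0.
pose d := reparam c h.
have dG : parametrizes d Gamma by exact: parametrizes_reparam.
have d0 : const0 d by exact: parametrizes0 dG.
have dc i : convergent (d i) by apply: convergent_comp => //; exact: const0_1.
have di0 : d i0 = X1 ^+ nu by exact: chE.
have cF' := linearized_forward hF c0 cc cF.
have cH := linearized_backward Uo U0 HF lam0 c0 cc cF'.
have FT := reparam_dynamics c0 cc sc hc s0 h0 hsE cF'.
have HT := reparam_dynamics c0 cc sc hc s0 h0 hsE cH.
(* Halfway between |lam| and 1: the map in the parameter of [d] has derivative [lam] at 0, and the
   margin absorbs its terms of higher order. *)
pose mu0 := (1 + ab lam) / 2.
have lam_ge0 := ab_ge0 lam.
have mu00 : 0 <= mu0 by rewrite /mu0; lra.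
have mu01 : mu0 < 1 by rewrite /mu0; lra.
have Tmu : small1 (fun w => ab (ev1 (fps_comp s (fun=> fpsC lam * h)) w) <= mu0 * ab w).
  have lh0 : (fpsC lam * h) mnm0 = 0 by rewrite fpsC_mul h0 mulr0.
  apply: ev1_contracts.
  - apply: convergent_comp => [||_]; [exact: const0_1 | exact: sc |].
    by apply: convergentM => //; exact: convergentC.
  - by rewrite fps_comp_const ?s0 //; exact: const0_1.
  - rewrite coef1_comp1 // coef1CM mulrCA.
    have := congr1 (fun f => coef1 f 1) hsE; rewrite coef1_comp1 // coef1_X /= mulrC => ->.
    by rewrite mulr1 /mu0; lra.
have [eU eU0 UP] := open_small Uo U0.
(* Taking [eU] as the size of the box keeps it inside [U]. *)
have [r1 r10 P1] := arc_equations nu0 d0 dc di0 zP eU0.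
have [r2 r20 P2] := arc_stable d0 dc mu00 mu01 FT Tmu.
have [r3 r30 P3] : exists2 r : R, 0 < r & forall x, ab x < r -> (x != 0 ->
    forall j : 'I_nu, (0 < j)%N -> cpt d (zeta ^+ j * x) <> cpt d x) /\ forall i, hol1 (ev1 (d i)) x.
  apply: small1_radius; apply: small1_and; first exact: (sheets_distinct nu0 d0 dc zP dG).
  apply: small1_all => i; have [r r0 dr] := iffLR (convergentP (d i)) (dc i).
  by exists (r / 4) => [|x xr]; [rewrite divr_gt0 | apply: hol1_ev1 dr xr].
pose rho := Num.min r1 (Num.min r2 r3).
have r230 := min_gt0 r20 r30.
have rho0 : 0 < rho by exact: min_gt0.
have /andP[_ rho1] := min_boundl r10 r230; have /andP[_ rho23] := min_boundr r10 r230.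
have /andP[_ rho2] := min_boundl r20 r30; have /andP[_ rho3] := min_boundr r20 r30.
have {}P1 := P1 rho; rewrite rho0 rho1 in P1; have [arc_box arcE eqn_hol] := P1 isT.
have [F_arc arc_cvg] := P2 rho (le_trans rho23 rho2).
have {}P3 x : ab x < rho -> _ := fun xr => P3 x (lt_le_trans xr (le_trans rho23 rho3)).
pose V := box i0 nu rho eU; pose B := arc d rho.
have V0 : V 0 by apply: arc_box; exact: (arc0 d0 rho0).
have VU : V `<=` U by move=> z [_ zV]; apply: UP => i; apply: ltW.
have Vo : open V by exact: box_open.
have B_rep : represents B Gamma.
  exact: (arc_represents nu0 d0 dc di0 rho0 arc_box arcE eqn_hol dG).
have B_stable : stable_set U F V B by split.
have B_limit := arc_limit arc_box arcE eqn_hol.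
have n1 : (1 <= n)%N by apply: leq_ltn_trans (ltn_ord i0).
(* For nu = 1 there is no other sheet to separate, and the chart exists at the parameter 0 as
   well. *)
have chart x : ab x < rho -> x != 0 \/ nu = 1%N -> exists W W' (phi : 'rV[Cplx R]_n -> 'rV[Cplx R]_n),
    [/\ W (cpt d x), (x != 0 -> forall z, W z -> z <> 0), biholomorphic W W' phi
    & forall z, W z -> (arc d rho z <-> forall i : 'I_n, (1 <= i)%N -> phi z 0 i = 0)].
  move=> xr xnu; have [Px _] := P3 x xr.
  apply: (chart_at nu0 di0 zP rho0 xr xnu) => [y yr|j j0]; first by have [] := P3 y yr.
  case: xnu => [x0|nuE]; first exact: Px.
  by have := ltn_ord j; rewrite [X in (_ < X)%N]nuE ltnS leqNgt j0.
split; first by exists B.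
exists V, B; split=> //.
- split.
  + split=> //.
    * by move=> z [zB _]; apply: arc_box.
    * move=> _ [z [zB z0] <-]; split; first by apply: F_arc; exists z.
      by move=> Fz; apply: z0; apply: F_inj => //; apply/VU/arc_box.
    * by move=> z [zB _]; exact: arc_cvg.
  + by rewrite setDE; apply: (arc_locally_closed arc_box arcE eqn_hol); exact: open_setD0.
  + exists 1%N; split=> // _ [[x xr ->] x0].
    (* Away from the origin the chart domain avoids 0, so removing 0 from the arc does not change
       its equations there. *)
    have xn : x != 0 by apply: contra_notN x0 => /eqP ->; exact: (cpt0 d0).
    have [W1 [W' [phi [W1x /(_ xn) W10 bih W1P]]]] := chart x xr (or_introl xn).
    exists W1, W', phi; split=> // z W1z; split; first by move=> [zB _]; apply/W1P.
    by move=> zphi; split; [apply/W1P | exact: W10].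
- move=> ns; have nuE := nu1 (ns_i0 ns); split=> //.
  + by rewrite -[B]setIT; apply: (arc_locally_closed arc_box arcE eqn_hol); exact: openT.
  + exists 1%N; split=> // _ [x xr ->].
    have [W1 [W' [phi [W1x _ bih W1P]]]] := chart x xr (or_intror nuE).
    by exists W1, W', phi.
- move=> a [aU aF _] aG.
  have [LF LF0 FL] := holo0_lipschitz hF; have [LH LH0 HL] := holo0_lipschitz hH.
  have HF' : small (fun z => H (F z) = z) by exists eU => // z /UP; exact: HF.
  have [N NP] := orbit_in_arc nu0 d0 dc di0 zP dG mu00 mu01 FT Tmu aF aG rho0 eU0 B_limit HT HF' LF0 LH0 FL HL.
  by exists N => // k /NP.
Qed.
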